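(* Let $(\widetilde M^n,\widetilde g)$ be a Lorentzian manifold with essentially parallel Weyl tensor of the form $(\mathbb{R}^2\times V,\ \kappa\,dt^2+dt\,ds+\Theta)$ described in the context, built from $V$, a periodic function $f$ and an operator $A\in\operatorname{End}(V)$. Then the identity component $\operatorname{Isom}^0(\widetilde M^n,\widetilde g)$ of the isometry group is isomorphic to the semidirect product $\mathcal S\,{}_{\exp}\!\ltimes \operatorname{He}(n-2)$, where $\mathcal S\subset\operatorname{SO}(n-2)$ is a connected Lie subgroup with Lie algebra $$\mathfrak s=\operatorname{span}\{F\in\mathfrak{so}(n-2)\ |\ [A,F]=0\},$$ which is non-trivial if and only if $A$ has at least one eigenspace of dimension greater than one.
   Context: Throughout $n\ge 4$. A semi-Riemannian manifold has essentially parallel Weyl tensor if its Weyl tensor $W$ is parallel ($\nabla W=0$), and it is neither conformally flat ($W=0$) nor locally symmetric ($\nabla\mathcal R=0$, $\mathcal R$ the curvature tensor). Here $V$ is a real vector space of dimension $n-2$ with a Euclidean inner product $\langle\cdot,\cdot\rangle$; $t,s$ are the Cartesian coordinates on $\mathbb{R}^2$; $dt\,ds$ is the symmetric product (so $\widetilde g(\partial_t,\partial_s)=\tfrac12$); $\Theta$ is the pullback of $\langle\cdot,\cdot\rangle$ under the projection $\mathbb{R}^2\times V\to V$; and $\kappa(t,s,\psi)=f(t)\langle\psi,\psi\rangle+\langle A\psi,\psi\rangle$, where $f:\mathbb{R}\to\mathbb{R}$ is a smooth periodic function and $A\in\operatorname{End}(V)$ is a nonzero traceless operator, self-adjoint relative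 to $\langle\cdot,\cdot\rangle$. (Such a manifold is never conformally flat, and it is locally symmetric if and only if $f$ is constant; so having essentially parallel Weyl tensor here means that $f$ is non-constant.) $V$ is identified with $\mathbb{R}^{n-2}$ by an orthonormal basis of eigenvectors of $A$, so that $\mathfrak{so}(n-2)$ and $\operatorname{SO}(n-2)$ act on $V$. The group $\mathcal S$ is the connected Lie subgroup of $\operatorname{SO}(n-2)$ generated by $\exp(F)$, $F\in\mathfrak s$ (viewed as a Lie algebra of Killing fields, $\mathfrak s$ carries the negative of the commutator bracket; this does not affect $\mathcal S$). $\operatorname{He}(n-2)$ is the Heisenberg group of matrices $$\begin{pmatrix}1&a^T&c\\0&\mathbb I&b\\0&0&1\end{pmatrix},\qquad a,b\in\mathbb{R}^{n-2},\ c\in\mathbb{R}.$$ The semidirect product $\mathcal S\,{}_{\exp}\!\ltimes\operatorname{He}(n-2)$ is formed with respect to the action of $\mathcal S$ on $\operatorname{He}(n-2)$ by automorphisms in which $\exp(F)$, $F\in\mathfrak s$, sends the matrix with entries $(a,b,c)$ to the one with entries $(e^Fa,e^Fb,c)$. *)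

(* Defs.v *)
From HB Require Import structures.
From mathcomp Require Import all_boot all_order all_algebra.
From mathcomp Require Import sesquilinear.
From mathcomp Require Import all_classical all_reals all_analysis.

Set Implicit Arguments.
Unset Strict Implicit.
Unset Printing Implicit Defensive.

Import Order.TTheory GRing.Theory Num.Theory.
Import numFieldNormedType.Exports.

Local Open Scope classical_set_scope.
Local Open Scope ring_scope.

Section Smoothness.
Variables (R : realType) (N : nat).

Definition partial (i : 'I_N) (F : 'rV[R]_N -> R) (x : 'rV[R]_N) : R :=
  'D_(delta_mx 0 i) F x.

Fixpoint Ck (k : nat) (F : 'rV[R]_N -> R) : Prop :=
  if k is k'.+1 then
    continuous F /\
    forall i, (forall x, derivable F x (delta_mx 0 i)) /\ Ck k' (partial i F)
  else continuous F.

Definition smooth (F : 'rV[R]_N -> R) : Prop := forall k, Ck k F.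

Definition smooth_map (phi : 'rV[R]_N -> 'rV[R]_N) : Prop :=
  forall j, smooth (fun x => phi x 0 j).

End Smoothness.

Definition smooth_line (R : realType) (f : R -> R) : Prop :=
  forall k x, derivable (derive1n k f) x 1.

(* Tensor calculus in a global coordinate system on R^N; g x is the matrix of
   the metric at x in the coordinate frame.  Covariant tensor fields of rank 4
   are given by their components, the point being the last argument. *)
Section TensorCalculus.
Variables (R : realType) (N : nat) (g : 'rV[R]_N -> 'M[R]_N).
Implicit Types (x : 'rV[R]_N) (T : 'I_N -> 'I_N -> 'I_N -> 'I_N -> 'rV[R]_N -> R).

Definition christoffel (k i j : 'I_N) x : R :=
  2^-1 * \sum_l invmx (g x) k l *
    (partial i (fun y => g y j l) x + partial j (fun y => g y i l) x
     - partial l (fun y => g y i j) x).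

(* The coefficient of d_l in Rm(d_i, d_j) d_k, where
   Rm(X, Y) Z = nabla_X nabla_Y Z - nabla_Y nabla_X Z - nabla_[X,Y] Z. *)
Definition curvature_up (l k i j : 'I_N) x : R :=
  partial i (christoffel l j k) x - partial j (christoffel l i k) x
  + \sum_p (christoffel l i p x * christoffel p j k x
            - christoffel l j p x * christoffel p i k x).

(* g(Rm(d_i, d_j) d_k, d_l) *)
Definition curvature (l k i j : 'I_N) x : R :=
  \sum_p g x l p * curvature_up p k i j x.

Definition ricci (k j : 'I_N) x : R := \sum_i curvature_up i k i j x.

Definition scalar_curvature x : R :=
  \sum_k \sum_j invmx (g x) k j * ricci k j x.

Definition weyl (l k i j : 'I_N) x : R :=
  curvature l k i j x
  - (N%:R - 2)^-1 *
      (g x l i * ricci k j x - g x l j * ricci k i x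
       + g x k j * ricci l i x - g x k i * ricci l j x)
  + scalar_curvature x / ((N%:R - 1) * (N%:R - 2)) *
      (g x l i * g x k j - g x l j * g x k i).

(* Component (m; a, b, c, d) of nabla T for a rank 4 covariant tensor T. *)
Definition nabla4 T (m a b c d : 'I_N) x : R :=
  partial m (T a b c d) x
  - \sum_p (christoffel p m a x * T p b c d x
            + christoffel p m b x * T a p c d x
            + christoffel p m c x * T a b p d x
            + christoffel p m d x * T a b c p x).

Definition parallel4 T : Prop := forall m a b c d x, nabla4 T m a b c d x = 0.

Definition conformally_flat : Prop := forall l k i j x, weyl l k i j x = 0.

Definition locally_symmetric : Prop := parallel4 curvature.

Definition essentially_parallel_weyl : Prop :=
  [/\ parallel4 weyl, ~ conformally_flat & ~ locally_symmetric].

End TensorCalculus.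

Section Isometries.
Variables (R : realType) (N : nat) (g : 'rV[R]_N -> 'M[R]_N).

(* Row i holds the components of d_i phi. *)
Definition jacobian_mx (phi : 'rV[R]_N -> 'rV[R]_N) (x : 'rV[R]_N) : 'M[R]_N :=
  \matrix_(i, k) partial i (fun y => phi y 0 k) x.

Definition pullback_metric (phi : 'rV[R]_N -> 'rV[R]_N) (x : 'rV[R]_N) :
  'M[R]_N := jacobian_mx phi x *m g (phi x) *m (jacobian_mx phi x)^T.

Definition diffeomorphism (phi : 'rV[R]_N -> 'rV[R]_N) : Prop :=
  exists psi, [/\ cancel phi psi, cancel psi phi, smooth_map phi
                & smooth_map psi].

(* The Lie group topology of the isometry group is the compact-open one. *)
Definition Isom : set {compact-open, 'rV[R]_N -> 'rV[R]_N} :=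
  [set phi | diffeomorphism phi /\ forall x, pullback_metric phi x = g x].

Definition Isom0 : set {compact-open, 'rV[R]_N -> 'rV[R]_N} :=
  connected_component Isom idfun.

End Isometries.

(* Isomorphism of topological groups, each given as a subset (with the subspace
   topology) of an ambient space together with a multiplication.  For Lie groups
   this is isomorphism of Lie groups, as continuous homomorphisms between them
   are smooth. *)
Definition topgroup_isomorphic (T U : topologicalType)
    (G : set T) (mulG : T -> T -> T) (H : set U) (mulH : U -> U -> U) : Prop :=
  exists (F : T -> U) (F' : U -> T),
    [/\ [/\ forall x, G x -> H (F x), forall y, H y -> G (F' y),
            forall x, G x -> F' (F x) = x & forall y, H y -> F (F' y) = y],
        forall x y, G x -> G y -> F (mulG x y) = mulH (F x) (F y),
        {within G, continuous F} & {within H, continuous F'}].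

Section MatrixGroups.
Variables (R : realType) (m : nat).
Implicit Types (C F : 'M[R]_m) (G H : set 'M[R]_m).

Definition expmx F : 'M[R]_m :=
  lim (series (fun k => k`!%:R^-1 *: F ^+ k) @ \oo).

Definition so : set 'M[R]_m := [set F | F^T = - F].

Definition SO : set 'M[R]_m := [set C | C^T *m C = 1%:M /\ \det C = 1].

Definition mx_span (X : set 'M[R]_m) : set 'M[R]_m :=
  [set F | exists (k : nat) (c : 'I_k -> R) (B : 'I_k -> 'M[R]_m),
     (forall i, X (B i)) /\ F = \sum_i c i *: B i].

Definition mx_subgroup G H : Prop :=
  [/\ H `<=` G, H 1%:M, forall C D, H C -> H D -> H (C *m D)
    & forall C, H C -> H (invmx C)].

Definition lie_algebra_of H : set 'M[R]_m :=
  [set F | forall t : R, H (expmx (t *: F))].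

(* A subgroup that is closed in the matrix group G is an (embedded) Lie
   subgroup by Cartan's theorem, and its Lie group topology is then the subspace
   topology. *)
Definition connected_lie_subgroup G H : Prop :=
  [/\ mx_subgroup G H, (exists2 K, closed K & H = G `&` K) & connected H].

Definition centralizer_algebra (A : 'M[R]_m) : set 'M[R]_m :=
  mx_span [set F | so F /\ A *m F - F *m A = 0].

Definition centralizer_group (A : 'M[R]_m) : set 'M[R]_m :=
  smallest (mx_subgroup SO) (expmx @` centralizer_algebra A).

Definition heis_mx (a b : 'cV[R]_m) (c : R) : 'M[R]_(1 + (m + 1)) :=
  block_mx 1%:M (row_mx a^T c%:M) 0 (block_mx 1%:M b 0 1%:M).

Definition He : set 'M[R]_(1 + (m + 1)) :=
  [set M | exists a b c, M = heis_mx a b c].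

(* (a, b, c) |-> (C a, C b, c) *)
Definition heis_act C (M : 'M[R]_(1 + (m + 1))) : 'M[R]_(1 + (m + 1)) :=
  heis_mx (C *m (lsubmx (ursubmx M))^T) (C *m ursubmx (drsubmx M))
          (rsubmx (ursubmx M) 0 0).

Definition sdprod_He (S : set 'M[R]_m) : set ('M[R]_m * 'M[R]_(1 + (m + 1))) :=
  S `*` He.

Definition sdprod_He_mul (x y : 'M[R]_m * 'M[R]_(1 + (m + 1))) :
  'M[R]_m * 'M[R]_(1 + (m + 1)) :=
  (x.1 *m y.1, x.2 *m heis_act x.1 y.2).

End MatrixGroups.

Section PlaneWaveModel.
Variables (R : realType) (V : vectType R) (ip : {dot V for idfun}).
Variables (f : R -> R) (A : 'End(V)).

(* Matrix acting on column vectors of coordinates. *)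
Definition end_mx (m : nat) (e : m.-tuple V) : 'M[R]_m :=
  \matrix_(i, j) coord e i (A e`_j).

Definition end_trace : R := \tr (end_mx (vbasis {:V})).

(* The manifold R^2 x V is described by its global coordinates (t, s, x), where
   x lists the components of psi in a basis e of V. *)
Variables (m : nat) (e : m.-tuple V).

Definition coord_t (x : 'rV[R]_(2 + m)) : R := x 0 (lshift m 0).

Definition coord_psi (x : 'rV[R]_(2 + m)) : V :=
  \sum_(i < m) x 0 (rshift 2 i) *: e`_i.

Definition kappa (x : 'rV[R]_(2 + m)) : R :=
  f (coord_t x) * ip (coord_psi x) (coord_psi x)
  + ip (A (coord_psi x)) (coord_psi x).

(* Matrix of kappa dt^2 + dt ds + Theta; dt ds is the symmetric product, whence
   the off-diagonal entries 1/2. *)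
Definition wave_metric (x : 'rV[R]_(2 + m)) : 'M[R]_(2 + m) :=
  block_mx
    (\matrix_(i < 2, j < 2)
       if i != j then 2^-1 else if i == 0 then kappa x else 0)
    0 0
    (\matrix_(i < m, j < m) ip e`_i e`_j).

End PlaneWaveModel.

(* Main.v *)
(* In coordinates [(t, s, x)] adapted to the orthonormal eigenbasis, with [a_i] the
   eigenvalues of [A], the metric is [kappa dt^2 + dt ds + sum dx_i^2] with
   [kappa = sum (f(t) + a_i) x_i^2].  The Koszul formula expresses the second
   derivatives of an isometry by its first ones, and forces the isometry to map [t]
   to [alpha t + q] with [alpha^2 = 1] and [f (alpha t + q) = f t].  When [alpha = 1]
   and [q = 0] it has the form
     [(t, s, x) |-> (t, s - 2 <u', C x> - <u, u'> + c, C x + u)],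
   where [C] is orthogonal and commutes with [A], and [u'' = (f + A) u].  As [f] is
   not constant, connectedness yields [alpha = 1], [q = 0] and determinant one for
   the restrictions of [C] to the eigenspaces of [A].  A solution [u] amounts to the
   pair [(u(0), u'(0))], and composition of isometries turns into the product of
   the Heisenberg group because the Wronskian of two solutions is constant.
   Conversely, the matrices [C] are products of rotations in planes contained in
   eigenspaces; these are exponentials of elements of the centralizer, which
   identifies the group of all [C] with [S] and shows that it is connected. *)

Require Import Defs.
From HB Require Import structures.
From mathcomp Require Import all_boot all_order all_algebra.
From mathcomp Require Import sesquilinear.
From mathcomp Require Import all_classical all_reals all_analysis.
From mathcomp Require Import ring lra.

Set Implicit Arguments.
Unset Strict Implicit.
Unset Printing Implicit Defensive.

Import Order.TTheory GRing.Theory Num.Theory.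
Import numFieldNormedType.Exports.

Local Open Scope classical_set_scope.
Local Open Scope ring_scope.

(** * Directional derivatives *)

(** The classification rests on the vanishing of the gradient of $\kappa$ on the line $x = 0$, $s =
    0$: comparing a second derivative of the isometry there with its value one unit away in
    direction $x_i$ yields equations $(f(t) + a_i) r = 0$ for all $t$, and as $f$ is not constant,
    $r = 0$. Non-constancy comes from the assumption that the metric is not locally symmetric, since
    for constant $f$ the curvature is computed and found parallel. The scale $\alpha$ is controlled
    by the trace and by $A \ne 0$: the orthogonal linear part $C$ satisfies $\alpha^2 (f(\alpha t +
    q) + A) C = C (f(t) + A)$; comparing traces gives the rule for $f$, comparing Hilbert-Schmidt
    norms gives $\alpha^4 = 1$. The solutions $u$ have to exist on the whole line; periodicity
    bounds $f$, and Picard iteration then converges globally in an exponentially weighted norm. The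
    topological part avoids derivatives: all parameters of an isometry are read off from its values
    at finitely many points, and evaluations are continuous in the compact-open topology. *)

Lemma is_derive_ext (R : numFieldType) (V W : normedModType R) (F G : V -> W) x v a :
  F =1 G -> is_derive x v F a -> is_derive x v G a.
Proof. by move=> /funext ->. Qed.

Section DirectionalDerivatives.
Variables (R : realType) (V : normedModType R).
Implicit Types (F G : V -> R) (x v : V) (h : R -> R).

Lemma is_deriveDr F G x v a b : is_derive x v F a -> is_derive x v G b ->
  is_derive x v (fun y => F y + G y) (a + b).
Proof. by move=> dF dG; exact: (is_deriveD dF dG). Qed.

Lemma is_deriveNr F x v a : is_derive x v F a ->
  is_derive x v (fun y => - F y) (- a).
Proof. by move=> dF; exact: (is_deriveN dF). Qed.

Lemma is_deriveBr F G x v a b : is_derive x v F a -> is_derive x v G b ->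
  is_derive x v (fun y => F y - G y) (a - b).
Proof. by move=> dF dG; exact: (is_deriveB dF dG). Qed.

Lemma is_deriveMr F G x v a b : is_derive x v F a -> is_derive x v G b ->
  is_derive x v (fun y => F y * G y) (a * G x + F x * b).
Proof.
move=> dF dG; apply: (is_derive_eq (is_deriveM dF dG)).
by rewrite /GRing.scale /= addrC [G x * a]mulrC.
Qed.

Lemma is_deriveZr F x v a (c : R) : is_derive x v F a ->
  is_derive x v (fun y => c * F y) (c * a).
Proof. by move=> dF; exact: (is_deriveZ c dF). Qed.

Lemma is_derive_sumr n (F : 'I_n -> V -> R) x v (a : 'I_n -> R) :
  (forall i, is_derive x v (F i) (a i)) ->
  is_derive x v (fun y => \sum_(i < n) F i y) (\sum_(i < n) a i).
Proof.
move=> dF; have := is_derive_sum dF.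
by congr is_derive; apply/funext => y; rewrite fct_sumE.
Qed.

(** Both difference quotients are the same function of [h], so the one-variable chain rule and mean
    value theorem become available along every line, without total differentiability of [F]. *)
Lemma is_derive_lineE F x v d s : is_derive (x + s *: v) v F d <->
  is_derive s 1 (fun r => F (x + r *: v)) d.
Proof.
have E : (fun h : R => h^-1 *: ((F \o shift (x + s *: v)) (h *: v) - F (x + s *: v)))
       = (fun h : R => h^-1 *: (((fun r : R => F (x + r *: v)) \o shift s) (h *: 1)
            - F (x + s *: v))).
  apply/funext => h /=; congr (_ *: (F _ - _)).
  by rewrite [h *: 1]mulr1 scalerDl addrCA.
split=> -[c e]; split; rewrite /derivable /derive ?E // in c e *.
Qed.

Lemma is_derive_comp1 h F x v a b : is_derive (F x) 1 h a -> is_derive x v F b ->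
  is_derive x v (fun y => h (F y)) (a * b).
Proof.
move=> dh dF; rewrite -[x]addr0 -(scale0r v) is_derive_lineE.
apply: (@is_derive1_comp _ h (fun r => F (x + r *: v))).
  by rewrite scale0r addr0.
by apply/is_derive_lineE; rewrite scale0r addr0.
Qed.

Lemma derive0_line F v : (forall x, is_derive x v F 0) ->
  forall x r, F (x + r *: v) = F x.
Proof.
move=> dF x r; rewrite -[in RHS](addr0 x) -[in RHS](scale0r v).
by apply: (is_derive_0_is_cst (f := fun s => F (x + s *: v))) => s; apply/is_derive_lineE.
Qed.

Lemma derivable_line_continuous F v : (forall x, derivable F x v) ->
  forall x, continuous (fun r : R => F (x + r *: v)).
Proof.
move=> dF x r; apply/differentiable_continuous/derivable1_diffP.
by have /derivableP/is_derive_lineE[] := dF (x + r *: v).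
Qed.

Lemma MVT_line F v (dF : V -> R) x (h : R) : 0 < h ->
  (forall y, is_derive y v F (dF y)) ->
  exists2 c, 0 < c < h & F (x + h *: v) - F x = h * dF (x + c *: v).
Proof.
move=> h0 FdF.
have cF : continuous (fun r : R => F (x + r *: v)).
  by apply: derivable_line_continuous => y; have [] := FdF y.
have [c ch e] := @MVT _ (fun r => F (x + r *: v)) (fun r => dF (x + r *: v)) 0 h h0
  (fun r _ => (is_derive_lineE _ _ _ _ _).1 (FdF _)) (continuous_subspaceT cF).
exists c; first by move: ch; rewrite in_itv.
by move: e; rewrite scale0r addr0 subr0 mulrC.
Qed.

(* The second difference [F (x + h u + h v) - F (x + h u) - F (x + h v) + F x]
   equals [h ^ 2] times a value of either mixed derivative near [x]. *)
Lemma mixed_derive_eq F (Fu Fv Fuv Fvu : V -> R) u v x :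
  (forall y, is_derive y u F (Fu y)) -> (forall y, is_derive y v F (Fv y)) ->
  (forall y, is_derive y v Fu (Fuv y)) -> (forall y, is_derive y u Fv (Fvu y)) ->
  {for x, continuous Fuv} -> {for x, continuous Fvu} -> Fuv x = Fvu x.
Proof.
move=> dFu dFv dFuv dFvu cuv cvu.
(* The mean value theorem is used twice: in direction [u'] for the increment of [F] over [h *: v'],
   then in direction [v'] for [Fu']. Exchanging the two directions leaves the second difference
   unchanged. *)
have step (u' v' : V) (Fu' Fuv' : V -> R) (h : R) : 0 < h ->
    (forall y, is_derive y u' F (Fu' y)) -> (forall y, is_derive y v' Fu' (Fuv' y)) ->
    exists c d, [/\ 0 < c < h, 0 < d < h &
      F (x + h *: u' + h *: v') - F (x + h *: u') - F (x + h *: v') + F x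
      = h * (h * Fuv' (x + c *: u' + d *: v'))].
  move=> h0 d1 d2.
  have d3 y : is_derive y u' (fun y => F (y + h *: v') - F y) (Fu' (y + h *: v') - Fu' y).
    apply: is_deriveBr.
    rewrite -[y]addr0 -(scale0r u') is_derive_lineE.
    have /is_derive_lineE := d1 (y + h *: v' + 0 *: u').
    rewrite scale0r !addr0; apply: is_derive_ext => r.
    by rewrite addrAC.
  have [c ch e1] := MVT_line x h0 d3.
  have [d dh e2] := MVT_line (x + c *: u') h0 d2.
  exists c, d; split=> //; rewrite -e2 -e1; ring.
apply/eqP; rewrite -subr_eq0 -normr_le0; apply/ler_addgt0Pl => e e0.
have e20 : 0 < e / 2 by rewrite divr_gt0.
have nb (c d h : R) (w w' : V) : 0 < c < h -> 0 < d < h ->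
    `|c *: w + d *: w'| <= h * (`|w| + `|w'|) :> R.
  move=> /andP[c0 ch] /andP[d0 dh]; rewrite (le_trans (ler_normD _ _)) // !normrZ.
  by rewrite mulrDr lerD // ler_wpM2r // gtr0_norm // ltW.
move/cvgrPdist_lt: cuv => /(_ _ e20) /nbhs_ballP[r1 /= r10 H1].
move/cvgrPdist_lt: cvu => /(_ _ e20) /nbhs_ballP[r2 /= r20 H2].
(* The summand 1 makes [K] positive also for zero directions and the bound [hK] strict, so that the
   intermediate points lie in both balls around [x]. *)
pose K := `|u| + `|v| + 1; have K0 : 0 < K by rewrite ltr_wpDl // addr_ge0.
pose h := Num.min r1 r2 / K; have h0 : 0 < h by rewrite divr_gt0 // lt_min r10.
have hK : h * (`|u| + `|v|) < Num.min r1 r2.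
  rewrite /h mulrAC ltr_pdivrMr // ltr_pM2l ?lt_min ?r10 //; first by rewrite ltrDl.
have [c1 [d1 [c1h d1h e1]]] := step u v Fu Fuv h h0 dFu dFuv.
have [c2 [d2 [c2h d2h e2]]] := step v u Fv Fvu h h0 dFv dFvu.
have e3 : Fuv (x + c1 *: u + d1 *: v) = Fvu (x + c2 *: v + d2 *: u).
  apply: (mulfI (lt0r_neq0 h0)); apply: (mulfI (lt0r_neq0 h0)).
  rewrite -e1 -e2 [x + h *: u + _]addrAC; ring.
have {}H1 := H1 (x + c1 *: u + d1 *: v); have {}H2 := H2 (x + c2 *: v + d2 *: u).
rewrite e3 in H1.
have b1 : `|Fuv x - Fvu (x + c2 *: v + d2 *: u)| < e / 2.
  apply: H1; rewrite -ball_normE /= -addrA opprD addNKr normrN.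
  by rewrite (le_lt_trans (nb _ _ _ _ _ c1h d1h)) // (lt_le_trans hK) // ge_min lexx.
have b2 : `|Fvu x - Fvu (x + c2 *: v + d2 *: u)| < e / 2.
  apply: H2; rewrite -ball_normE /= -addrA opprD addNKr normrN.
  rewrite (le_lt_trans (nb _ _ _ _ _ c2h d2h)) // addrC (lt_le_trans hK) //.
  by rewrite ge_min lexx orbT.
rewrite addr0 (le_trans (ler_distD (Fvu (x + c2 *: v + d2 *: u)) _ _)) //.
by rewrite [e]splitr ltW // ltrD // distrC.
Qed.

End DirectionalDerivatives.

(** * Linear second-order equations *)

Section LinearODE.
Variable R : realType.
Implicit Types (f g h w y : R -> R).

Lemma is_derive_continuous f df : (forall t : R, is_derive t 1 f (df t)) -> continuous f.
Proof. by move=> d t; apply/differentiable_continuous/derivable1_diffP; have [] := d t. Qed.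

Lemma is_derive_oppv f (t d : R) : is_derive (- t) 1 f d ->
  is_derive t 1 (fun s => f (- s)) (- d).
Proof.
move=> df; apply: (is_derive_eq (is_derive_comp1 (F := -%R) df (is_deriveNid _ _))).
by rewrite mulrN1.
Qed.

(** The fundamental theorem of calculus applies to the right of the base point of the integral. The
    base point -1, rather than 0, leaves an overlap with the reflected construction. *)
Lemma antiderivative_gt h : continuous h ->
  exists H, forall t : R, - 1 < t -> is_derive t 1 H (h t).
Proof.
move=> ch; exists (fun t => \int[lebesgue_measure]_(r in [set` `[-1, t]]) h r) => t t1.
have [||d e] := @continuous_FTC1 _ h (BLeft (-1)) t (t + 1) _ _ t1 (ch t).
- by rewrite ltrDl.
- apply: continuous_compact_integrable; first exact: segment_compact.
  exact: continuous_subspaceT.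
by split; rewrite -?derive1E.
Qed.

Lemma derive0_itv f (a b : R) : (forall t, a < t < b -> is_derive t 1 f 0) ->
  forall s t, a < s < b -> a < t < b -> f s = f t.
Proof.
move=> df; suff le s t : a < s < b -> a < t < b -> s < t -> f s = f t.
  move=> s t hs ht; have [st|st|-> //] := ltgtP s t; first exact: le.
  by apply/esym/le.
move=> /andP[as_ sb] /andP[at_ tb] st.
have sub r : s <= r <= t -> a < r < b.
  by move=> /andP[sr rt]; rewrite (lt_le_trans as_) ?(le_lt_trans rt).
have [r|r|c _] := @MVT _ f (fun=> 0) s t st.
- by rewrite in_itv /= => /andP[sr rt]; apply/df/sub; rewrite !ltW.
- apply: derivable_within_continuous => r'.
  by rewrite in_itv /= => /sub /df [].
by rewrite mul0r => /eqP; rewrite subr_eq0 => /eqP.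
Qed.

(** A primitive on $(-1, \infty)$ and the reflection of a primitive of $t \mapsto h(-t)$, valid on
    $(-\infty, 1)$, have a constant difference [D] on $(-1, 1)$ and are glued at 0. *)
Lemma antiderivative h : continuous h ->
  exists2 H, H 0 = 0 & forall t : R, is_derive t 1 H (h t).
Proof.
move=> ch; have [P dP] := antiderivative_gt ch.
have [|Q dQ] := @antiderivative_gt (fun t => h (- t)).
  by move=> t; apply: (continuous_comp (continuousN _)); [exact: cvg_id|exact: ch].
have dQN (t : R) : t < 1 -> is_derive t 1 (fun s => - Q (- s)) (h t).
  move=> t1; apply: is_derive_eq; last exact: opprK.
  by apply/is_deriveNr/is_derive_oppv/is_derive_eq/(congr1 h)/opprK/dQ; rewrite ltrN2.
pose D t := P t + Q (- t).
have cD s t : -1 < s < 1 -> -1 < t < 1 -> D s = D t.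
  apply: derive0_itv => {s t} t /andP[t1 t2].
  apply: (is_derive_ext (F := fun s => P s - (- Q (- s)))) => [s|]; first by rewrite opprK.
  by apply: is_derive_eq (subrr (h t)); apply: is_deriveBr; [exact: dP|exact: dQN].
pose H t := if t < 0 then - Q (- t) + D 0 else P t.
have dH (t : R) : is_derive t 1 H (h t).
  have [t0|t0] := ltP t 0.
    apply: (near_eq_is_derive (f := fun s => - Q (- s) + D 0)).
      near=> s; rewrite /H ifT //; near: s; exact: lt_nbhsl.
    apply: is_derive_eq (addr0 _); apply: is_deriveDr; first exact: (dQN t (lt_trans t0 ltr01)).
  apply: (near_eq_is_derive (f := P)).
    near=> s; rewrite /H; case: ltP => // s0.
    rewrite (cD 0 s) ?ltrN10 ?ltr01 //.
      by rewrite /D addrCA addNr addr0.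
    rewrite (lt_trans s0) // andbT; near: s; apply: lt_nbhsr.
    by rewrite (lt_le_trans _ t0) // ltrN10.
  by apply: dP; rewrite (lt_le_trans _ t0) // ltrN10.
exists (fun t => H t - H 0); first by rewrite subrr.
move=> t; apply: is_derive_eq (subr0 _); exact: is_deriveBr.
Unshelve. all: by end_near. Qed.

(** As [f1] increases and vanishes at 0, [f] is minimal at 0. This is the comparison principle
    behind the weighted bounds of the Picard iteration. *)
Lemma derive2_ge0 f f1 f2 : (forall t : R, is_derive t 1 f (f1 t)) ->
  (forall t : R, is_derive t 1 f1 (f2 t)) -> (forall t, 0 <= f2 t) ->
  f1 0 = 0 -> 0 <= f 0 -> forall t, 0 <= f t.
Proof.
move=> df df1 f2_ge0 f10 f0 t.
have mvt g g1 (a b : R) : (forall t : R, is_derive t 1 g (g1 t)) -> a < b ->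
    exists2 c, a < c < b & g b - g a = g1 c * (b - a).
  move=> dg ab; have [|c] := @MVT _ g g1 a b ab (fun r _ => dg r).
    exact: (continuous_subspaceT (is_derive_continuous dg)).
  by rewrite in_itv /= => cab e; exists c.
rewrite (le_trans f0) // -subr_ge0; have [t0|t0|->] := ltgtP t 0; last by rewrite subrr.
- have [c /andP[_ c0]] := mvt _ _ _ _ df t0; rewrite sub0r => e.
  rewrite -oppr_le0 opprB e mulr_le0_ge0 ?oppr_ge0 ?(ltW t0) //.
  have [d _] := mvt _ _ _ _ df1 c0; rewrite f10 !sub0r => /eqP.
  by rewrite eqr_oppLR => /eqP ->; rewrite oppr_le0 mulr_ge0 // oppr_ge0 ltW.
- have [c /andP[c0 _]] := mvt _ _ _ _ df t0; rewrite subr0 => ->.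
  rewrite mulr_ge0 ?(ltW t0) //.
  have [d _] := mvt _ _ _ _ df1 c0; rewrite f10 !subr0 => ->.
  by rewrite mulr_ge0 // ltW.
Qed.

Lemma second_antiderivative h : continuous h -> exists H H1,
  [/\ H 0 = 0, H1 0 = 0, forall t : R, is_derive t 1 H (H1 t)
    & forall t : R, is_derive t 1 H1 (h t)].
Proof.
move=> /antiderivative [H1 H10 dH1].
have [H H0 dH] := antiderivative (is_derive_continuous dH1).
by exists H, H1.
Qed.

(** The tail is dominated by $\sum_{k \ge n} c\,2^{-k} = 2c\,2^{-n}$; [tail] subtracts the part of
    this sum from $n + k$ on, so that the induction closes exactly. *)
Lemma geometric_tail (u : R^nat) (c : R) : (forall n, `|u n| <= c / 2 ^+ n) ->
  cvgn (series u) /\ forall n, `|limn (series u) - series u n| <= 2 * c / 2 ^+ n.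
Proof.
move=> uc; have c0 : 0 <= c by rewrite -[c]divr1 -(expr0 2) (le_trans _ (uc 0%N)).
have cu : cvgn (series u).
  apply: normed_cvg; apply: (@series_le_cvg _ _ (geometric c 2^-1)) => [n|n|n|].
  - exact: normr_ge0.
  - by rewrite /= mulr_ge0 // exprn_ge0 // invr_ge0.
  - by rewrite /= exprVn.
  - apply: is_cvg_geometric_series; rewrite ger0_norm ?invr_ge0 //.
    by rewrite invf_lt1 // ltr1n.
split=> // n.
have tail k : `|series u (n + k)%N - series u n| <= 2 * c / 2 ^+ n - 2 * c / 2 ^+ (n + k)%N.
  elim: k => [|k IH]; first by rewrite addn0 !subrr normr0.
  have -> : series u (n + k.+1)%N - series u n
            = (series u (n + k)%N - series u n) + u (n + k)%N.
    by rewrite addnS /series /= big_nat_recr //= addrAC.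
  rewrite (le_trans (ler_normD _ _)) // (le_trans (lerD IH (uc _))) //.
  rewrite addnS exprS invfM le_eqVlt; apply/orP; left; apply/eqP.
  set z := (2 ^+ (n + k)%N)^-1; set z' := (2 ^+ n)^-1.
  have -> : 2 * c * (2^-1 * z) = c * z by rewrite mulrACA mulfV // mul1r.
  ring.
have cn : (fun k => `|series u (n + k)%N - series u n|) @ \oo
    --> `|limn (series u) - series u n|.
  apply: cvg_norm; apply: cvgB; last exact: cvg_cst.
  rewrite (_ : (fun k => series u (n + k)%N) = [sequence series u (k + n)%N]_k).
    by rewrite (cvg_shiftn n).
  by apply/funext => k; rewrite addnC.
rewrite -(cvg_lim _ cn) //; apply: limr_le; first by apply/cvg_ex; eexists; exact: cn.
near=> k; apply: le_trans (tail k) _.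
by rewrite gerBl mulr_ge0 ?invr_ge0 ?exprn_ge0 // mulr_ge0.
Unshelve. all: by end_near. Qed.

(** * Picard iteration for $y'' = w y$ on the whole line *)

Section PicardIteration.
Variables (w : R -> R) (M p v : R).
Hypotheses (w_cont : continuous w) (M_gt0 : 0 < M) (w_le : forall t, `|w t| <= M).

(* [weight'' = 2 M weight], so each Picard step halves the constant [B] in a
   bound [B * weight]. *)
Let L := Num.sqrt (2 * M).
Let weight (t : R) := expR (L * t) + expR (- (L * t)).
Let weight1 (t : R) := L * (expR (L * t) - expR (- (L * t))).

Let L_gt0 : 0 < L. Proof. by rewrite sqrtr_gt0 mulr_gt0. Qed.

Let dweight (t : R) : is_derive t 1 weight (weight1 t).
Proof.
have dL : is_derive t 1 (fun s : R => L * s) L.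
  exact: is_derive_eq (is_deriveZr L (is_derive_id t 1)) (mulr1 L).
apply: (is_derive_eq (is_deriveDr (is_derive_comp1 (is_derive_expR _) dL)
  (is_derive_comp1 (is_derive_expR _) (is_deriveNr dL)))).
by rewrite /weight1; ring.
Qed.

Let dweight1 (t : R) : is_derive t 1 weight1 (2 * M * weight t).
Proof.
have dL : is_derive t 1 (fun s : R => L * s) L.
  exact: is_derive_eq (is_deriveZr L (is_derive_id t 1)) (mulr1 L).
have LL : L * L = 2 * M by rewrite -expr2 sqr_sqrtr // mulr_ge0 // ltW.
apply: (is_derive_eq (is_deriveZr L (is_deriveBr (is_derive_comp1 (is_derive_expR _) dL)
  (is_derive_comp1 (is_derive_expR _) (is_deriveNr dL))))).
by rewrite /weight -LL; ring.
Qed.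

Let weight_ge0 t : 0 <= weight t.
Proof. by rewrite addr_ge0 // expR_ge0. Qed.

(** As [B * weight] has second derivative [2 * M * B * weight], both [B * weight + h] and
    [B * weight - h] are convex, and at 0 they are critical and nonnegative; hence they are
    nonnegative everywhere. *)
Let weight_compare (h h1 h2 : R -> R) (B : R) : 0 <= B ->
  (forall t : R, is_derive t 1 h (h1 t)) -> (forall t : R, is_derive t 1 h1 (h2 t)) ->
  h 0 = 0 -> h1 0 = 0 -> (forall t, `|h2 t| <= 2 * M * B * weight t) ->
  forall t, `|h t| <= B * weight t.
Proof.
move=> B0 dh dh1 h0 h10 h2_le t.
have w10 : weight1 0 = 0 by rewrite /weight1 mulr0 oppr0 subrr mulr0.
rewrite ler_norml lerNl -subr_ge0 -[X in _ && X]subr_ge0 opprK; apply/andP; split.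
- apply: (@derive2_ge0 (fun t => B * weight t + h t) (fun t => B * weight1 t + h1 t)
      (fun t => B * (2 * M * weight t) + h2 t)).
  + by move=> s; apply: is_deriveDr; exact: is_deriveZr.
  + by move=> s; apply: is_deriveDr; exact: is_deriveZr.
  + move=> s; have := h2_le s; rewrite ler_norml => /andP[+ _].
    by rewrite lerNl -subr_ge0 opprK; congr (0 <= _); ring.
  + by rewrite w10 h10 mulr0 addr0.
  + by rewrite h0 addr0 mulr_ge0.
- apply: (@derive2_ge0 (fun t => B * weight t - h t) (fun t => B * weight1 t - h1 t)
      (fun t => B * (2 * M * weight t) - h2 t)).
  + by move=> s; apply: is_deriveBr; exact: is_deriveZr.
  + by move=> s; apply: is_deriveBr; exact: is_deriveZr.
  + move=> s; have := h2_le s; rewrite ler_norml => /andP[_].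
    by rewrite -subr_ge0; congr (0 <= _); ring.
  + by rewrite w10 h10 mulr0 subr0.
  + by rewrite h0 subr0 mulr_ge0.
Qed.

(** The solution is the sum of the iterates $y_{n+1}'' = w y_n$ with zero initial data, starting
    from the affine function $p + v t$. The weighted bound halves at each step, so the series
    converges on all of $\mathbb{R}$ and no local solutions have to be glued. *)
Lemma linear_ode_exists : exists y y1,
  [/\ y 0 = p, y1 0 = v, forall t : R, is_derive t 1 y (y1 t)
    & forall t : R, is_derive t 1 y1 (w t * y t)].
Proof.
pose y0 (t : R) := p + v * t.
have dy0 (t : R) : is_derive t 1 y0 v.
  apply: (is_derive_eq (is_deriveDr (is_derive_cst p t 1) (is_deriveZr v (is_derive_id t 1)))).
  by rewrite mulr1 add0r.
have /choice[J HJ] h : exists J : (R -> R) * (R -> R), continuous h ->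
    [/\ J.1 0 = 0, J.2 0 = 0, forall t : R, is_derive t 1 J.1 (J.2 t)
      & forall t : R, is_derive t 1 J.2 (h t)].
  have [ch|nch] := pselect (continuous h); last by exists (h, h).
  by have [H [H1 ?]] := second_antiderivative ch; exists (H, H1).
pose yn := fix yn n := if n is n'.+1 then (J (fun t => w t * yn n' t)).1 else y0.
have cw g : continuous g -> continuous (fun t => w t * g t).
  by move=> cg t; apply: continuousM; [exact: w_cont|exact: cg].
have cyn n : continuous (yn n).
  elim: n => [|n IH]; first exact: is_derive_continuous dy0.
  by have [_ _ d _] := HJ _ (cw _ IH); exact: is_derive_continuous d.
(* As [weight t] is at least 1 and at least $L |t|$, this [B] gives $|p + v t| \le B \cdot$
   [weight t]. *)
pose B : R := `|p| + `|v| / L; have B0 : 0 <= B by rewrite addr_ge0 // divr_ge0 // ltW.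
have yn_le n t : `|yn n t| <= B * weight t / 2 ^+ n.
  rewrite mulrAC; elim: n t => [|n IH] t.
    rewrite expr0 divr1 (le_trans (ler_normD _ _)) // mulrDl lerD //.
      rewrite ler_peMr // /weight.
      have [s|s] := leP 0 (L * t).
        by rewrite -[1]addr0 lerD ?expR_ge0 // -expR0 ler_expR.
      by rewrite -[1]add0r lerD ?expR_ge0 // -expR0 ler_expR oppr_ge0 ltW.
    rewrite normrM -mulrA ler_wpM2l // mulrC -ler_pdivrMr ?invr_gt0 // invrK.
    rewrite -[X in _ * X](gtr0_norm L_gt0) -normrM mulrC /weight.
    have H (s : R) : s <= expR s by rewrite (le_trans _ (expR_ge1Dx s)) // lerDr.
    by case: (ger0P (L * t)) => _; rewrite (le_trans (H _)) // ?lerDl ?lerDr expR_ge0.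
  have [j0 j10 dj dj1] := HJ _ (cw _ (cyn n)).
  apply: (weight_compare _ dj dj1 j0 j10); first by rewrite divr_ge0 // exprn_ge0.
  move=> s; rewrite normrM (le_trans (ler_pM _ _ (w_le s) (IH s))) //.
  by rewrite exprS invfM le_eqVlt; apply/orP; left; apply/eqP; field;
    rewrite expf_neq0 // pnatr_eq0.
pose y t := limn (series (fun n => yn n t)).
pose Y n t := series (fun n => yn n t) n.
have yY n t : `|y t - Y n t| <= 2 * B * weight t / 2 ^+ n.
  by have [_ /(_ n)] := geometric_tail (yn_le ^~ t); rewrite mulrA.
have cY n : continuous (Y n).
  elim: n => [|n IH] t.
    by rewrite (_ : Y 0%N = cst 0); [exact: cst_continuous|]; apply/funext => s; rewrite /Y /series/= big_geq.
  rewrite (_ : Y n.+1 = fun s => Y n s + yn n s); first by apply: continuousD; [exact: IH|exact: cyn].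
  by apply/funext => s; rewrite /Y /series /= big_nat_recr.
have small (c e : R) : 0 < e -> exists n, c / 2 ^+ n < e.
  move=> e0; exists (Num.bound `|c / e|); set n := Num.bound _.
  rewrite ltr_pdivrMr ?exprn_gt0 // mulrC -ltr_pdivrMr //.
  rewrite (le_lt_trans (ler_norm _)) // (lt_le_trans (archi_boundP (normr_ge0 _))) //.
  by rewrite -natrX ler_nat ltnW // ltn_expl.
have cy : continuous y.
  move=> t; apply/cvgrPdist_lt => e e0; have e3 : 0 < e / 3 by rewrite divr_gt0.
  have [n hn] := small (2 * B * (weight t + 1)) _ e3.
  have cwt : weight s @[s --> t] --> weight t := @is_derive_continuous weight weight1 dweight t.
  have wt : \forall s \near t, weight s < weight t + 1.
    by apply: (cvgr_lt (weight t) cwt); rewrite ltrDl.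
  have Yt : \forall s \near t, `|Y n t - Y n s| < e / 3.
    by have /cvgrPdist_lt := cY n t; apply.
  near=> s.
  have ws : weight s < weight t + 1.
    by near: s; exact: wt.
  have tail r : weight r <= weight t + 1 -> `|y r - Y n r| < e / 3.
    move=> wr; apply: le_lt_trans hn; apply: le_trans (yY n r) _.
    by rewrite ler_wpM2r ?invr_ge0 ?exprn_ge0 // ler_wpM2l // mulr_ge0.
  rewrite (_ : y t - y s = (y t - Y n t) + (Y n t - Y n s) - (y s - Y n s)); last by ring.
  rewrite (le_lt_trans (ler_normB _ _)) //.
  rewrite (_ : e = e / 3 + e / 3 + e / 3); last by field.
  rewrite ltrD ?tail ?(ltW ws) // (le_lt_trans (ler_normD _ _)) // ltrD ?tail ?lerDl //.
  by near: s; exact: Yt.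
(* It remains to see that [y] is the affine start plus the double primitive [z] of [w * y]: the
   defect against the partial sum $Y_{n+1}$ has second derivative $w (y - Y_n)$, so it is again of
   order $2^{-n}$. *)
have [z0 z10 dz dz1] := HJ _ (cw _ cy).
set z := (J _).1 in z0 dz; set z1 := (J _).2 in z10 dz dz1.
have zY n : exists d, [/\ d 0 = 0, z 0 + y0 0 - Y n.+1 0 = 0,
   forall t : R, is_derive t 1 (fun t => z t + y0 t - Y n.+1 t) (d t) &
   forall t : R, is_derive t 1 d (w t * (y t - Y n t))].
  elim: n => [|n [d [d0 e0 dz' dd]]].
    exists z1; split=> //.
    - by rewrite /Y /series /= big_nat1 addrK.
    - by move=> t; apply: is_derive_ext (dz t) => s; rewrite /Y /series /= big_nat1 addrK.
    - move=> t; apply: is_derive_eq (dz1 t) _.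
      by rewrite /Y /series /= big_geq // subr0.
  have [j0 j10 dj dj1] := HJ _ (cw _ (cyn n)).
  have YS k t : Y k.+1 t = Y k t + yn k t by rewrite /Y /series /= big_nat_recr.
  exists (fun t => d t - (J (fun t => w t * yn n t)).2 t); split=> /=.
  - by rewrite d0 j10 subrr.
  - by rewrite YS opprD addrA e0 /= j0 subrr.
  - move=> t; apply: is_derive_ext (is_deriveBr (dz' t) (dj t)) => s.
    by rewrite [Y n.+2 s]YS opprD [RHS]addrA.
  - move=> t; apply: is_derive_eq (is_deriveBr (dd t) (dj1 t)) _.
    by rewrite [Y n.+1 t]YS; ring.
have zy t : z t + y0 t = y t.
  apply/eqP; rewrite -subr_eq0 -normr_le0; apply/ler_addgt0Pl => e e0; rewrite addr0.
  have [n hn] := small (2 * B * weight t) _ e0; apply/ltW.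
  have [d [d0 e1 dz' dd]] := zY n.
  have h1 : `|z t + y0 t - Y n.+1 t| <= B / 2 ^+ n * weight t.
    apply: (weight_compare _ dz' dd e1 d0); first by rewrite divr_ge0 // exprn_ge0.
    move=> s; rewrite normrM (le_trans (ler_pM _ _ (w_le s) (yY n s))) //.
    by rewrite le_eqVlt; apply/orP; left; apply/eqP; ring.
  rewrite (_ : z t + y0 t - y t = (z t + y0 t - Y n.+1 t) - (y t - Y n.+1 t)); last by ring.
  rewrite (le_lt_trans (ler_normB _ _)) // (le_lt_trans (lerD h1 (yY _ _))) //.
  apply: le_lt_trans hn; rewrite exprS invfM le_eqVlt; apply/orP; left; apply/eqP.
  by field; rewrite expf_neq0 // pnatr_eq0.
exists y, (fun t => z1 t + v); split.
- by rewrite -zy z0 /y0 mulr0 addr0 add0r.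
- by rewrite z10 add0r.
- by move=> t; apply: is_derive_ext zy _; exact: is_deriveDr.
- move=> t; apply: is_derive_eq (addr0 _); apply: is_deriveDr.
Unshelve. all: by end_near. Qed.

End PicardIteration.

End LinearODE.

(** * Uniqueness by means of Wronskians *)

Section LinearODEUniqueness.
Variables (R : realType) (w : R -> R).
Hypotheses (w_cont : continuous w) (w_bounded : exists M, forall t, `|w t| <= M).

Definition ode_solution (p v : R) (y y1 : R -> R) : Prop :=
  [/\ y 0 = p, y1 0 = v, forall t : R, is_derive t 1 y (y1 t)
    & forall t : R, is_derive t 1 y1 (w t * y t)].

Lemma ode_solution_exists p v : exists y y1, ode_solution p v y y1.
Proof.
have [M wM] := w_bounded.
apply: (@linear_ode_exists R w (Num.max M 1)) => // [|t]; first by rewrite lt_max ltr01 orbT.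
by rewrite le_max wM.
Qed.

Lemma wronskian_cst p v y y1 q u z z1 :
  ode_solution p v y y1 -> ode_solution q u z z1 ->
  forall t, y t * z1 t - y1 t * z t = p * u - v * q.
Proof.
move=> [<- <- dy dy1] [<- <- dz dz1] t.
apply: (@is_derive_0_is_cst _ (fun t => y t * z1 t - y1 t * z t)) => s.
apply: (is_derive_eq (is_deriveBr (is_deriveMr (dy s) (dz1 s)) (is_deriveMr (dy1 s) (dz s)))).
ring.
Qed.

(** The Wronskians with two fundamental solutions [c] and [s], whose own Wronskian is 1, determine
    [x] and [x1] at every time by Cramer's rule; this replaces a Gronwall estimate. *)
Lemma ode_solution_unique p v y y1 z z1 :
  ode_solution p v y y1 -> ode_solution p v z z1 -> y = z /\ y1 = z1.
Proof.
have [c [c1 hc]] := ode_solution_exists 1 0.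
have [s [s1 hs]] := ode_solution_exists 0 1.
suff E x x1 : ode_solution p v x x1 ->
    x = (fun t => p * c t + v * s t) /\ x1 = (fun t => p * c1 t + v * s1 t).
  by move=> /E[-> ->] /E[-> ->].
move=> hx; have ec := wronskian_cst hx hc; have es := wronskian_cst hx hs.
have ecs := wronskian_cst hc hs.
split; apply/funext => t; rewrite -[LHS]mulr1 -[1]subr0 -[X in X - _](mulr1 1) -(mul0r 0) -(ecs t).
- have -> : p = x t * s1 t - x1 t * s t by rewrite es; ring.
  have -> : v = - (x t * c1 t - x1 t * c t) by rewrite ec; ring.
  ring.
- have -> : p = x t * s1 t - x1 t * s t by rewrite es; ring.
  have -> : v = - (x t * c1 t - x1 t * c t) by rewrite ec; ring.
  ring.
Qed.

End LinearODEUniqueness.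

Lemma periodic_bounded (R : realType) (f : R -> R) (p : R) : continuous f ->
  p != 0 -> periodic f p -> exists M, forall t, `|f t| <= M.
Proof.
move=> cf p0 fp.
have fN (n : nat) t : f (t + n%:R * p) = f t.
  by elim: n t => [|n IH] t; rewrite ?mul0r ?addr0 // -natr1 mulrDl mul1r addrA fp IH.
have fZ (z : int) t : f (t + z%:~R * p) = f t.
  case: z => n; first by rewrite -pmulrn fN.
  by rewrite NegzE mulrNz mulNr -[LHS](fN n.+1) -pmulrn subrK.
have [c _ hc] := @EVT_max R (fun t => `|f t|) 0 `|p| (normr_ge0 _)
  (continuous_subspaceT (fun t => continuous_comp (cf t) (@norm_continuous _ _ _))).
exists `|f c| => t.
have [z] : exists z : int, t + z%:~R * p \in `[0, `|p|]; last first.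
  by move=> /hc; rewrite fZ.
have fl := floor_itv (t / `|p|); set k := Num.floor _ in fl; move: fl.
rewrite intrD ler_pdivlMr ?normr_gt0 // ltr_pdivrMr ?normr_gt0 // => /andP[k1 k2].
(* The period [p] may be negative, whereas the floor is taken with respect to its absolute value. *)
have E : exists z : int, z%:~R * p = - (k%:~R * `|p|).
  case: (ger0P p) => _; last by exists k; rewrite mulrN opprK.
  by exists (- k); rewrite mulrNz mulNr.
case: E => z Ez; exists z; rewrite Ez in_itv /= subr_ge0 k1 /=.
rewrite lerBlDr; apply: ltW; apply: lt_le_trans k2 _; rewrite mulrDl mul1r; lra.
Qed.

(** * The matrix exponential *)

Section MatrixConvergence.
Variables (R : realType) (m n : nat).

Lemma cvg_mx (T : Type) (G : set_system T) (FG : Filter G) (f : T -> 'M[R]_(m, n))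
    (M : 'M[R]_(m, n)) :
  (forall i j, f x i j @[x --> G] --> M i j) -> f @ G --> M.
Proof.
move=> fM A [P MP PA].
apply: (@filterS _ _ FG [set x | forall i j, P i j (f x i j)]) => [x Px|]; first exact: PA.
by apply: filter_forall => i; apply: filter_forall => j; exact: fM (MP i j).
Qed.

Lemma continuous_mx (T : topologicalType) (f : T -> 'M[R]_(m, n)) :
  (forall i j, continuous (fun x => f x i j)) -> continuous f.
Proof. by move=> cf x; apply: cvg_mx => i j; exact: cf. Qed.

Lemma continuous_entry (T : topologicalType) (f : T -> 'M[R]_(m, n)) i j :
  continuous f -> continuous (fun x => f x i j).
Proof.
move=> cf x; apply: (@continuous_comp _ _ _ f (fun M : 'M[R]_(m, n) => M i j)).
  exact: cf.
exact: coord_continuous.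
Qed.

Lemma cvg_sumr (T : Type) (G : set_system T) (FG : Filter G) (I : Type) (r : seq I)
    (f : I -> T -> R) (l : I -> R) : (forall i, f i x @[x --> G] --> l i) ->
  \sum_(i <- r) f i x @[x --> G] --> \sum_(i <- r) l i.
Proof.
move=> fl; elim: r => [|i r IH].
  by rewrite big_nil; under eq_fun do rewrite big_nil; exact: cvg_cst.
by rewrite big_cons; under eq_fun do rewrite big_cons; exact: cvgD.
Qed.

Lemma continuous_sumr (T : topologicalType) (I : Type) (r : seq I) (f : I -> T -> R) :
  (forall i, continuous (f i)) -> continuous (fun x => \sum_(i <- r) f i x).
Proof. by move=> cf x; apply: cvg_sumr => i; exact: cf. Qed.

Lemma continuousDr (T : topologicalType) (f g : T -> R) :
  continuous f -> continuous g -> continuous (fun x => f x + g x).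
Proof. by move=> cf cg x; apply: continuousD; [exact: cf|exact: cg]. Qed.

Lemma continuousNr (T : topologicalType) (f : T -> R) :
  continuous f -> continuous (fun x => - f x).
Proof. by move=> cf x; apply: continuousN; exact: cf. Qed.

Lemma continuousMr (T : topologicalType) (f g : T -> R) :
  continuous f -> continuous g -> continuous (fun x => f x * g x).
Proof. by move=> cf cg x; apply: continuousM; [exact: cf|exact: cg]. Qed.

Lemma continuous_prodr (T : topologicalType) (I : Type) (r : seq I) (f : I -> T -> R) :
  (forall i, continuous (f i)) -> continuous (fun x => \prod_(i <- r) f i x).
Proof.
move=> cf x; elim: r => [|i r IH]; rewrite /continuous_at.
  by rewrite big_nil; under eq_fun do rewrite big_nil; exact: cvg_cst.
by rewrite big_cons; under eq_fun do rewrite big_cons; apply: cvgM => //; exact: cf.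
Qed.

End MatrixConvergence.

(** * Curves of matrices, differentiated entry by entry *)

Section MatrixDerivative.
Variable R : realType.

Definition mx_derive m n (G G1 : R -> 'M[R]_(m, n)) : Prop :=
  forall t i j, is_derive (t : R) 1 (fun s => G s i j) (G1 t i j).

Lemma mx_derive_cst m n (B : 'M[R]_(m, n)) : mx_derive (fun=> B) (fun=> 0).
Proof. by move=> t i j; rewrite mxE; exact: is_derive_cst. Qed.

Lemma mx_deriveM m n p (G G1 : R -> 'M[R]_(m, n)) (H H1 : R -> 'M[R]_(n, p)) :
  mx_derive G G1 -> mx_derive H H1 ->
  mx_derive (fun t => G t *m H t) (fun t => G1 t *m H t + G t *m H1 t).
Proof.
move=> dG dH t i j.
apply: (is_derive_ext (F := fun s => \sum_k G s i k * H s k j)) => [s|]; first by rewrite mxE.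
apply: (is_derive_eq (is_derive_sumr (fun k => is_deriveMr (dG t i k) (dH t k j)))).
by rewrite big_split /= !mxE.
Qed.

Lemma mx_derive_tr m n (G G1 : R -> 'M[R]_(m, n)) : mx_derive G G1 ->
  mx_derive (fun t => (G t)^T) (fun t => (G1 t)^T).
Proof.
move=> dG t i j; rewrite mxE.
by apply: is_derive_ext (dG t j i) => s; rewrite mxE.
Qed.

Lemma mx_deriveN m n (G G1 : R -> 'M[R]_(m, n)) : mx_derive G G1 ->
  mx_derive (fun t => G (- t)) (fun t => - G1 (- t)).
Proof.
by move=> dG t i j; rewrite mxE; apply: is_derive_oppv (dG (- t) i j).
Qed.

Lemma mx_derive_eq m n (G G1 G2 : R -> 'M[R]_(m, n)) : mx_derive G G1 ->
  mx_derive G G2 -> G1 = G2.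
Proof.
move=> d1 d2; apply/funext => t; apply/matrixP => i j.
by have [_ <-] := d1 t i j; have [_ <-] := d2 t i j.
Qed.

Lemma mx_derive_is_cst m n (G G1 : R -> 'M[R]_(m, n)) : mx_derive G G1 ->
  (forall t, G1 t = 0) -> forall s t, G s = G t.
Proof.
move=> dG G10 s t; apply/matrixP => i j.
apply: (@is_derive_0_is_cst _ (fun s => G s i j)) => r.
by have := dG r i j; rewrite G10 mxE.
Qed.

Lemma mx_derive_continuous m n (G G1 : R -> 'M[R]_(m, n)) : mx_derive G G1 ->
  continuous G.
Proof.
move=> dG; apply: continuous_mx => i j.
exact: is_derive_continuous (fun t => dG t i j).
Qed.

End MatrixDerivative.

(** * The exponential as a power series and as the solution of $G' = F G$ *)

Section MatrixExponential.
Variables (R : realType) (m : nat).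
Implicit Types F B : 'M[R]_m.

Let mx_bound F : R := \sum_i \sum_j `|F i j|.

Let mx_bound_ge0 F : 0 <= mx_bound F.
Proof. by rewrite sumr_ge0 // => i _; rewrite sumr_ge0. Qed.

Let exprmx_le F k i j : `|(F ^+ k) i j| <= mx_bound F ^+ k.
Proof.
elim: k i j => [|k IH] i j.
  by rewrite !expr0 mxE; case: eqP => _; rewrite ?normr1 ?normr0.
rewrite !exprS mxE (le_trans (ler_norm_sum _ _ _)) //.
apply: (@le_trans _ _ (\sum_l `|F i l| * mx_bound F ^+ k)).
  by apply: ler_sum => l _; rewrite normrM ler_wpM2l.
rewrite -mulr_suml ler_wpM2r ?exprn_ge0 ?mx_bound_ge0 // /mx_bound.
by rewrite [in leRHS](bigD1 i) //= lerDl sumr_ge0 // => l _; rewrite sumr_ge0.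
Qed.

Let cvg_exp_le (c : R^nat) (A K x : R) : 0 <= K ->
  (forall k, `|c k| <= A * K ^+ k / k`!%:R) -> cvgn (pseries c x).
Proof.
move=> K0 cK; apply: normed_cvg.
have A0 : 0 <= A by have := cK 0%N; rewrite expr0 fact0 divr1 mulr1; exact: le_trans.
apply: (@series_le_cvg _ _ (fun k => A * exp_coeff (K * `|x|) k)) => [k|k|k|].
- exact: normr_ge0.
- by rewrite mulr_ge0 // /exp_coeff /= divr_ge0 // exprn_ge0 // mulr_ge0.
- rewrite /= normrM normrX /exp_coeff /= exprMn.
  rewrite (le_trans (ler_wpM2r _ (cK k))) ?exprn_ge0 //.
  by rewrite le_eqVlt; apply/orP; left; apply/eqP; ring.
- by apply: is_cvg_seriesZ; exact: is_cvg_series_exp_coeff.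
Qed.

(** The offset [l] makes the family of entry series closed under formal differentiation: offsets 0,
    1, 2 are the exponential and its first two derivatives, whose convergence is what termwise
    differentiation asks for. *)
Let pseries_diffs_entryS F i j l :
  pseries_diffs (fun k => (F ^+ (k + l)%N) i j / k`!%:R)
  = fun k => (F ^+ (k + l.+1)%N) i j / k`!%:R.
Proof.
apply/funext => k; rewrite /pseries_diffs factS natrM invfM addSnnS.
by rewrite mulrCA mulVKf // pnatr_eq0.
Qed.

Let cvg_entry F i j l x : cvgn (pseries (fun k => (F ^+ (k + l)%N) i j / k`!%:R) x).
Proof.
apply: (@cvg_exp_le _ (mx_bound F ^+ l) (mx_bound F)) => // k.
rewrite normrM normfV [`|_%:R|]ger0_norm // ler_wpM2r ?invr_ge0 //.
by rewrite -exprD addnC exprmx_le.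
Qed.

Let expmx_entry F t i j :
  expmx (t *: F) i j = limn (pseries (fun k => (F ^+ (k + 0)%N) i j / k`!%:R) t).
Proof.
pose E := \matrix_(i, j) limn (pseries (fun k => (F ^+ (k + 0)%N) i j / k`!%:R) t).
suff cE : series (fun k => k`!%:R^-1 *: (t *: F) ^+ k) @ \oo --> E.
  by rewrite /expmx (cvg_lim _ cE) ?mxE //; exact: norm_hausdorff.
apply: cvg_mx => k l; rewrite mxE.
rewrite (_ : (fun n => _) = pseries (fun k0 => (F ^+ (k0 + 0)%N) k l / k0`!%:R) t).
  exact: cvg_entry.
apply/funext => n; rewrite /series /pseries /= /series /= summxE.
apply: eq_bigr => q _; rewrite addn0.
have -> : (t *: F) ^+ q = t ^+ q *: F ^+ q.
  elim: q => [|q IH]; first by rewrite !expr0 scale1r.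
  rewrite !exprS IH -[LHS]/((t *: F) *m (t ^+ q *: F ^+ q)).
  by rewrite -scalemxAl -scalemxAr scalerA.
by rewrite !mxE; ring.
Qed.

Let lim_entry_mul F t i j :
  limn (pseries (fun k => (F ^+ (k + 1)%N) i j / k`!%:R) t) = (F *m expmx (t *: F)) i j.
Proof.
rewrite mxE; apply: cvg_lim => //.
rewrite (_ : pseries _ t = fun n => \sum_l F i l *
    pseries (fun k => (F ^+ (k + 0)%N) l j / k`!%:R) t n).
  apply: cvg_sumr => l; rewrite expmx_entry.
  apply: cvgM; [exact: cvg_cst|exact: cvg_entry].
apply/funext => n; rewrite /pseries /series /=.
under eq_bigr do rewrite addn1 exprS mxE !mulr_suml.
rewrite exchange_big; apply: eq_bigr => l _; rewrite mulr_sumr.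
by apply: eq_bigr => k _; rewrite addn0 !mulrA.
Qed.

Let lim_entry_mulr F t i j :
  limn (pseries (fun k => (F ^+ (k + 1)%N) i j / k`!%:R) t) = (expmx (t *: F) *m F) i j.
Proof.
rewrite mxE; apply: cvg_lim => //.
rewrite (_ : pseries _ t = fun n => \sum_l
    pseries (fun k => (F ^+ (k + 0)%N) i l / k`!%:R) t n * F l j).
  apply: cvg_sumr => l; rewrite expmx_entry.
  apply: cvgM; [exact: cvg_entry|exact: cvg_cst].
apply/funext => n; rewrite /pseries /series /=.
under eq_bigr do rewrite addn1 exprSr mxE !mulr_suml.
rewrite exchange_big; apply: eq_bigr => l _; rewrite mulr_suml.
by apply: eq_bigr => k _; rewrite addn0; ring.
Qed.

Lemma expmx_comm F t : F *m expmx (t *: F) = expmx (t *: F) *m F.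
Proof. by apply/matrixP => i j; rewrite -lim_entry_mul lim_entry_mulr. Qed.

Lemma expmx_derive F : mx_derive (fun t => expmx (t *: F)) (fun t => F *m expmx (t *: F)).
Proof.
move=> t i j; rewrite -lim_entry_mul -pseries_diffs_entryS.
apply: is_derive_ext (fun s => esym (expmx_entry F s i j)) _.
apply: (@pseries_snd_diffs _ _ (`|t| + 1)); rewrite ?pseries_diffs_entryS.
- exact: cvg_entry.
- exact: cvg_entry.
- exact: cvg_entry.
- by rewrite [ltRHS]ger0_norm ?addr_ge0 // ltrDl.
Qed.

Lemma expmx0 : expmx (0 : 'M[R]_m) = 1%:M.
Proof.
apply: cvg_lim; first exact: norm_hausdorff.
rewrite -(cvg_shiftn 1).
rewrite (_ : (fun n => _) = cst 1%:M); first exact: cvg_cst.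
apply/funext => n; rewrite /series /= addn1 big_nat_recl //= expr0 fact0 invr1 scale1r.
by rewrite big1 ?addr0 // => k _; rewrite exprS mul0r scaler0.
Qed.

Lemma expmxNK F t : expmx (- t *: F) *m expmx (t *: F) = 1%:M.
Proof.
have d := mx_deriveM (mx_deriveN (expmx_derive F)) (expmx_derive F).
rewrite (mx_derive_is_cst d _ t 0) ?scaleNr ?scale0r ?oppr0 ?expmx0 ?mulmx1 //.
by move=> s; rewrite mulNmx (expmx_comm F (- s)) mulmxA addNr.
Qed.

(** By the product rule [expmx (- t *: F) *m G t] is constant. The addition formula, the commutation
    rule and the identification of rotations with exponentials are all drawn from this
    uniqueness. *)
Lemma expmx_unique F (G : R -> 'M[R]_m) : mx_derive G (fun t => F *m G t) ->
  forall t, G t = expmx (t *: F) *m G 0.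
Proof.
move=> dG t.
have d := mx_deriveM (mx_deriveN (expmx_derive F)) dG.
have e : expmx (- t *: F) *m G t = G 0.
  rewrite (mx_derive_is_cst d _ t 0) ?scaleNr ?scale0r ?oppr0 ?expmx0 ?mul1mx //.
  by move=> s; rewrite (expmx_comm F (- s)) mulNmx mulmxA addNr.
by rewrite -e mulmxA -[X in expmx (X *: _) *m _]opprK expmxNK mul1mx.
Qed.

Lemma expmx_commute F B t : B *m F = F *m B ->
  B *m expmx (t *: F) = expmx (t *: F) *m B.
Proof.
move=> BF; have := @expmx_unique F (fun s => B *m expmx (s *: F)) _ t.
rewrite scale0r expmx0 mulmx1; apply=> s i j.
have := mx_deriveM (mx_derive_cst B) (expmx_derive F) s i j.
by rewrite mul0mx add0r !mulmxA BF.
Qed.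

Lemma expmxD F s t : expmx ((s + t) *: F) = expmx (s *: F) *m expmx (t *: F).
Proof.
have := @expmx_unique F (fun s => expmx ((s + t) *: F)) _ s; rewrite add0r; apply=> r i j.
rewrite -[X in is_derive _ _ _ X]mulr1.
apply: (@is_derive1_comp _ (fun r => expmx (r *: F) i j) (fun r => r + t)).
  exact: expmx_derive.
exact: (is_derive_eq (is_deriveDr (is_derive_id r 1) (is_derive_cst t r 1)) (addr0 1)).
Qed.

Lemma expmx_skew F t : F^T = - F -> (expmx (t *: F))^T *m expmx (t *: F) = 1%:M.
Proof.
move=> FN; have d := mx_deriveM (mx_derive_tr (expmx_derive F)) (expmx_derive F).
rewrite (mx_derive_is_cst d _ t 0) ?scale0r ?expmx0 ?trmx1 ?mulmx1 // => s.
by rewrite trmx_mul FN mulmxN mulNmx mulmxA addNr.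
Qed.

End MatrixExponential.

(** * The centralizer of a diagonal matrix *)

Section Rotations.
Variables (R : realType) (m : nat).
Implicit Types (i j k l : 'I_m) (C : 'M[R]_m).

(* Rotation in the coordinate plane [(i, j)] when [c ^ 2 + s ^ 2 = 1]. *)
Definition plane_mx (c s : R) i j : 'M[R]_m :=
  \matrix_(k, l) if k == i then c * (l == i)%:R + s * (l == j)%:R
    else if k == j then c * (l == j)%:R - s * (l == i)%:R else (k == l)%:R.

Definition plane_gen i j : 'M[R]_m :=
  \matrix_(k, l) if k == i then (l == j)%:R
    else if k == j then - (l == i)%:R else 0.

Definition rotation i j (t : R) : 'M[R]_m := plane_mx (cos t) (sin t) i j.

Lemma sum_delta (f : 'I_m -> R) i : \sum_l (l == i)%:R * f l = f i.
Proof.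
rewrite (bigD1 i) //= eqxx mul1r big1 ?addr0 // => l /negPf ->.
by rewrite mul0r.
Qed.

Lemma plane_mx_mul c s i j C k l : (plane_mx c s i j *m C) k l =
  if k == i then c * C i l + s * C j l
  else if k == j then c * C j l - s * C i l else C k l.
Proof.
rewrite mxE; under eq_bigr do rewrite mxE.
have [ki|ki] := eqVneq k i.
  under eq_bigr do rewrite mulrDl -!mulrA.
  by rewrite big_split /= -!mulr_sumr !sum_delta.
have [kj|kj] := eqVneq k j.
  under eq_bigr do rewrite mulrBl -!mulrA.
  by rewrite sumrB -!mulr_sumr !sum_delta.
by under eq_bigr do rewrite eq_sym; rewrite (sum_delta (C^~ l)).
Qed.

Lemma plane_gen_mul i j C k l : (plane_gen i j *m C) k l =
  if k == i then C j l else if k == j then - C i l else 0.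
Proof.
rewrite mxE; under eq_bigr do rewrite mxE.
have [ki|ki] := eqVneq k i; first by rewrite (sum_delta (C^~ l)).
have [kj|kj] := eqVneq k j; last by rewrite big1 // => q _; rewrite mul0r.
by under eq_bigr do rewrite mulNr; rewrite sumrN (sum_delta (C^~ l)).
Qed.

Lemma rotationE i j t : i != j -> rotation i j t = expmx (t *: plane_gen i j).
Proof.
move=> ij; rewrite (@expmx_unique _ _ (plane_gen i j) (rotation i j)).
  rewrite (_ : rotation i j 0 = 1%:M) ?mulmx1 //; apply/matrixP => k l.
  rewrite !mxE cos0 sin0 !mul1r !mul0r addr0 subr0 [l == i]eq_sym [l == j]eq_sym.
  by have [->|_] := eqVneq k i; last have [->|_] := eqVneq k j.
move=> r k l; rewrite plane_gen_mul.
apply: (is_derive_ext (F := fun r => if k == i then cos r * (l == i)%:R + sin r * (l == j)%:R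
    else if k == j then cos r * (l == j)%:R - sin r * (l == i)%:R else (k == l)%:R)).
  by move=> x; rewrite mxE.
have dc (c : R) : is_derive r 1 (fun y => cos y * c) (- sin r * c).
  by apply: (is_derive_eq (is_deriveMr (is_derive_cos r) (is_derive_cst c r 1))); rewrite mulr0 addr0.
have ds (c : R) : is_derive r 1 (fun y => sin y * c) (cos r * c).
  by apply: (is_derive_eq (is_deriveMr (is_derive_sin r) (is_derive_cst c r 1))); rewrite mulr0 addr0.
rewrite !mxE eqxx [j == i]eq_sym (negPf ij).
have [ki|ki] := eqVneq k i.
  by apply: (is_derive_eq (is_deriveDr (dc _) (ds _))); ring.
have [kj|kj] := eqVneq k j; last exact: is_derive_cst.
by apply: (is_derive_eq (is_deriveBr (dc _) (ds _))); rewrite eqxx; ring.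
Qed.

Lemma rotationNK i j t C : i != j -> rotation i j (- t) *m (rotation i j t *m C) = C.
Proof. by move=> ij; rewrite mulmxA !rotationE // expmxNK mul1mx. Qed.

Lemma rotation0 i j : i != j -> rotation i j 0 = 1%:M.
Proof. by move=> ij; rewrite rotationE // scale0r expmx0. Qed.

Lemma cos_sin_exists (c s : R) : c ^+ 2 + s ^+ 2 = 1 -> exists t, cos t = c /\ sin t = s.
Proof.
move=> cs; have c1 : -1 <= c <= 1.
  by rewrite -ler_norml -[leRHS]sqrtr1 -sqrtr_sqr ler_wsqrtr // -cs lerDl sqr_ge0.
have ca := acosK c1.
have sa : sin (acos c) = `|s|.
  rewrite sin_acos // -sqrtr_sqr; congr Num.sqrt; rewrite -cs; ring.
have [s0|s0] := leP 0 s.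
  by exists (acos c); rewrite ca sa ger0_norm.
by exists (- acos c); rewrite cosN sinN ca sa ltr0_norm // opprK.
Qed.

End Rotations.

(** * The group generated by the exponentials, described eigenspace by eigenspace *)

Section Centralizer.
Variables (R : realType) (m : nat) (a : 'I_m -> R).
Implicit Types (i j k l : 'I_m) (C F : 'M[R]_m).

Let D : 'M[R]_m := diag_mx (\row_i a i).

Definition block_diagonal C : Prop := forall i j, a i != a j -> C i j = 0.

(** The entries of the commutator are $(a_i - a_j) C_{ij}$. *)
Lemma block_diagonalP C : D *m C = C *m D <-> block_diagonal C.
Proof.
have E i j : (D *m C) i j - (C *m D) i j = (a i - a j) * C i j.
  by rewrite mul_diag_mx mul_mx_diag !mxE; ring.
split=> [DC i j ij|bC].
  apply: (mulfI (x := a i - a j)); first by rewrite subr_eq0.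
  by rewrite -E DC subrr mulr0.
apply/matrixP => i j; apply/eqP; rewrite -subr_eq0 E.
by have [->|/bC ->] := eqVneq (a i) (a j); rewrite ?subrr ?mul0r ?mulr0.
Qed.

Lemma centralizer_algebraP F : centralizer_algebra D F <-> so F /\ block_diagonal F.
Proof.
have comm G : D *m G - G *m D = 0 <-> block_diagonal G.
  rewrite -block_diagonalP; split=> [/eqP|->]; last by rewrite subrr.
  by rewrite subr_eq0 => /eqP.
split=> [[k [c [B [sB ->]]]]|[sF bF]]; last first.
  exists 1%N, (fun=> 1), (fun=> F); split; last by rewrite big_ord1 scale1r.
  by move=> _; split=> //; apply/comm.
split.
  rewrite /so /= linear_sum -sumrN; apply: eq_bigr => i _ /=.
  by have [sBi _] := sB i; rewrite linearZ /= sBi scalerN.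
move=> i j ij; rewrite summxE big1 // => l _; have [_ /comm bB] := sB l.
by rewrite mxE bB // mulr0.
Qed.

(** For block-diagonal [C] this is its restriction to the eigenspace of [lam], extended by the
    identity to the other eigenspaces. Its determinant is that of the restriction, with no
    reindexing, and it is 1 when [lam] is not an eigenvalue. *)
Definition eigen_block (lam : R) C : 'M[R]_m :=
  \matrix_(i, j) if a i == lam then C i j else (i == j)%:R.

Lemma eigen_blockM lam C F : block_diagonal C ->
  eigen_block lam (C *m F) = eigen_block lam C *m eigen_block lam F.
Proof.
move=> bC; apply/matrixP => i j; rewrite !mxE; under [RHS]eq_bigr do rewrite mxE.
have [ai|ai] := eqVneq (a i) lam.
  apply: eq_bigr => k _; rewrite mxE.
  have [_ //|ak] := eqVneq (a k) lam; rewrite bC ?mul0r // ai eq_sym //.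
by under eq_bigr do rewrite eq_sym; rewrite sum_delta mxE (negPf ai).
Qed.

Lemma eigen_block1 lam : eigen_block lam 1%:M = 1%:M.
Proof. by apply/matrixP => i j; rewrite !mxE if_same. Qed.

Lemma eigen_block_tr lam C : block_diagonal C ->
  eigen_block lam C^T = (eigen_block lam C)^T.
Proof.
move=> bC; apply/matrixP => i j; rewrite !mxE [j == i]eq_sym.
have [ai|ai] := eqVneq (a i) lam; have [aj|aj] := eqVneq (a j) lam => //.
- by rewrite bC ?ai //; have [ij|//] := eqVneq i j; rewrite -ij ai eqxx in aj.
- by rewrite bC ?aj 1?eq_sym //; have [ij|//] := eqVneq i j; rewrite ij aj eqxx in ai.
Qed.

(* The product of the special orthogonal groups of the eigenspaces. *)
Definition block_SO : set 'M[R]_m :=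
  [set C | [/\ SO C, block_diagonal C & forall lam, \det (eigen_block lam C) = 1]].

Lemma block_diagonalM C F : block_diagonal C -> block_diagonal F ->
  block_diagonal (C *m F).
Proof.
move=> /block_diagonalP hC /block_diagonalP hF; apply/block_diagonalP.
by rewrite mulmxA hC -mulmxA hF mulmxA.
Qed.

Lemma block_diagonal_tr C : block_diagonal C -> block_diagonal C^T.
Proof. by move=> bC i j ij; rewrite mxE bC // eq_sym. Qed.

Lemma SO_inv C : SO C -> invmx C = C^T.
Proof.
move=> [CC _]; have uC : C \in unitmx by case/mulmx1_unit: CC.
by rewrite -[RHS]mulmx1 -(mulmxV uC) mulmxA CC mul1mx.
Qed.

Lemma block_SO_subgroup : mx_subgroup (@SO R m) block_SO.
Proof.
split=> [C []//||C F [[C1 C2] bC dC] [[F1 F2] bF dF]|C [sC bC dC]].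
- split; first by split; rewrite ?trmx1 ?mulmx1 ?det1.
    by move=> i j ij; rewrite mxE; have [e|//] := eqVneq i j; rewrite e eqxx in ij.
  by move=> lam; rewrite eigen_block1 det1.
- split.
  + split; last by rewrite det_mulmx C2 F2 mulr1.
    by rewrite trmx_mul mulmxA -[_ *m _ *m C]mulmxA C1 mulmx1.
  + exact: block_diagonalM.
  + by move=> lam; rewrite eigen_blockM // det_mulmx dC dF mulr1.
- rewrite SO_inv //; case: sC => C1 C2; split.
  + by split; rewrite ?trmxK ?det_tr //; apply: mulmx1C.
  + exact: block_diagonal_tr.
  + by move=> lam; rewrite eigen_block_tr // det_tr.
Qed.

(* [exp F] is the square of [exp (F / 2)], whose determinants are signs. *)
Lemma expmx_block_SO F : centralizer_algebra D F -> block_SO (expmx F).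
Proof.
move=> /centralizer_algebraP[sF /block_diagonalP bF].
pose E := expmx (2^-1 *: F).
have bE : block_diagonal E by apply/block_diagonalP; exact: expmx_commute.
have EE : E^T *m E = 1%:M by exact: expmx_skew.
have -> : expmx F = E *m E.
  by rewrite /E -expmxD -[X in expmx X]scale1r; congr (expmx (_ *: F)); field.
have sq (B : 'M[R]_m) : B^T *m B = 1%:M -> \det B * \det B = 1.
  by move=> /(congr1 determinant); rewrite det_mulmx det_tr det1.
split.
- split; last by rewrite det_mulmx sq.
  by rewrite trmx_mul mulmxA -[E^T *m E^T *m E]mulmxA EE mulmx1.
- exact: block_diagonalM.
- move=> lam; rewrite eigen_blockM // det_mulmx sq //.
  by rewrite -eigen_block_tr // -eigen_blockM ?EE ?eigen_block1 //; exact: block_diagonal_tr.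
Qed.

Lemma plane_gen_centralizer i j : i != j -> a i = a j ->
  forall t, centralizer_algebra D (t *: plane_gen R i j).
Proof.
move=> ij aij t; apply/centralizer_algebraP; split.
  rewrite /so /= linearZ /= -scalerN; congr (_ *: _); apply/matrixP => k l; rewrite !mxE.
  have [ki|ki] := eqVneq k i; have [li|li] := eqVneq l i; subst; rewrite ?eqxx ?(negPf ij) //=.
  - by rewrite oppr0.
  - by case: (l == j); rewrite ?oppr0.
  - by have [kj|_] := eqVneq k j; rewrite ?opprK ?oppr0.
  - by have [kj|_] := eqVneq k j; have [lj|_] := eqVneq l j; rewrite ?oppr0.
move=> k l kl; rewrite !mxE.
have [ki|ki] := eqVneq k i.
  by have [lj|_] := eqVneq l j; rewrite ?mulr0 //; rewrite ki lj aij eqxx in kl.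
have [kj|_] := eqVneq k j; rewrite ?mulr0 //.
by have [li|_] := eqVneq l i; rewrite ?oppr0 ?mulr0 //; rewrite kj li aij eqxx in kl.
Qed.

Lemma rotation_block_SO i j t : i != j -> a i = a j -> block_SO (rotation i j t).
Proof. by move=> ij aij; rewrite rotationE //; apply/expmx_block_SO/plane_gen_centralizer. Qed.

(* Induction over the factorisation of a block-orthogonal matrix into plane
   rotations (Givens elimination). *)
Lemma block_SO_ind (H : set 'M[R]_m) : H 1%:M ->
  (forall i j t C, i != j -> a i = a j -> block_SO C -> H C -> H (rotation i j t *m C)) ->
  block_SO `<=` H.
Proof.
move=> H1 HR.
have [SOs SO1 SOM _] := block_SO_subgroup.
have SOR i j t C : i != j -> a i = a j -> block_SO C -> block_SO (rotation i j t *m C).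
  by move=> ij aij sC; apply: SOM => //; exact: rotation_block_SO.
(* The elimination step: [C] is the inverse rotation, which is again an admissible factor, times
   [rotation i j t *m C]. *)
have HinvR i j t C : i != j -> a i = a j -> block_SO C ->
    H (rotation i j t *m C) -> H C.
  move=> ij aij sC HC; rewrite -(rotationNK t C ij); apply: HR => //.
  exact: SOR.
have col1 C l : block_SO C -> \sum_k C k l ^+ 2 = 1.
  move=> [[/matrixP/(_ l l) + _] _ _]; rewrite !mxE eqxx => CC; rewrite -[RHS]CC.
  by apply: eq_bigr => k _; rewrite mxE expr2.
have row1 C k : block_SO C -> \sum_l C k l ^+ 2 = 1.
  move=> [[/mulmx1C/matrixP/(_ k k) + _] _ _]; rewrite !mxE eqxx => CC; rewrite -[RHS]CC.
  by apply: eq_bigr => l _; rewrite mxE expr2.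
(* A diagonal matrix has signs on the diagonal here. Determinant 1 on the eigenspace of an entry -1
   forces a second -1 there, and the rotation by [pi] in the plane of the two turns both into 1; [q]
   bounds the number of entries different from 1. *)
have diag q C : (#|[set k | C k k != 1%R]%SET| <= q)%N -> block_SO C ->
    (forall k l, k != l -> C k l = 0) -> H C.
  elim: q C => [|q IH] C cq sC dC.
    suff -> : C = 1%:M by [].
    apply/matrixP => k l; rewrite mxE; have [<-|kl] := eqVneq k l; last exact: dC.
    move: cq; rewrite leqn0 cards_eq0 => /eqP/setP/(_ k).
    by rewrite !inE => /negbFE/eqP.
  have [/eqP|[k]] := set_0Vmem [set k | C k k != 1]%SET.
    by rewrite -cards_eq0 => /eqP c0; apply: IH => //; rewrite c0.
  rewrite inE => Ckk.
  have sgn l : C l l = 1 \/ C l l = -1.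
    have := col1 C l sC; rewrite (bigD1 l) //= big1 => [|r rl].
      by rewrite addr0 => /eqP; rewrite sqrf_eq1 => /orP[]/eqP; [left|right].
    by rewrite dC // expr0n.
  have Ck : C k k = -1 by have [e|//] := sgn k; rewrite e eqxx in Ckk.
  have [j [jk aj Cj]] : exists j, [/\ j != k, a j = a k & C j j = -1].
    apply: contrapT => nex; have [_ _ /(_ (a k))] := sC.
    have -> : eigen_block (a k) C = diag_mx (\row_l if l == k then -1 else 1).
      apply/matrixP => i l; rewrite !mxE; have [<-|il] := eqVneq i l; last first.
        by rewrite dC // if_same mulr0n.
      rewrite mulr1n; have [ik|ik] := eqVneq i k; first by rewrite ik eqxx.
      have [aik|//] := eqVneq (a i) (a k).
      by have [//|Ci] := sgn i; case: nex; exists i.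
    rewrite det_diag (bigD1 k) //= mxE eqxx big1 ?mulr1 => [/eqP|l lk].
      by rewrite eq_sym -subr_eq0 opprK (_ : 1 + 1 = 2%:R :> R) ?pnatr_eq0.
    by rewrite mxE (negPf lk).
  have kj : k != j by rewrite eq_sym.
  apply: (HinvR k j pi) => //; apply: IH; last first.
  - move=> r l rl; rewrite plane_mx_mul cospi sinpi !mul0r addr0 subr0.
    have [rk|_] := eqVneq r k; first by rewrite dC ?mulr0 // -rk.
    by have [rj|_] := eqVneq r j; rewrite dC ?mulr0 // -rj.
  - exact: SOR.
  - rewrite -ltnS; apply: leq_trans cq; apply: proper_card; apply/properP; split.
      apply/fintype.subsetP => l; rewrite !inE plane_mx_mul cospi sinpi !mul0r addr0 subr0.
      have [lk|_] := eqVneq l k; first by rewrite lk Ck mulrNN mulr1 eqxx.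
      by have [lj|_] := eqVneq l j; first by rewrite lj Cj mulrNN mulr1 eqxx.
    exists k; rewrite !inE // plane_mx_mul eqxx cospi sinpi mul0r addr0 Ck mulrNN mulr1 eqxx //.
(* [k] counts the leading rows and columns already cleared off the diagonal, [n] bounds the
   remaining ones. In [inner], [q] bounds the nonzero off-diagonal entries of the column being
   cleared. *)
have main n (k : nat) C : (m <= n + k)%N -> block_SO C ->
    (forall i j : 'I_m, (i < k)%N -> j != i -> C i j = 0 /\ C j i = 0) -> H C.
  elim: n k C => [|n IH] k C mk sC dC.
    apply: (diag _ C (leqnn _) sC) => i j ij.
    by have [] := dC i j (leq_trans (ltn_ord i) mk); rewrite // eq_sym.
  have [km|mk'] := ltnP k m; last first.
    apply: (diag _ C (leqnn _) sC) => i j ij.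
    by have [] := dC i j (leq_trans (ltn_ord i) mk'); rewrite // eq_sym.
  pose K := Ordinal km.
  suff inner q C' : (#|[set j | (j != K) && (C' j K != 0%R)]%SET| <= q)%N -> block_SO C' ->
      (forall i j : 'I_m, (i < k)%N -> j != i -> C' i j = 0 /\ C' j i = 0) -> H C'.
    exact: inner (leqnn _) sC dC.
  elim: q C' => [|q IHq] {sC dC}C cq sC dC.
    have CK j : j != K -> C j K = 0.
      move=> jK; move: cq; rewrite leqn0 cards_eq0 => /eqP/setP/(_ j).
      by rewrite !inE jK /= => /negbFE/eqP.
    have CKK : C K K ^+ 2 = 1.
      have := col1 C K sC; rewrite (bigD1 K) //= big1 ?addr0 // => j jK.
      by rewrite CK // expr0n.
    (* Once the column is cleared its diagonal entry is a sign, and the unit length of the row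
       clears the row as well. *)
    have RK j : j != K -> C K j = 0.
      move=> jK; have := row1 C K sC; rewrite (bigD1 K) //= CKK => /eqP.
      rewrite -subr_eq0 addrAC subrr add0r psumr_eq0 => [/allP/(_ j)|l _]; last exact: sqr_ge0.
      by rewrite mem_index_enum jK => /(_ isT) /=; rewrite sqrf_eq0 => /eqP.
    apply: (IH k.+1) => //; first by rewrite addnS -addSn.
    move=> i j; rewrite ltnS leq_eqVlt => /orP[/eqP ik|ik] ji; last exact: dC.
    have iK : i = K by exact: val_inj.
    by move: ji; rewrite iK => jK; split; [exact: RK|exact: CK].
  have [/eqP|[j]] := set_0Vmem [set j | (j != K) && (C j K != 0)]%SET.
    by rewrite -cards_eq0 => /eqP c0; apply: IHq => //; rewrite c0.
  rewrite inE => /andP[jK CjK]; have Kj : K != j by rewrite eq_sym.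
  have aKj : a K = a j.
    have [_ bC _] := sC; apply/eqP; apply: contraNT CjK => aKj.
    by rewrite bC // eq_sym.
  (* The rotation by the angle found below sends $(C_{KK}, C_{jK})$ to $(r, 0)$. It is admissible,
     since $C_{jK} \ne 0$ puts both indices in one eigenspace. *)
  pose r := Num.sqrt (C K K ^+ 2 + C j K ^+ 2).
  have r2 : r ^+ 2 = C K K ^+ 2 + C j K ^+ 2 by rewrite sqr_sqrtr // addr_ge0 // sqr_ge0.
  have r0 : r != 0.
    by rewrite -sqrf_eq0 r2 paddr_eq0 ?sqr_ge0 // !sqrf_eq0 negb_and CjK orbT.
  have [|t [ct st]] := @cos_sin_exists R (C K K / r) (C j K / r).
    by rewrite !expr_div_n -mulrDl -r2 divff // expf_neq0.
  apply: (HinvR K j t) => //; apply: IHq.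
  - rewrite -ltnS; apply: leq_trans cq; apply: proper_card; apply/properP; split.
      apply/fintype.subsetP => l; rewrite !inE plane_mx_mul => /andP[lK].
      rewrite lK (negPf lK) /=; have [->|//] := eqVneq l j.
      by rewrite CjK.
    exists j; rewrite !inE ?jK //= plane_mx_mul (negPf jK) eqxx ct st.
    by rewrite negbK subr_eq0; apply/eqP; ring.
  - exact: SOR.
  - move=> i l ik li; have iK : i != K by apply: contraTneq ik => ->; rewrite ltnn.
    have Ki : K != i by rewrite eq_sym.
    have ij : i != j by apply: contraNneq CjK => <-; have [-> _] := dC i K ik Ki.
    rewrite !plane_mx_mul (negPf iK) (negPf ij); split; first by have [] := dC i l ik li.
    have z q' : q' != i -> C q' i = 0 by move=> qi; have [] := dC i q' ik qi.
    have ji : j != i by rewrite eq_sym.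
    by rewrite (z K) // (z j) // (z l) // !mulr0 addr0 subr0 !if_same.
by move=> C sC; apply: (main m 0%N) => //; rewrite addn0.
Qed.

(** One inclusion is minimality. For the other, plane rotations inside eigenspaces already suffice
    as generators. *)
Lemma centralizer_groupE : centralizer_group D = block_SO.
Proof.
apply/seteqP; split.
  apply: smallest_sub; first exact: block_SO_subgroup.
  by move=> _ [F sF <-]; exact: expmx_block_SO.
move=> C sC H [[HSO H1 HM _] Hexp]; move: C sC.
apply: (block_SO_ind H1) => i j t C ij aij _ HC.
apply: HM => //; apply: Hexp; exists (t *: plane_gen R i j); last by rewrite rotationE.
exact: plane_gen_centralizer.
Qed.

Lemma rotation_continuous i j : i != j -> continuous (rotation i j : R -> 'M[R]_m).
Proof.
move=> ij; rewrite (_ : rotation i j = fun t => expmx (t *: plane_gen R i j)).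
  exact: mx_derive_continuous (expmx_derive _).
by apply/funext => t; rewrite rotationE.
Qed.

(** In a product of rotations each factor can be turned back to angle 0 without leaving the group;
    induction over the factors joins every element to the identity. *)
Lemma block_SO_connected : connected block_SO.
Proof.
have [_ S1 SM _] := block_SO_subgroup.
suff -> : block_SO = connected_component block_SO 1%:M by exact: component_connected.
apply/seteqP; split; last exact: connected_component_sub.
apply: block_SO_ind; first exact: connected_component_refl.
move=> i j t C ij aij sC; move/connected_component_trans; apply.
exists [set rotation i j s *m C | s in setT]; last by exists t.
split.
- by exists 0 => //; rewrite rotation0 // mul1mx.
- by move=> _ [s _ <-]; apply: SM => //; exact: rotation_block_SO.
- apply: connected_continuous_connected; first exact/connected_intervalP.
  apply: continuous_subspaceT; apply: continuous_mx => k l.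
  rewrite (_ : (fun s => _) = fun s => \sum_q rotation i j s k q * C q l).
    apply: continuous_sumr => q s; apply: continuousM; last exact: cst_continuous.
    exact: continuous_entry (rotation_continuous ij) s.
  by apply/funext => s; rewrite mxE.
Qed.

Lemma det_continuous : continuous (fun C : 'M[R]_m => \det C).
Proof.
apply: continuous_sumr => s C /=.
have h : continuous (fun C : 'M[R]_m => \prod_i C i (perm.fun_of_perm s i)).
  by apply: continuous_prodr => i; exact: coord_continuous.
by have := cvgM (cvg_cst ((-1 : R) ^+ perm.odd_perm s)) (h C); exact.
Qed.

Lemma eigen_block_continuous lam : continuous (eigen_block lam : 'M[R]_m -> 'M[R]_m).
Proof.
apply: continuous_mx => i j.
rewrite (_ : (fun C => _) = if a i == lam then (fun C => C i j) else cst (i == j)%:R).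
  by case: eqP => _; [exact: coord_continuous|exact: cst_continuous].
by apply/funext => C; rewrite mxE; case: eqP.
Qed.

Lemma block_SO_closed : exists2 K, closed K & block_SO = SO (m := m) `&` K.
Proof.
pose K1 : set 'M[R]_m := \bigcap_(p in [set p : 'I_m * 'I_m | a p.1 != a p.2])
  [set C | C p.1 p.2 = 0].
pose K2 : set 'M[R]_m := \bigcap_(lam in setT) [set C | \det (eigen_block lam C) = 1].
exists (K1 `&` K2).
  apply: closedI; apply: closed_bigI => p _.
    apply: (@closed_comp _ _ (fun C : 'M[R]_m => C p.1 p.2) [set 0]) => [C _|].
      exact: coord_continuous.
    exact: closed_eq.
  apply: (@closed_comp _ _ (fun C : 'M[R]_m => \det (eigen_block p C)) [set 1]) => [C _|].
    apply: (@continuous_comp _ _ _ (eigen_block p) (fun C => \det C)).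
      exact: eigen_block_continuous.
    exact: det_continuous.
  exact: closed_eq.
apply/seteqP; split=> C.
  move=> [SC bC dC]; split=> //; split=> [[i j] /= ij|lam _]; first exact: bC.
  exact: dC.
move=> [SC [bC dC]]; split=> // [i j ij|lam]; first exact: (bC (i, j)).
exact: dC.
Qed.

Lemma block_SO_connected_lie_subgroup : connected_lie_subgroup (@SO R m) block_SO.
Proof.
split; [exact: block_SO_subgroup|exact: block_SO_closed|exact: block_SO_connected].
Qed.

(** A one-parameter group in [block_SO] is orthogonal and commutes with [D] at all times;
    differentiating both relations at 0 gives the two conditions on [F]. *)
Lemma block_SO_lie_algebra : lie_algebra_of block_SO = centralizer_algebra D.
Proof.
apply/seteqP; split=> F; last first.
  move=> /centralizer_algebraP[sF bF] t; apply/expmx_block_SO/centralizer_algebraP; split.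
    by rewrite /so /= linearZ /= sF scalerN.
  by move=> i j ij; rewrite mxE bF // mulr0.
move=> LF; apply/centralizer_algebraP.
have dE := expmx_derive F.
have E0 : expmx (0 *: F) = 1%:M by rewrite scale0r expmx0.
split.
  have := mx_deriveM (mx_derive_tr dE) dE.
  rewrite (_ : (fun t => _) = fun=> 1%:M); last by apply/funext => t; have [[]] := LF t.
  move=> /mx_derive_eq /(_ (mx_derive_cst _)) /(congr1 (fun G => G 0)).
  by rewrite E0 !trmx_mul trmx1 !mulmx1 !mul1mx => /eqP; rewrite addr_eq0 => /eqP.
apply/block_diagonalP.
have := mx_deriveM (mx_derive_cst D) dE; have := mx_deriveM dE (mx_derive_cst D).
rewrite (_ : (fun t => expmx (t *: F) *m D) = fun t => D *m expmx (t *: F)).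
  move=> /mx_derive_eq h /h /(congr1 (fun G => G 0)).
  by rewrite E0 !mulmx1 mulmx0 addr0 add0r.
by apply/funext => t; have [_ /block_diagonalP] := LF t.
Qed.

Definition simple_spectrum : Prop := forall i j, a i = a j -> i = j.

Lemma centralizer_algebra_trivial :
  centralizer_algebra D = [set 0] <-> simple_spectrum.
Proof.
split=> [s0 i j aij|inj].
  apply/eqP; apply: contraT => ij.
  have : centralizer_algebra D (1 *: plane_gen R i j) by exact: plane_gen_centralizer.
  rewrite s0 scale1r => /matrixP/(_ i j); rewrite !mxE !eqxx => /eqP.
  by rewrite oner_eq0.
apply/seteqP; split=> F.
  move=> /centralizer_algebraP[sF bF]; apply/matrixP => i j; rewrite mxE.
  have [<-|ij] := eqVneq i j; last by rewrite bF //; apply: contraNneq ij => /inj ->.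
  have /matrixP/(_ i i) := sF; rewrite !mxE => /eqP.
  by rewrite -subr_eq0 opprK -mulr2n mulrn_eq0 /= => /eqP.
move=> ->; apply/centralizer_algebraP; split; first by rewrite /so /= trmx0 oppr0.
by move=> i j _; rewrite mxE.
Qed.

Lemma block_SO_trivial : block_SO = [set 1%:M] <-> simple_spectrum.
Proof.
split=> [S1 i j aij|inj].
  apply/eqP; apply: contraT => ij.
  have : block_SO (rotation i j pi) by exact: rotation_block_SO.
  rewrite S1 => /matrixP/(_ i i); rewrite !mxE !eqxx cospi sinpi mul0r addr0 mulr1 => /eqP.
  by rewrite eq_sym -subr_eq0 opprK (_ : 1 + 1 = 2%:R :> R) ?pnatr_eq0.
have [_ S1 _ _] := block_SO_subgroup.
apply/seteqP; split=> [|_ -> //].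
by apply: block_SO_ind => // i j t C ij /inj e; rewrite e eqxx in ij.
Qed.

End Centralizer.

(** * Plane wave metrics in coordinates *)

Lemma natr_true (R : nzSemiRingType) : true%:R = 1 :> R. Proof. by []. Qed.
Lemma natr_false (R : nzSemiRingType) : false%:R = 0 :> R. Proof. by []. Qed.
Definition natr_bool := (natr_true, natr_false).

Section Coordinates.
Variables (R : realType) (m : nat).

Definition ti : 'I_(2 + m) := lshift m (0 : 'I_2).
Definition si : 'I_(2 + m) := lshift m (1 : 'I_2).
Definition xi (i : 'I_m) : 'I_(2 + m) := rshift 2 i.

Variant coord_spec : 'I_(2 + m) -> Type :=
  | CoordT : coord_spec ti
  | CoordS : coord_spec si
  | CoordX i : coord_spec (xi i).

Lemma coordP p : coord_spec p.
Proof.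
rewrite -(splitK p); case: (fintype.split p) => [[[|[|//]] q]|i] /=.
- by rewrite (_ : Ordinal q = 0) //; [exact: CoordT|exact: val_inj].
- by rewrite (_ : Ordinal q = 1) //; [exact: CoordS|exact: val_inj].
- exact: CoordX.
Qed.

Lemma ti_si : (ti == si) = false. Proof. by []. Qed.
Lemma si_ti : (si == ti) = false. Proof. by []. Qed.
Lemma ti_xi i : (ti == xi i) = false. Proof. by []. Qed.
Lemma xi_ti i : (xi i == ti) = false. Proof. by []. Qed.
Lemma si_xi i : (si == xi i) = false. Proof. by []. Qed.
Lemma xi_si i : (xi i == si) = false. Proof. by []. Qed.
Lemma xi_xi i j : (xi i == xi j) = (i == j).
Proof. by rewrite /xi (inj_eq (@rshift_inj _ _)). Qed.
Definition coordE := (ti_si, si_ti, ti_xi, xi_ti, si_xi, xi_si, xi_xi, eqxx).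

Lemma sum_coord (F : 'I_(2 + m) -> R) :
  \sum_p F p = F ti + F si + \sum_i F (xi i).
Proof.
rewrite big_split_ord /=; congr (_ + _).
rewrite big_ord_recl big_ord1 /ti /si; congr (F _ + F _).
by congr lshift; exact: val_inj.
Qed.

Definition unit_vec (p q : 'I_(2 + m)) : R := (q == p)%:R.

(** The metric at a point, on tangent vectors given by their components. The point enters only
    through the value [k] of $\kappa$, so that vectors at [x] and at its image under a map are
    treated by one formula. *)
Definition metric_form (k : R) (u v : 'I_(2 + m) -> R) : R :=
  k * u ti * v ti + 2^-1 * (u ti * v si + u si * v ti) + \sum_i u (xi i) * v (xi i).

(** The dual form on covectors; $-4k$ arises from inverting the $(t, s)$ block with rows $(k, 1/2)$
    and $(1/2, 0)$. *)
Definition inverse_form (k : R) (u v : 'I_(2 + m) -> R) : R :=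
  2 * (u ti * v si + u si * v ti) - 4 * k * u si * v si + \sum_i u (xi i) * v (xi i).

Definition metric_mx (k : R) : 'M[R]_(2 + m) :=
  block_mx (\matrix_(i < 2, j < 2) if i != j then 2^-1 else if i == 0 then k else 0)
    0 0 1%:M.

Definition inverse_mx (k : R) : 'M[R]_(2 + m) :=
  block_mx (\matrix_(i < 2, j < 2) if i != j then 2 else if i == 0 then 0 else - 4 * k)
    0 0 1%:M.

Lemma block_formE (M : 'M[R]_2) (u v : 'I_(2 + m) -> R) :
  \sum_p \sum_q u p * block_mx M 0 0 1%:M p q * v q =
  u ti * M 0 0 * v ti + u ti * M 0 1 * v si + (u si * M 1 0 * v ti + u si * M 1 1 * v si)
  + \sum_i u (xi i) * v (xi i).
Proof.
rewrite sum_coord !sum_coord /ti /si /xi.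
rewrite !block_mxEul; congr (_ + _ + _).
- rewrite big1 ?addr0 // => i _; rewrite block_mxEur mxE mulr0 mul0r //.
- rewrite big1 ?addr0 // => i _; rewrite block_mxEur mxE mulr0 mul0r //.
apply: eq_bigr => i _; rewrite sum_coord /ti /si /xi !block_mxEdl !mxE !mulr0 !mul0r !add0r.
rewrite (bigD1 i) //= big1 ?addr0 => [|j ji]; rewrite block_mxEdr mxE.
  by rewrite eqxx mulr1.
by rewrite eq_sym (negPf ji) mulr0 mul0r.
Qed.

Lemma metric_formE k u v :
  \sum_p \sum_q u p * metric_mx k p q * v q = metric_form k u v.
Proof. by rewrite block_formE !mxE /= /metric_form; ring. Qed.

Lemma inverse_formE k u v :
  \sum_p \sum_q u p * inverse_mx k p q * v q = inverse_form k u v.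
Proof. by rewrite block_formE !mxE /= /inverse_form; ring. Qed.

Lemma inverse_mxK k : metric_mx k *m inverse_mx k = 1%:M.
Proof.
rewrite mulmx_block !mulmx0 !mul0mx !mulmx1 !addr0 !add0r [RHS]scalar_mx_block.
congr block_mx; apply/matrixP => i j; rewrite !mxE big_ord_recl big_ord1 !mxE.
by case: i j => [[|[|//]] ?] [[|[|//]] ?] /=; field.
Qed.

Lemma sum_unit_vec p (u : 'I_(2 + m) -> R) : \sum_q unit_vec p q * u q = u p.
Proof. exact: sum_delta. Qed.

Lemma metric_form_unit k p q :
  metric_form k (unit_vec p) (unit_vec q) = metric_mx k p q.
Proof.
rewrite -metric_formE; under eq_bigr => p' _.
  under eq_bigr => q' _ do rewrite -mulrA [_ * unit_vec q q']mulrC.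
  by rewrite -mulr_sumr sum_unit_vec; over.
by rewrite sum_unit_vec.
Qed.

Lemma metric_formC k u v : metric_form k u v = metric_form k v u.
Proof.
rewrite /metric_form; congr (_ + _ + _); try ring.
by apply: eq_bigr => i _; rewrite mulrC.
Qed.

Lemma inverse_formDl k u w v c d :
  inverse_form k (fun p => c * u p + d * w p) v = c * inverse_form k u v + d * inverse_form k w v.
Proof.
rewrite /inverse_form [c * (_ + _)]mulrDr [d * (_ + _)]mulrDr !mulr_sumr.
under eq_bigr do rewrite mulrDl -!mulrA.
by rewrite big_split /=; ring.
Qed.

Lemma inverse_mx_t k q : inverse_mx k q ti = 2 * (q == si)%:R.
Proof.
rewrite /inverse_mx; case: (coordP q) => [||i]; rewrite ?coordE.
- by rewrite block_mxEul mxE /= mulr0.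
- by rewrite block_mxEul mxE /= mulr1.
- by rewrite block_mxEdl mxE mulr0.
Qed.

Lemma inverse_mx_x k q i : inverse_mx k q (xi i) = (q == xi i)%:R.
Proof.
rewrite /inverse_mx; case: (coordP q) => [||j]; rewrite ?coordE.
- by rewrite block_mxEur mxE.
- by rewrite block_mxEur mxE.
- by rewrite block_mxEdr mxE.
Qed.

Lemma sum_inverse_t k (c : 'I_(2 + m) -> R) : \sum_q c q * inverse_mx k q ti = 2 * c si.
Proof.
rewrite -(sum_delta c si) mulr_sumr.
by apply: eq_bigr => q _; rewrite inverse_mx_t; ring.
Qed.

Lemma sum_inverse_x k (c : 'I_(2 + m) -> R) i :
  \sum_q c q * inverse_mx k q (xi i) = c (xi i).
Proof.
rewrite -[RHS]sum_delta; apply: eq_bigr => q _.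
by rewrite inverse_mx_x mulrC.
Qed.

Lemma row_mx_t (A : 'rV[R]_2) (B : 'rV[R]_m) : row_mx A B 0 ti = A 0 0.
Proof. exact: row_mxEl. Qed.

Lemma row_mx_s (A : 'rV[R]_2) (B : 'rV[R]_m) : row_mx A B 0 si = A 0 1.
Proof. exact: row_mxEl. Qed.

Lemma row_mx_x (A : 'rV[R]_2) (B : 'rV[R]_m) i : row_mx A B 0 (xi i) = B 0 i.
Proof. exact: row_mxEr. Qed.

End Coordinates.

#[global] Opaque ti si xi metric_mx inverse_mx.

(** * Smooth functions of several variables and their partial derivatives *)

Section SmoothFunctions.
Variables (R : realType) (N : nat).
Implicit Types (F G : 'rV[R]_N -> R) (x : 'rV[R]_N) (i p : 'I_N).

Lemma partialE F i x d : is_derive x (delta_mx 0 i) F d -> partial i F x = d.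
Proof. by case. Qed.

Lemma partial_shift F w c x : (forall y, F (y + w) = F y) ->
  partial c F (x + w) = partial c F x.
Proof.
move=> Fw; rewrite /partial /derive.
rewrite (_ : (fun h : R => h^-1 *: ((F \o shift (x + w)) (h *: delta_mx 0 c) - F (x + w)))
  = fun h : R => h^-1 *: ((F \o shift x) (h *: delta_mx 0 c) - F x)) //.
by apply/funext => h /=; rewrite addrA !Fw.
Qed.

Lemma Ck_weaken k F : Ck k.+1 F -> Ck k F.
Proof.
elim: k F => [|k IH] F [cF dF]; first exact: cF.
by split=> // i; have [dFi /IH] := dF i.
Qed.

Lemma smooth_continuous F : smooth F -> continuous F.
Proof. by move=> /(_ 0%N). Qed.

Lemma smooth_is_derive F i x : smooth F -> is_derive x (delta_mx 0 i) F (partial i F x).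
Proof. by move=> /(_ 1%N)[_ /(_ i)[+ _]] => /(_ x) /derivableP. Qed.

Lemma smooth_partial F i : smooth F -> smooth (partial i F).
Proof. by move=> sF k; have [_ /(_ i)[]] := sF k.+1. Qed.

Lemma partialC F i j x : smooth F -> partial i (partial j F) x = partial j (partial i F) x.
Proof.
move=> sF; have d G k : smooth G -> forall y, is_derive y (delta_mx 0 k) G (partial k G y).
  by move=> sG y; exact: smooth_is_derive.
have sj := smooth_partial j sF; have si := smooth_partial i sF.
have cij : continuous (partial i (partial j F)) by apply/smooth_continuous/smooth_partial.
have cji : continuous (partial j (partial i F)) by apply/smooth_continuous/smooth_partial.
exact: (mixed_derive_eq (d F j sF) (d F i sF) (d _ i sj) (d _ j si) (cij x) (cji x)).
Qed.

Lemma CkS_intro k F (dF : 'I_N -> 'rV[R]_N -> R) : continuous F ->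
  (forall i x, is_derive x (delta_mx 0 i) F (dF i x)) -> (forall i, Ck k (dF i)) ->
  Ck k.+1 F.
Proof.
move=> cF d sdF; split=> // i; split=> [x|]; first by case: (d i x).
by rewrite (_ : partial i F = dF i) //; apply/funext => x; exact: partialE.
Qed.

Lemma CkS_is_derive k F i x : Ck k.+1 F -> is_derive x (delta_mx 0 i) F (partial i F x).
Proof. by move=> [_ /(_ i)[+ _]] => /(_ x) /derivableP. Qed.

Lemma Ck_continuous k F : Ck k F -> continuous F.
Proof. by case: k => [|k] // []. Qed.

Lemma Ck_cst k (c : R) : Ck k (fun _ : 'rV[R]_N => c).
Proof.
elim: k c => [|k IH] c; first exact: cst_continuous.
by apply: (CkS_intro (dF := fun _ _ => 0)) => //; exact: cst_continuous.
Qed.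

Lemma CkD k F G : Ck k F -> Ck k G -> Ck k (fun x => F x + G x).
Proof.
elim: k F G => [|k IH] F G kF kG; first by move=> x; apply: continuousD; [exact: kF|exact: kG].
apply: (CkS_intro (dF := fun i x => partial i F x + partial i G x)).
- by move=> x; apply: continuousD; [exact: (Ck_continuous kF)|exact: (Ck_continuous kG)].
- by move=> i x; exact: (is_deriveDr (CkS_is_derive i x kF) (CkS_is_derive i x kG)).
- by move=> i; case: kF kG => [_ /(_ i)[_ ?]] [_ /(_ i)[_ ?]]; exact: IH.
Qed.

Lemma CkM k F G : Ck k F -> Ck k G -> Ck k (fun x => F x * G x).
Proof.
elim: k F G => [|k IH] F G kF kG; first by move=> x; apply: continuousM; [exact: kF|exact: kG].
apply: (CkS_intro (dF := fun i x => partial i F x * G x + F x * partial i G x)).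
- by move=> x; apply: continuousM; [exact: (Ck_continuous kF)|exact: (Ck_continuous kG)].
- by move=> i x; exact: (is_deriveMr (CkS_is_derive i x kF) (CkS_is_derive i x kG)).
- have wF := Ck_weaken kF; have wG := Ck_weaken kG.
  by move=> i; case: kF kG => [_ /(_ i)[_ ?]] [_ /(_ i)[_ ?]]; apply: CkD; exact: IH.
Qed.

Lemma Ck_sum k (I : Type) (r : seq I) (F : I -> 'rV[R]_N -> R) :
  (forall l, Ck k (F l)) -> Ck k (fun x => \sum_(l <- r) F l x).
Proof.
move=> kF; elim: r => [|l r IH].
  by under eq_fun do rewrite big_nil; exact: Ck_cst.
by under eq_fun do rewrite big_cons; exact: CkD.
Qed.

Lemma is_derive_coord p i x : is_derive x (delta_mx 0 i) (fun y => y 0 p) (i == p)%:R.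
Proof.
rewrite -[x]addr0 -(scale0r (delta_mx 0 i)) is_derive_lineE.
apply: (is_derive_ext (F := fun r : R => (i == p)%:R * r + x 0 p)) => [r|].
  by rewrite !mxE eqxx /= [p == i]eq_sym mulrC addrC.
apply: (is_derive_eq (is_deriveDr (is_deriveZr _ (is_derive_id (0 : R) 1))
  (is_derive_cst (x 0 p) (0 : R) 1))).
by rewrite mulr1 addr0.
Qed.

Lemma Ck_coord k p : Ck k (fun x => x 0 p).
Proof.
case: k => [|k]; first exact: coord_continuous.
apply: (CkS_intro (dF := fun i _ => (i == p)%:R)).
- exact: coord_continuous.
- by move=> i x; exact: is_derive_coord.
- by move=> i; exact: Ck_cst.
Qed.

Lemma is_derive_coord_comp (h : R -> R) d p i x : is_derive (x 0 p) 1 h d ->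
  is_derive x (delta_mx 0 i) (fun y => h (y 0 p)) (d * (i == p)%:R).
Proof. by move=> dh; apply: is_derive_comp1 dh (is_derive_coord p i x). Qed.

Lemma Ck_line k p (h : R -> R) : smooth_line h -> Ck k (fun x => h (x 0 p)).
Proof.
have cp h' : smooth_line h' -> continuous (fun x : 'rV[R]_N => h' (x 0 p)).
  move=> sh x; apply: (@continuous_comp _ _ _ (fun x : 'rV[R]_N => x 0 p) h').
    exact: coord_continuous.
  exact/differentiable_continuous/derivable1_diffP/(sh 0%N).
elim: k h => [|k IH] h sh; first exact: cp.
apply: (CkS_intro (dF := fun i x => derive1 h (x 0 p) * (i == p)%:R)).
- exact: cp.
- move=> i x; apply: is_derive_coord_comp.
  by rewrite derive1E; apply/derivableP/(sh 0%N).
- move=> i; apply: CkM; last exact: Ck_cst.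
  by apply: IH => q x; rewrite -derive1Sn; exact: sh.
Qed.

End SmoothFunctions.

#[global] Opaque partial.

(** * The metric written in an orthonormal eigenbasis *)

Section WaveMetric.
Variables (R : realType) (m : nat) (f : R -> R) (a : 'I_m -> R).
Notation N := (2 + m)%N.
Notation ti := (ti m).
Notation si := (si m).
Implicit Types (x y : 'rV[R]_N) (phi : 'rV[R]_N -> 'rV[R]_N).

Definition wave_kappa x : R := \sum_i (f (x 0 ti) + a i) * x 0 (xi i) ^+ 2.

Lemma wave_kappaE x : wave_kappa x = \sum_i (f (x 0 ti) + a i) * x 0 (xi i) ^+ 2.
Proof. by []. Qed.

Definition wave_mx x : 'M[R]_N := metric_mx m (wave_kappa x).

Definition kappa_grad x (p : 'I_N) : R :=
  (p == ti)%:R * (\sum_i derive1 f (x 0 ti) * x 0 (xi i) ^+ 2)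
  + \sum_i (p == xi i)%:R * (2 * (f (x 0 ti) + a i) * x 0 (xi i)).

Lemma kappa_grad_t x : kappa_grad x ti = \sum_i derive1 f (x 0 ti) * x 0 (xi i) ^+ 2.
Proof.
by rewrite /kappa_grad eqxx mul1r [X in _ + X]big1 ?addr0 // => i _; rewrite ti_xi mul0r.
Qed.

Lemma kappa_grad_s x : kappa_grad x si = 0.
Proof. by rewrite /kappa_grad si_ti mul0r add0r big1 // => i _; rewrite si_xi mul0r. Qed.

Lemma kappa_grad_x x i : kappa_grad x (xi i) = 2 * (f (x 0 ti) + a i) * x 0 (xi i).
Proof.
rewrite /kappa_grad xi_ti mul0r add0r; under eq_bigr do rewrite xi_xi eq_sym.
exact: sum_delta.
Qed.

Hypothesis f_smooth : smooth_line f.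

Let df (t : R) : is_derive t 1 f (derive1 f t).
Proof. by have /derivableP := @f_smooth 0%N t; rewrite derive1E. Qed.

Lemma is_derive_kappa phi x v (d : 'I_N -> R) :
  (forall p, is_derive x v (fun y => phi y 0 p) (d p)) ->
  is_derive x v (fun y => wave_kappa (phi y)) (\sum_p kappa_grad (phi x) p * d p).
Proof.
move=> dphi; rewrite sum_coord kappa_grad_s mul0r addr0.
have -> : kappa_grad (phi x) ti * d ti
    = \sum_i (derive1 f (phi x 0 ti) * d ti) * phi x 0 (xi i) ^+ 2.
  by rewrite kappa_grad_t mulr_suml; apply: eq_bigr => i _; ring.
rewrite -big_split /=; apply: is_derive_sumr => i.
have dT : is_derive x v (fun y => f (phi y 0 ti) + a i) (derive1 f (phi x 0 ti) * d ti).
  by rewrite -[X in is_derive _ _ _ X]addr0; apply: is_deriveDr; apply: is_derive_comp1.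
apply: (is_derive_eq (is_deriveMr dT (is_deriveMr (dphi (xi i)) (dphi (xi i))))).
by rewrite kappa_grad_x; ring.
Qed.

Lemma partial_kappa c x : is_derive x (delta_mx 0 c) wave_kappa (kappa_grad x c).
Proof.
apply: (is_derive_eq (is_derive_kappa (phi := id) (fun p => is_derive_coord p c x))).
by under eq_bigr do rewrite eq_sym mulrC; rewrite sum_delta.
Qed.

Lemma pullback_waveE phi x p q : pullback_metric wave_mx phi x p q =
  metric_form (wave_kappa (phi x)) (fun r => partial p (fun y => phi y 0 r) x)
    (fun r => partial q (fun y => phi y 0 r) x).
Proof.
rewrite -metric_formE /pullback_metric mxE; under eq_bigr do rewrite mxE mulr_suml.
rewrite exchange_big; apply: eq_bigr => r _; apply: eq_bigr => l _.
by rewrite !mxE.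
Qed.

End WaveMetric.

#[global] Opaque wave_kappa kappa_grad.

Section TimeAxis.
Variables (R : realType) (m : nat).

(** All first derivatives of $\kappa$ vanish on this line, which makes it the place where second
    derivatives of an isometry are evaluated. *)
Definition time_axis (t : R) : 'rV[R]_(2 + m) := t *: delta_mx 0 (ti m).

Lemma time_axisE t p : time_axis t 0 p = t * (p == ti m)%:R.
Proof. by rewrite !mxE. Qed.

Lemma time_axis_t t : time_axis t 0 (ti m) = t.
Proof. by rewrite time_axisE eqxx mulr1. Qed.

Lemma time_axis_x t i : time_axis t 0 (xi i) = 0.
Proof. by rewrite time_axisE xi_ti mulr0. Qed.

Lemma time_axis_line t : time_axis t = 0 + t *: delta_mx 0 (ti m).
Proof. by rewrite add0r. Qed.

End TimeAxis.

#[global] Opaque time_axis.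

(** * Isometries of plane waves *)

Section FormTransport.
Variables (R : realType) (m : nat).
Notation N := (2 + m)%N.
Notation ti := (ti m).
Notation si := (si m).
Implicit Types (k : R) (J : 'I_N -> 'I_N -> R) (P c : 'I_N -> R).

Lemma metric_mxK k : inverse_mx m k *m metric_mx m k = 1%:M.
Proof. exact: mulmx1C (inverse_mxK m k). Qed.

Lemma inverse_metric_form k c (v : 'I_N -> R) :
  metric_form k (fun r => \sum_q c q * inverse_mx m k q r) v = \sum_q c q * v q.
Proof.
rewrite -metric_formE.
have -> : \sum_p \sum_q (\sum_l c l * inverse_mx m k l p) * metric_mx m k p q * v q
   = ((\row_l c l) *m inverse_mx m k *m metric_mx m k *m (\col_q v q)) 0 0.
  rewrite mxE exchange_big; apply: eq_bigr => q _; rewrite mxE mulr_suml mxE.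
  apply: eq_bigr => p _; rewrite !mxE; congr (_ * _ * _).
  by apply: eq_bigr => l _; rewrite [in RHS]mxE.
rewrite -[_ *m _ *m metric_mx m k]mulmxA metric_mxK mulmx1 mxE.
by apply: eq_bigr => q _; rewrite !mxE.
Qed.

(* [J] is an isometry from the metric at a point to the metric at its image, so
   that raising an index commutes with it. *)
Lemma form_transport k k' J :
  (forall p q, metric_form k' (J p) (J q) = metric_mx m k p q) ->
  forall P p, inverse_form k (fun b => metric_form k' P (J b)) (fun d => J d p) = P p.
Proof.
move=> hJ P p; pose JM : 'M[R]_N := \matrix_(i, j) J i j.
have JMJ : JM *m metric_mx m k' *m JM^T = metric_mx m k.
  apply/matrixP => i j; rewrite -hJ -metric_formE mxE exchange_big.
  apply: eq_bigr => q _; rewrite mxE mulr_suml mxE.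
  by apply: eq_bigr => l _; rewrite !mxE.
have J1 : metric_mx m k' *m JM^T *m inverse_mx m k *m JM = 1%:M.
  by apply: mulmx1C; rewrite !mulmxA JMJ inverse_mxK.
have -> : P p = ((\row_q P q) *m (metric_mx m k' *m JM^T *m inverse_mx m k *m JM)) 0 p.
  by rewrite J1 mulmx1 mxE.
rewrite !mulmxA mxE -inverse_formE exchange_big; apply: eq_bigr => d _.
rewrite !mxE mulr_suml; apply: eq_bigr => b _; congr (_ * _ * _).
rewrite -metric_formE mxE exchange_big; apply: eq_bigr => q _.
by rewrite !mxE mulr_suml; apply: eq_bigr => l _; rewrite !mxE.
Qed.

Lemma inverse_form_transport k k' J :
  (forall p q, metric_form k' (J p) (J q) = metric_mx m k p q) ->
  forall c p, inverse_form k (fun b => \sum_q c q * J b q) (fun d => J d p)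
    = \sum_q c q * inverse_mx m k' q p.
Proof.
move=> hJ c p; rewrite -(form_transport hJ (fun r => \sum_q c q * inverse_mx m k' q r)).
by congr inverse_form; apply/funext => b; rewrite inverse_metric_form.
Qed.

Lemma inverse_form_t k v : inverse_form k (fun b => (b == ti)%:R) v = 2 * v si.
Proof.
rewrite /inverse_form eqxx si_ti big1 => [|i _]; last by rewrite xi_ti mul0r.
by rewrite /=; ring.
Qed.

End FormTransport.

(** The hypothesis for $(c, b, e)$ plus that for $(b, c, e)$ minus that for $(e, c, b)$, as for the
    Levi-Civita connection. Only the coefficient of $dt^2$ varies, so the metric has derivative
    [k c * th b * th e] in direction [c]; [K] and [T] are the corresponding data at the image
    point. *)
Lemma koszul_formula (R : comRingType) (I V : Type) (M : V -> V -> R)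
    (D1 : I -> V) (D2 : I -> I -> V) (K T k th : I -> R) :
  (forall u v, M u v = M v u) -> (forall b c, D2 b c = D2 c b) ->
  (forall c b e, K c * T b * T e + M (D2 c b) (D1 e) + M (D1 b) (D2 c e)
     = k c * th b * th e) ->
  forall c b e, 2 * M (D2 c b) (D1 e) =
    (k c * th b + k b * th c) * th e - th b * th c * k e
    - ((K c * T b + K b * T c) * T e - T b * T c * K e).
Proof.
move=> MC DC H c b e; have e1 := H c b e; have e2 := H b c e; have e3 := H e c b.
rewrite (DC b c) in e2; rewrite (DC e c) (DC e b) in e3.
rewrite [M (D2 c e) _]MC in e3.
have -> : (k c * th b + k b * th c) * th e - th b * th c * k e
  = k c * th b * th e + k b * th c * th e - k e * th c * th b by ring.
by rewrite -e1 -e2 -e3; ring.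
Qed.

(** * Second derivatives of an isometry in terms of its first derivatives *)

Section Isometries.
Variables (R : realType) (m : nat) (f : R -> R) (a : 'I_m -> R).
Hypothesis f_smooth : smooth_line f.
Notation N := (2 + m)%N.
Notation ti := (ti m).
Notation si := (si m).
Notation kappa := (wave_kappa f a).
Notation dkappa := (kappa_grad f a).
Implicit Types (x y : 'rV[R]_N).

Lemma is_derive_metric_form x e (k : 'rV[R]_N -> R) k' (u v : 'I_N -> 'rV[R]_N -> R)
    (u' v' : 'I_N -> R) :
  is_derive x e k k' -> (forall p, is_derive x e (u p) (u' p)) ->
  (forall p, is_derive x e (v p) (v' p)) ->
  is_derive x e (fun y => metric_form (k y) (u^~ y) (v^~ y))
    (k' * u ti x * v ti x + metric_form (k x) u' (v^~ x) + metric_form (k x) (u^~ x) v').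
Proof.
move=> dk du dv.
have d1 := is_deriveMr (is_deriveMr dk (du ti)) (dv ti).
have d2 := is_deriveZr 2^-1 (is_deriveDr (is_deriveMr (du ti) (dv si)) (is_deriveMr (du si) (dv ti))).
have d3 := is_derive_sumr (fun i => is_deriveMr (du (xi i)) (dv (xi i))).
apply: (is_derive_eq (is_deriveDr (is_deriveDr d1 d2) d3)).
by rewrite /metric_form big_split /=; ring.
Qed.

Variable phi : 'rV[R]_N -> 'rV[R]_N.
Hypothesis phi_smooth : smooth_map phi.
Hypothesis phi_isom : forall x, pullback_metric (wave_mx f a) phi x = wave_mx f a x.

Notation comp p := (fun y => phi y 0 p).
Notation d1 p b x := (partial b (comp p) x).
Notation d2 p c b x := (partial c (partial b (comp p)) x).

Let dcomp p b x : is_derive x (delta_mx 0 b) (comp p) (d1 p b x).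
Proof. exact: smooth_is_derive (phi_smooth p). Qed.

Let dcomp2 p c b x : is_derive x (delta_mx 0 c) (partial b (comp p)) (d2 p c b x).
Proof. exact: smooth_is_derive (smooth_partial b (phi_smooth p)). Qed.

Let d2C p c b x : d2 p c b x = d2 p b c x.
Proof. exact: partialC (phi_smooth p). Qed.

Let isomE x b e : metric_form (kappa (phi x)) (fun p => d1 p b x) (fun p => d1 p e x)
  = metric_mx m (kappa x) b e.
Proof. by rewrite -pullback_waveE phi_isom. Qed.

Let Kd x c : R := \sum_p dkappa (phi x) p * d1 p c x.

Let isom_derive x c b e :
  Kd x c * d1 ti b x * d1 ti e x
  + metric_form (kappa (phi x)) (fun p => d2 p c b x) (fun p => d1 p e x)
  + metric_form (kappa (phi x)) (fun p => d1 p b x) (fun p => d2 p c e x)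
  = dkappa x c * (b == ti)%:R * (e == ti)%:R.
Proof.
have l := is_derive_metric_form (is_derive_kappa a f_smooth (fun p => dcomp p c x))
  (fun p => dcomp2 p c b x) (fun p => dcomp2 p c e x).
have r := is_derive_metric_form (partial_kappa a f_smooth c x)
  (fun p => is_derive_cst (unit_vec R b p) x (delta_mx 0 c))
  (fun p => is_derive_cst (unit_vec R e p) x (delta_mx 0 c)).
have E : (fun y => metric_form (kappa (phi y)) (fun p => d1 p b y) (fun p => d1 p e y))
   = (fun y => metric_form (kappa y) (unit_vec R b) (unit_vec R e)).
  by apply/funext => y; rewrite isomE metric_form_unit.
case: l; rewrite E => _ <-; case: r => _ ->.
have z (v : 'I_N -> R) k : metric_form k (fun=> 0) v = 0.
  by rewrite /metric_form big1 => [|i _]; rewrite ?mul0r //; ring.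
rewrite z metric_formC z !addr0 /unit_vec /= [b == _]eq_sym [e == _]eq_sym //.
Qed.

(** The Koszul formula gives the pairing of the second derivative with the image of every coordinate
    vector. These images form a frame, and raising the index through [form_transport] isolates the
    component [p]. *)
Lemma hessian_component p c b x :
  2 * d2 p c b x =
  (dkappa x c * (b == ti)%:R + dkappa x b * (c == ti)%:R) * (2 * d1 p si x)
  - (b == ti)%:R * (c == ti)%:R * (2 * dkappa x ti * d1 p si x
       + \sum_i dkappa x (xi i) * d1 p (xi i) x)
  - (Kd x c * d1 ti b x + Kd x b * d1 ti c x) * inverse_mx m (kappa (phi x)) ti p
  + d1 ti b x * d1 ti c x * \sum_q dkappa (phi x) q * inverse_mx m (kappa (phi x)) q p.
Proof.
pose th (e : 'I_N) : R := (e == ti)%:R.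
(* The Koszul formula as a combination of the four covectors $dt$, $d\kappa$ and their pullbacks
   under [phi]; the factors 1 give it the shape to which linearity of [inverse_form] applies. *)
have K e : metric_form (kappa (phi x)) (fun p => d2 p c b x) (fun p => d1 p e x) =
   1 * (2^-1 * (dkappa x c * th b + dkappa x b * th c) * th e
         + (- (2^-1 * th b * th c)) * dkappa x e)
   + 1 * (- (2^-1 * (Kd x c * d1 ti b x + Kd x b * d1 ti c x)) * d1 ti e x
         + 2^-1 * d1 ti b x * d1 ti c x * Kd x e).
  apply: (mulfI (x := 2)); first by rewrite pnatr_eq0.
  rewrite (@koszul_formula _ _ _ (metric_form (kappa (phi x))) (fun e p => d1 p e x)
    (fun c b p => d2 p c b x) (Kd x) (fun e => d1 ti e x) (dkappa x) th).
  - by move: (dkappa x c) (dkappa x b) (dkappa x e) (Kd x c) (Kd x b) (Kd x e) (d1 ti b x)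
      (d1 ti c x) (d1 ti e x) (th b) (th c) (th e) => *; field.
  - exact: metric_formC.
  - by move=> b' c'; apply/funext => q; exact: d2C.
  - exact: isom_derive.
have := form_transport (isomE x) (fun p => d2 p c b x) p.
under [X in inverse_form _ X _]eq_fun do rewrite K.
rewrite !inverse_formDl inverse_form_t => <-.
have hK := inverse_form_transport (isomE x) (dkappa (phi x)) p.
have hT : inverse_form (kappa x) (fun e => d1 ti e x) (fun d => d1 p d x)
    = inverse_mx m (kappa (phi x)) ti p.
  rewrite -[RHS](sum_unit_vec ti (fun q => inverse_mx m (kappa (phi x)) q p)).
  rewrite -(inverse_form_transport (isomE x) (unit_vec R ti) p).
  by congr inverse_form; apply/funext => e; rewrite sum_unit_vec.
have hk : inverse_form (kappa x) (dkappa x) (fun d => d1 p d x) =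
    2 * dkappa x ti * d1 p si x + \sum_i dkappa x (xi i) * d1 p (xi i) x.
  by rewrite /inverse_form kappa_grad_s; ring.
rewrite hT hK hk /th.
move: (dkappa x c) (dkappa x b) (Kd x c) (Kd x b) (d1 ti b x) (d1 ti c x) (b == ti)%:R
  (c == ti)%:R (inverse_mx _ _ ti p) (\sum_q _) (\sum_i _) (dkappa x ti) (d1 p si x) => *.
by field.
Qed.

End Isometries.

(** * The maps built from an orthogonal matrix and solutions of $u'' = (f + A) u$ *)

Section WaveMaps.
Variables (R : realType) (m : nat) (f : R -> R) (a : 'I_m -> R).
Hypothesis f_smooth : smooth_line f.
Notation N := (2 + m)%N.
Notation ti := (ti m).
Notation si := (si m).
Notation kappa := (wave_kappa f a).
Implicit Types (x y : 'rV[R]_N) (C : 'M[R]_m) (u : 'I_m -> R -> R) (c : R).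

Definition xpart C x (k : 'I_m) : R := \sum_i C k i * x 0 (xi i).

Definition wave_map C u u1 c x : 'rV[R]_N :=
  row_mx (\row_(j < 2) if j == 0 then x 0 ti else
            x 0 si - 2 * (\sum_k u1 k (x 0 ti) * xpart C x k)
            - \sum_k u k (x 0 ti) * u1 k (x 0 ti) + c)
         (\row_k (xpart C x k + u k (x 0 ti))).

Lemma wave_map_t C u u1 c x : wave_map C u u1 c x 0 ti = x 0 ti.
Proof. by rewrite /wave_map row_mx_t mxE. Qed.

Lemma wave_map_s C u u1 c x : wave_map C u u1 c x 0 si =
  x 0 si - 2 * (\sum_k u1 k (x 0 ti) * xpart C x k)
  - \sum_k u k (x 0 ti) * u1 k (x 0 ti) + c.
Proof. by rewrite /wave_map row_mx_s mxE. Qed.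

Lemma wave_map_x C u u1 c x k :
  wave_map C u u1 c x 0 (xi k) = xpart C x k + u k (x 0 ti).
Proof. by rewrite /wave_map row_mx_x mxE. Qed.

Definition xdir C (b : 'I_N) (k : 'I_m) : R := \sum_i C k i * (b == xi i)%:R.

Lemma is_derive_xpart C k b x :
  is_derive x (delta_mx 0 b) (fun y => xpart C y k) (xdir C b k).
Proof. by apply: is_derive_sumr => i; apply: is_deriveZr; exact: is_derive_coord. Qed.

Lemma sum_orthogonal (C : 'M[R]_m) (v w : 'I_m -> R) : C^T *m C = 1%:M ->
  \sum_k (\sum_i C k i * v i) * (\sum_i C k i * w i) = \sum_i v i * w i.
Proof.
move=> CC; transitivity (\sum_i \sum_j (C^T *m C) i j * (v i * w j)).
  under eq_bigr => k _.
    rewrite mulr_suml; under eq_bigr do rewrite mulr_sumr; over.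
  rewrite exchange_big; apply: eq_bigr => i _; rewrite exchange_big.
  apply: eq_bigr => j _; rewrite mxE mulr_suml; apply: eq_bigr => k _.
  by rewrite mxE; ring.
apply: eq_bigr => i _; rewrite CC; under eq_bigr do rewrite mxE eq_sym.
by rewrite (sum_delta (fun j => v i * w j)).
Qed.

(** Being orthogonal and commuting with $f + A$, the matrix [C] preserves the quadratic form; only
    the translation by [y] contributes further terms. *)
Lemma kappa_affine C x (y : 'I_m -> R) : C^T *m C = 1%:M -> block_diagonal a C ->
  \sum_k (f (x 0 ti) + a k) * (xpart C x k + y k) ^+ 2 =
  kappa x + 2 * (\sum_k (f (x 0 ti) + a k) * y k * xpart C x k)
  + \sum_k (f (x 0 ti) + a k) * y k * y k.
Proof.
move=> CC bC; have -> : kappa x = \sum_k xpart C x k *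
    (\sum_i C k i * ((f (x 0 ti) + a i) * x 0 (xi i))).
  by rewrite sum_orthogonal // wave_kappaE; apply: eq_bigr => i _; ring.
rewrite mulr_sumr -!big_split; apply: eq_bigr => k _ /=.
have -> : \sum_i C k i * ((f (x 0 ti) + a i) * x 0 (xi i))
    = (f (x 0 ti) + a k) * xpart C x k.
  rewrite mulr_sumr; apply: eq_bigr => i _.
  by have [->|/bC ->] := eqVneq (a k) (a i); ring.
ring.
Qed.

Section Isometric.
Variables (C : 'M[R]_m) (u u1 : 'I_m -> R -> R) (c : R).
Hypotheses (du : forall k (t : R), is_derive t 1 (u k) (u1 k t))
  (du1 : forall k (t : R), is_derive t 1 (u1 k) ((f t + a k) * u k t)).
Hypotheses (CC : C^T *m C = 1%:M) (bC : block_diagonal a C).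
Notation phi := (wave_map C u u1 c).

Lemma is_derive_wave_map_t b x :
  is_derive x (delta_mx 0 b) (fun y => phi y 0 ti) (b == ti)%:R.
Proof.
by apply: is_derive_ext (is_derive_coord ti b x) => y; rewrite wave_map_t.
Qed.

Lemma is_derive_wave_map_x k b x :
  is_derive x (delta_mx 0 b) (fun y => phi y 0 (xi k)) (xdir C b k + u1 k (x 0 ti) * (b == ti)%:R).
Proof.
apply: (is_derive_ext (F := fun y => xpart C y k + u k (y 0 ti))) => [y|].
  by rewrite wave_map_x.
by apply: is_deriveDr; [exact: is_derive_xpart|exact: is_derive_coord_comp].
Qed.

Lemma is_derive_wave_map_s b x :
  is_derive x (delta_mx 0 b) (fun y => phi y 0 si)
   ((b == si)%:R - 2 * (\sum_k u1 k (x 0 ti) * xdir C b k)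
    - (b == ti)%:R * (2 * (\sum_k (f (x 0 ti) + a k) * u k (x 0 ti) * xpart C x k)
       + \sum_k u1 k (x 0 ti) * u1 k (x 0 ti)
       + \sum_k (f (x 0 ti) + a k) * u k (x 0 ti) * u k (x 0 ti))).
Proof.
apply: (is_derive_ext (F := fun x => x 0 si - 2 * (\sum_k u1 k (x 0 ti) * xpart C x k)
  - \sum_k u k (x 0 ti) * u1 k (x 0 ti) + c)) => [y|].
  by rewrite wave_map_s.
have d1 := is_deriveZr 2 (is_derive_sumr (fun k =>
  is_deriveMr (is_derive_coord_comp (p := ti) b (du1 k (x 0 ti))) (is_derive_xpart C k b x))).
have d2 := is_derive_sumr (fun k =>
  is_deriveMr (is_derive_coord_comp (p := ti) b (du k (x 0 ti)))
    (is_derive_coord_comp (p := ti) b (du1 k (x 0 ti)))).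
apply: (is_derive_eq (is_deriveDr (is_deriveBr (is_deriveBr (is_derive_coord si b x) d1) d2)
  (is_derive_cst c x _))).
rewrite addr0 !big_split /= !mulrDr !mulr_sumr !opprD !addrA.
have e1 : \sum_i 2 * ((f (x 0 ti) + a i) * u i (x 0 ti) * (b == ti)%:R * xpart C x i)
  = \sum_i (b == ti)%:R * (2 * ((f (x 0 ti) + a i) * u i (x 0 ti) * xpart C x i)).
  by apply: eq_bigr => i _; ring.
have e2 : \sum_i u1 i (x 0 ti) * (b == ti)%:R * u1 i (x 0 ti)
  = \sum_i (b == ti)%:R * (u1 i (x 0 ti) * u1 i (x 0 ti)).
  by apply: eq_bigr => i _; ring.
have e3 : \sum_i u i (x 0 ti) * ((f (x 0 ti) + a i) * u i (x 0 ti) * (b == ti)%:R)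
  = \sum_i (b == ti)%:R * ((f (x 0 ti) + a i) * u i (x 0 ti) * u i (x 0 ti)).
  by apply: eq_bigr => i _; ring.
by rewrite e1 e2 e3; ring.
Qed.

(** The translation by $u(t)$ adds $2 \langle u', C\,dx \rangle dt$ and $|u'|^2 dt^2$, and it
    changes $\kappa$. The differential of the $s$ component cancels all of these; the equation for
    $u''$ matches the derivative of $u'$ with the change of $\kappa$. *)
Lemma wave_map_pullback x : pullback_metric (wave_mx f a) phi x = wave_mx f a x.
Proof.
apply/matrixP => b e; rewrite pullback_waveE.
set z := x 0 ti.
rewrite -metric_form_unit /metric_form.
rewrite !(partialE (is_derive_wave_map_t _ _)) !(partialE (is_derive_wave_map_s _ _)).
have -> : \sum_i partial b (fun y => phi y 0 (xi i)) x * partial e (fun y => phi y 0 (xi i)) x =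
    \sum_k (xdir C b k + u1 k z * (b == ti)%:R) * (xdir C e k + u1 k z * (e == ti)%:R).
  by apply: eq_bigr => k _; rewrite !(partialE (is_derive_wave_map_x _ _ _)).
have -> : kappa (phi x) = kappa x + 2 * (\sum_k (f z + a k) * u k z * xpart C x k)
    + \sum_k (f z + a k) * u k z * u k z.
  rewrite -kappa_affine // wave_kappaE wave_map_t.
  by apply: eq_bigr => k _; rewrite wave_map_x.
have -> : \sum_k (xdir C b k + u1 k z * (b == ti)%:R) * (xdir C e k + u1 k z * (e == ti)%:R)
  = \sum_i unit_vec R b (xi i) * unit_vec R e (xi i)
    + (e == ti)%:R * (\sum_k u1 k z * xdir C b k) + (b == ti)%:R * (\sum_k u1 k z * xdir C e k)
    + (b == ti)%:R * (e == ti)%:R * (\sum_k u1 k z * u1 k z).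
  rewrite /unit_vec; under [X in X + _ + _ + _]eq_bigr do rewrite eq_sym [xi _ == e]eq_sym.
  rewrite -(sum_orthogonal (fun i => (b == xi i)%:R) (fun i => (e == xi i)%:R) CC).
  rewrite !mulr_sumr -!big_split.
  by apply: eq_bigr => k _ /=; rewrite -!/(xdir C _ _); ring.
rewrite /unit_vec ![ti == _]eq_sym ![si == _]eq_sym -/z.
by move: (\sum_k (f z + a k) * u k z * xpart C x k) (\sum_k (f z + a k) * u k z * u k z)
  (\sum_k u1 k z * xdir C b k) (\sum_k u1 k z * xdir C e k) (\sum_k u1 k z * u1 k z)
  (\sum_i _) => s1 s2 s3 s4 s5 s6; field.
Qed.

(** The equation bootstraps regularity: [u] and [u1] gain derivatives together, since their
    derivatives are [u1] and $(f + a_k) u$. *)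
Lemma wave_map_smooth : smooth_map phi.
Proof.
have Cku n k : Ck n (fun x : 'rV[R]_N => u k (x 0 ti)) /\ Ck n (fun x : 'rV[R]_N => u1 k (x 0 ti)).
  elim: n => [|n [IH IH1]].
    have cc (h h1 : R -> R) : (forall t : R, is_derive t 1 h (h1 t)) ->
        continuous (fun x : 'rV[R]_N => h (x 0 ti)).
      move=> dh x; apply: (@continuous_comp _ _ _ (fun x : 'rV[R]_N => x 0 ti) h).
        exact: coord_continuous.
      exact: (is_derive_continuous dh).
    by split; [exact: (cc _ _ (du k))|exact: (cc _ _ (du1 k))].
  split.
  - apply: (CkS_intro (dF := fun b x => u1 k (x 0 ti) * (b == ti)%:R)).
    + exact: Ck_continuous IH.
    + by move=> b x; exact: is_derive_coord_comp.
    + by move=> b; apply: CkM => //; exact: Ck_cst.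
  - apply: (CkS_intro (dF := fun b x => (f (x 0 ti) + a k) * u k (x 0 ti) * (b == ti)%:R)).
    + exact: Ck_continuous IH1.
    + by move=> b x; apply: is_derive_coord_comp.
    + move=> b; apply: CkM; last exact: Ck_cst.
      by apply: CkM => //; apply: CkD; [exact: Ck_line|exact: Ck_cst].
have Cx n k : Ck n (fun x => xpart C x k).
  by apply: Ck_sum => i; apply: CkM; [exact: Ck_cst|exact: Ck_coord].
move=> p n; case: (coordP p) => [||k].
- by under eq_fun do rewrite wave_map_t; exact: Ck_coord.
- under eq_fun do rewrite wave_map_s.
  apply: CkD; last exact: Ck_cst.
  under eq_fun do rewrite -[X in X - _]addr0 -[- (2 * _)]mulN1r -[- (\sum_k _)]mulN1r.
  have [Cu Cu1] : (forall k, Ck n (fun x : 'rV[R]_N => u k (x 0 ti))) /\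
    (forall k, Ck n (fun x : 'rV[R]_N => u1 k (x 0 ti))) by split=> k; case: (Cku n k).
  do ?[apply: CkD | apply: CkM | apply: Ck_sum => ? | exact: Ck_cst | exact: Ck_coord
    | exact: Cu | exact: Cu1 | exact: Cx].
- under eq_fun do rewrite wave_map_x.
  by apply: CkD; [exact: Cx|case: (Cku n k)].
Qed.

End Isometric.

End WaveMaps.

Section CoordinateInvariance.
Variables (R : realType) (N : nat).
Implicit Types (F : 'rV[R]_N -> R) (x y w : 'rV[R]_N).

(** The coordinates of [x] are replaced by those of [y] one at a time. *)
Lemma coord_invariant (P : pred 'I_N) F :
  (forall c, P c -> forall y r, F (y + r *: delta_mx 0 c) = F y) ->
  forall x y, (forall c, ~~ P c -> x 0 c = y 0 c) -> F x = F y.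
Proof.
move=> FP x y xy.
have H (s : seq 'I_N) : F (\row_c if c \in s then y 0 c else x 0 c) = F x.
  elim: s => [|c s IH].
    by congr F; apply/rowP => c; rewrite mxE.
  rewrite -[RHS]IH.
  have [Pc|/xy xyc] := boolP (P c).
    pose r := if c \in s then 0 else y 0 c - x 0 c.
    rewrite -(FP c Pc (\row_c if c \in s then y 0 c else x 0 c) r); congr F.
    apply/rowP => d; rewrite !mxE inE eqxx /= /r.
    have [->|dc] /= := eqVneq d c; last by rewrite mulr0 addr0.
    by case: ifP => _; rewrite mulr1 ?addr0 // addrC subrK.
  congr F; apply/rowP => d; rewrite !mxE inE.
  by have [->|//] /= := eqVneq d c; rewrite xyc if_same.
rewrite -(H (index_enum 'I_N)); congr F.
by apply/rowP => c; rewrite mxE mem_index_enum.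
Qed.

End CoordinateInvariance.

(** * Classification of the isometries for non-constant $f$ *)

Section IsometryClassification.
Variables (R : realType) (m : nat) (f : R -> R) (a : 'I_m -> R).
Hypothesis f_smooth : smooth_line f.
Hypothesis f_nonconst : exists t1 t2, f t1 != f t2.
Hypothesis a_sum0 : \sum_i a i = 0.
Hypothesis a_neq0 : exists i, a i != 0.
Notation N := (2 + m)%N.
Notation ti := (ti m).
Notation si := (si m).
Notation kappa := (wave_kappa f a).
Notation dkappa := (kappa_grad f a).
Implicit Types (x y : 'rV[R]_N).

Variable phi : 'rV[R]_N -> 'rV[R]_N.
Hypothesis phi_smooth : smooth_map phi.
Hypothesis phi_isom : forall x, pullback_metric (wave_mx f a) phi x = wave_mx f a x.

Notation comp p := (fun y => phi y 0 p).
Notation d1 p b := (partial b (comp p)).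
Notation d2 p c b := (partial c (partial b (comp p))).

Let dcomp p b x : is_derive x (delta_mx 0 b) (comp p) (d1 p b x).
Proof. exact: smooth_is_derive (phi_smooth p). Qed.

Let dcomp2 p c b x : is_derive x (delta_mx 0 c) (d1 p b) (d2 p c b x).
Proof. exact: smooth_is_derive (smooth_partial b (phi_smooth p)). Qed.

Let isomE x b e : metric_form (kappa (phi x)) (fun p => d1 p b x) (fun p => d1 p e x)
  = metric_mx m (kappa x) b e.
Proof. by rewrite -pullback_waveE phi_isom. Qed.

Let hess_t c b x : 2 * d2 ti c b x =
  (dkappa x c * (b == ti)%:R + dkappa x b * (c == ti)%:R) * (2 * d1 ti si x)
  - (b == ti)%:R * (c == ti)%:R * (2 * dkappa x ti * d1 ti si x
       + \sum_i dkappa x (xi i) * d1 ti (xi i) x).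
Proof.
rewrite (hessian_component f_smooth phi_smooth phi_isom) inverse_mx_t ti_si sum_inverse_t.
by rewrite kappa_grad_s mulr0n !mulr0 subr0 addr0.
Qed.

Let hess_x k c b x : 2 * d2 (xi k) c b x =
  (dkappa x c * (b == ti)%:R + dkappa x b * (c == ti)%:R) * (2 * d1 (xi k) si x)
  - (b == ti)%:R * (c == ti)%:R * (2 * dkappa x ti * d1 (xi k) si x
       + \sum_i dkappa x (xi i) * d1 (xi k) (xi i) x)
  + d1 ti b x * d1 ti c x * dkappa (phi x) (xi k).
Proof.
rewrite (hessian_component f_smooth phi_smooth phi_isom) inverse_mx_x ti_xi sum_inverse_x.
by rewrite mulr0n mulr0 subr0.
Qed.

Let two_neq0 : (2 : R) != 0. Proof. by rewrite pnatr_eq0. Qed.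

Let invariant p b c : (forall x, 2 * d2 p c b x = 0) ->
  forall x r, d1 p b (x + r *: delta_mx 0 c) = d1 p b x.
Proof.
move=> h; apply: derive0_line => x.
by have := dcomp2 p c b x; rewrite (mulfI two_neq0 (etrans (h x) (esym (mulr0 2)))).
Qed.

Let constant p b : (forall c x, 2 * d2 p c b x = 0) -> forall x y, d1 p b x = d1 p b y.
Proof.
move=> h x y; apply: (@coord_invariant _ _ predT) => // c _; exact: invariant.
Qed.

Notation pt := (time_axis m).

Let xdelta (t : R) i p : (pt t + 1 *: delta_mx 0 (xi i)) 0 p = t * (p == ti)%:R + (p == xi i)%:R.
Proof. by rewrite scale1r mxE time_axisE [X in _ + X]mxE eqxx. Qed.

(** Subtracting the equations at two times with different values of [f] removes [a i]. *)
Let f_kernel i (r : R) : (forall t, (f t + a i) * r = 0) -> r = 0.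
Proof.
case: f_nonconst => t1 [t2 ft] h; have : (f t1 - f t2) * r = 0.
  by rewrite -[RHS](subrr 0) -{1}(h t1) -(h t2); ring.
by move/eqP; rewrite mulf_eq0 subr_eq0 (negPf ft) /= => /eqP.
Qed.

Let dkappa_pt t i : dkappa (pt t) (xi i) = 0.
Proof. by rewrite kappa_grad_x time_axis_x mulr0. Qed.

Let dkappa_xdelta t i j : dkappa (pt t + 1 *: delta_mx 0 (xi i)) (xi j)
  = 2 * (f t + a j) * (j == i)%:R.
Proof. by rewrite kappa_grad_x !xdelta !coordE mulr0 add0r /= mulr1 addr0. Qed.

(** If [d1 p b] does not depend on $x_i$, neither does its time derivative. Evaluating the Hessian
    formula on both sides, where [dkappa] is 0 on the axis and $2 (f + a_i)$ in slot $x_i$ at the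
    translate, produces equations of the form required by [f_kernel]. *)
Let shift_hess p b i t : (forall x, 2 * d2 p (xi i) b x = 0) ->
  d2 p ti b (pt t + 1 *: delta_mx 0 (xi i)) = d2 p ti b (pt t).
Proof. by move=> h; exact: (partial_shift ti (pt t) (fun y => invariant h y 1)). Qed.

Let hess_t_tx i y : 2 * d2 ti ti (xi i) y = dkappa y (xi i) * (2 * d1 ti si y).
Proof. by rewrite hess_t xi_ti eqxx natr_false natr_true mulr0 mulr1 add0r !mul0r subr0. Qed.

Let hess_t_xx i j y : 2 * d2 ti (xi i) (xi j) y = 0.
Proof. by rewrite hess_t !xi_ti natr_false !mulr0 addr0 !mul0r subr0. Qed.

Let T_s x : d1 ti si x = 0.
Proof.
have T_s0 y z : d1 ti si y = d1 ti si z.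
  by apply: constant => c w; rewrite hess_t kappa_grad_s si_ti natr_false mulr0 !mul0r addr0 mul0r subr0.
have [i _] := a_neq0; apply: (f_kernel (i := i)) => t.
have /(congr1 (fun r => 2 * r)) := shift_hess t (hess_t_xx i i).
rewrite [LHS]hess_t_tx [RHS]hess_t_tx [in RHS]dkappa_pt dkappa_xdelta eqxx natr_true mulr1.
rewrite mul0r (T_s0 _ x) -mulrA.
by move=> /eqP; rewrite mulrCA !mulf_eq0 (negPf two_neq0) /= -mulf_eq0 => /eqP.
Qed.

Let hess_t_tt y : 2 * d2 ti ti ti y = - \sum_i dkappa y (xi i) * d1 ti (xi i) y.
Proof.
rewrite hess_t T_s eqxx natr_true; move: (\sum_i _) (dkappa _ _) => r1 r2; ring.
Qed.

Let hess_t_xt i y : 2 * d2 ti (xi i) ti y = 0.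
Proof. by rewrite hess_t T_s xi_ti natr_false !mulr0 mul0r subr0. Qed.

(** The same comparison as for [T_s], now with the second time derivative, which is a combination of
    the constants [d1 ti (xi j)] with coefficients from [dkappa]. *)
Let T_x i x : d1 ti (xi i) x = 0.
Proof.
have T_x0 j y z : d1 ti (xi j) y = d1 ti (xi j) z.
  by apply: constant => c w; rewrite hess_t T_s xi_ti natr_false !mulr0 !mul0r subr0.
apply: (f_kernel (i := i)) => t.
have /(congr1 (fun r => 2 * r)) := shift_hess t (hess_t_xt i).
rewrite [LHS]hess_t_tt [RHS]hess_t_tt.
rewrite [in RHS]big1 => [|j _]; last by rewrite dkappa_pt mul0r.
under eq_bigr do rewrite dkappa_xdelta mulrAC mulrC.
rewrite (sum_delta (fun j => 2 * (f t + a j) * d1 ti (xi j) _)) (T_x0 i _ x) oppr0 -mulrA.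
by move=> /eqP; rewrite oppr_eq0 mulf_eq0 (negPf two_neq0) /= => /eqP.
Qed.

Let T_affine : exists al q, (forall x, d1 ti ti x = al) /\ (forall x, phi x 0 ti = al * x 0 ti + q).
Proof.
have T_t y z : d1 ti ti y = d1 ti ti z.
  apply: constant => c w; rewrite hess_t T_s big1 ?(mulr0, addr0, subr0) // => i _.
  by rewrite T_x mulr0.
exists (d1 ti ti 0), (phi 0 0 ti); split=> // x.
pose F y := phi y 0 ti - d1 ti ti 0 * y 0 ti.
suff -> : phi x 0 ti = F x + d1 ti ti 0 * x 0 ti.
  rewrite (_ : F x = F 0); first by rewrite /F mxE mulr0 subr0 addrC.
  apply: (@coord_invariant _ _ predT) => // c _; apply: derive0_line => y.
  apply: (is_derive_eq (is_deriveBr (dcomp ti c y) (is_deriveZr _ (is_derive_coord ti c y)))).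
  case: (coordP c) => [||i]; rewrite !coordE ?T_s ?T_x ?(T_t y 0) ?natr_bool; ring.
by rewrite /F subrK.
Qed.

Let al : R := d1 ti ti 0.
Let q : R := phi 0 0 ti.

Let T_t x : d1 ti ti x = al.
Proof. by have [al' [q' [h _]]] := T_affine; rewrite /al !h. Qed.

Let T_eq x : phi x 0 ti = al * x 0 ti + q.
Proof.
have [al' [q' [h h']]] := T_affine; rewrite h' /al /q h h' mxE mulr0 add0r.
by [].
Qed.

(** The image of the null vector $\partial_s$ is null and has no $t$ component by [T_s], so its
    squared length is the sum of the squares of these entries. *)
Let X_s k x : d1 (xi k) si x = 0.
Proof.
have := isomE x si si; rewrite -metric_form_unit /metric_form /unit_vec !coordE !natr_bool T_s.
rewrite [X in _ = _ + X]big1 => [|i _]; last by rewrite mul0r.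
rewrite !(mulr0, mul0r, addr0, add0r) => /eqP; rewrite psumr_eq0 => [|i _]; last first.
  by rewrite -expr2 sqr_ge0.
move=> /allP/(_ k); rewrite mem_index_enum => /(_ isT) /=.
by rewrite mulf_eq0 orbb => /eqP.
Qed.

Let al_S x : al * d1 si si x = 1.
Proof.
have := isomE x ti si; rewrite -metric_form_unit /metric_form /unit_vec !coordE !natr_bool.
rewrite T_s T_t [X in _ = _ + X]big1 => [|i _]; last by rewrite ?coordE ?natr_bool mul0r.
rewrite [X in _ + X = _]big1 => [|i _]; last by rewrite X_s mulr0.
by move=> h; apply: (mulfI (x := 2^-1)); rewrite ?invr_eq0 //; move: h; lra.
Qed.

Let C : 'M[R]_m := \matrix_(k, i) d1 (xi k) (xi i) 0.

Let X_x k i x : d1 (xi k) (xi i) x = C k i.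
Proof.
rewrite mxE; apply: constant => c y.
by rewrite hess_x X_s T_x !coordE !natr_bool; ring.
Qed.

Let CC : C^T *m C = 1%:M.
Proof.
apply/matrixP => i j; rewrite !mxE.
have := isomE 0 (xi i) (xi j).
rewrite -metric_form_unit /metric_form /unit_vec !coordE !natr_bool !T_x.
under [X in _ = _ + X]eq_bigr do rewrite xi_xi.
rewrite sum_delta xi_xi !mulr0 !mul0r !addr0 !mulr0 !add0r eq_sym => <-.
by apply: eq_bigr => k _; rewrite !X_x mxE.
Qed.

Let u (k : 'I_m) (t : R) : R := phi (pt t) 0 (xi k).
Let u1 (k : 'I_m) (t : R) : R := d1 (xi k) ti (pt t).

Let X_eq k x : phi x 0 (xi k) = xpart C x k + u k (x 0 ti).
Proof.
pose F y := phi y 0 (xi k) - xpart C y k.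
have FE : F x = F (pt (x 0 ti)).
  apply: (@coord_invariant _ _ (predC1 ti)) => [c /= cti|c]; last first.
    by rewrite /= negbK => /eqP ->; rewrite time_axis_t.
  apply: derive0_line => y.
  apply: (is_derive_eq (is_deriveBr (dcomp (xi k) c y) (is_derive_xpart C k c y))).
  move: cti; case: (coordP c) => [||i] cti; rewrite ?eqxx // /xdir in cti *.
    by rewrite X_s big1 ?subr0 // => i _; rewrite si_xi mulr0.
  under eq_bigr do rewrite xi_xi mulrC eq_sym.
  by rewrite sum_delta X_x subrr.
rewrite -[LHS](subrK (xpart C x k)) -/(F x) FE /F /u addrC; congr (_ + _).
rewrite [X in _ - X]big1 ?subr0 // => i _.
by rewrite time_axis_x mulr0.
Qed.

Let du k (t : R) : is_derive t 1 (u k) (u1 k t).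
Proof.
have := dcomp (xi k) ti (pt t); rewrite {1}time_axis_line is_derive_lineE.
by apply: is_derive_ext => r; rewrite /u time_axis_line.
Qed.

Let X_tt k x : d2 (xi k) ti ti x =
  al ^+ 2 * (f (al * x 0 ti + q) + a k) * phi x 0 (xi k)
  - \sum_i (f (x 0 ti) + a i) * x 0 (xi i) * C k i.
Proof.
apply: (mulfI two_neq0); rewrite hess_x X_s T_t kappa_grad_x T_eq eqxx natr_true.
under eq_bigr do rewrite X_x kappa_grad_x -!mulrA.
by rewrite -mulr_sumr; under eq_bigr do rewrite mulrA; ring.
Qed.

Let du1 k (t : R) : is_derive t 1 (u1 k) (al ^+ 2 * (f (al * t + q) + a k) * u k t).
Proof.
have := dcomp2 (xi k) ti ti (pt t); rewrite X_tt time_axis_t big1 ?subr0 => [|i _]; last first.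
  by rewrite time_axis_x mulr0 mul0r.
rewrite {1}time_axis_line is_derive_lineE.
by apply: is_derive_ext => r; rewrite /u1 time_axis_line.
Qed.

(** The second time derivative of the component $x_k$ does not depend on $x_i$. Its values on the
    axis and at the unit translate in direction $x_i$ differ by the difference of the two sides. *)
Let C_intertwines k i t : al ^+ 2 * (f (al * t + q) + a k) * C k i = (f t + a i) * C k i.
Proof.
have : d2 (xi k) ti ti (pt t + 1 *: delta_mx 0 (xi i)) = d2 (xi k) ti ti (pt t).
  apply: partial_shift => y; apply: invariant => z.
  by rewrite hess_x X_s T_x !coordE !natr_bool; ring.
rewrite !X_tt [in X in _ = _ - X]big1 => [|j _]; last by rewrite time_axis_x mulr0 mul0r.
rewrite !X_eq !xdelta !coordE !natr_bool mulr1 addr0 time_axis_t.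
under [X in _ - X = _]eq_bigr do rewrite !xdelta !coordE !natr_bool mulr0 add0r -mulrA mulrCA.
rewrite (sum_delta (fun j => (f t + a j) * C k j)).
have -> : xpart C (pt t + 1 *: delta_mx 0 (xi i)) k = C k i.
  rewrite /xpart; under eq_bigr do rewrite xdelta !coordE !natr_bool mulr0 add0r mulrC.
  exact: sum_delta.
have -> : xpart C (pt t) k = 0.
  by rewrite /xpart big1 // => j _; rewrite time_axis_x mulr0.
rewrite subr0 add0r => e; apply/eqP; rewrite -subr_eq0; apply/eqP.
rewrite -[RHS](subrr (al ^+ 2 * (f (al * t + q) + a k) * u k t)) -{1}e; ring.
Qed.

Let col_C i : \sum_k C k i ^+ 2 = 1.
Proof.
have /matrixP/(_ i i) := CC; rewrite [LHS]mxE [RHS]mxE eqxx => e; rewrite -[RHS]e.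
by apply: eq_bigr => k _; rewrite [X in _ = X * _]mxE expr2.
Qed.

Let row_C k : \sum_i C k i ^+ 2 = 1.
Proof.
have /matrixP/(_ k k) := mulmx1C CC; rewrite [LHS]mxE [RHS]mxE eqxx => e; rewrite -[RHS]e.
by apply: eq_bigr => i _; rewrite [X in _ = _ * X]mxE expr2.
Qed.

(** The intertwining relation is multiplied by $C_{ki}$ and summed over both indices; rows and
    columns of [C] have length 1, and the traces vanish. *)
Let f_al t : al ^+ 2 * f (al * t + q) = f t.
Proof.
have [i0 _] := a_neq0.
have m0 : m%:R != 0 :> R by rewrite pnatr_eq0 -lt0n (leq_ltn_trans _ (ltn_ord i0)).
have e : \sum_k \sum_i al ^+ 2 * (f (al * t + q) + a k) * C k i ^+ 2
       = \sum_k \sum_i (f t + a i) * C k i ^+ 2.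
  by apply: eq_bigr => k _; apply: eq_bigr => i _; rewrite expr2 !mulrA C_intertwines.
move: e; under eq_bigr do rewrite -mulr_sumr row_C mulr1.
rewrite -mulr_sumr big_split /= sumr_const card_ord a_sum0 addr0 -mulr_natl exchange_big /=.
under [X in _ = X]eq_bigr do rewrite -mulr_sumr col_C mulr1.
rewrite big_split /= sumr_const card_ord a_sum0 addr0 -mulr_natl => e.
by apply: (mulfI m0); rewrite [RHS]mulr_natl -e; ring.
Qed.

Let C_a k i : al ^+ 2 * a k * C k i = a i * C k i.
Proof. by have := C_intertwines k i 0; rewrite mulrDr f_al !mulrDl => /addrI. Qed.

(** [C] conjugates $\alpha^2 A$ to $A$, so the Hilbert-Schmidt norms agree: $\alpha^4 \sum a_i^2 =
    \sum a_i^2$, where the sum is not zero. *)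
Lemma isometry_time_scale : al ^+ 2 = 1.
Proof.
have e : \sum_k \sum_i (al ^+ 2 * a k) ^+ 2 * C k i ^+ 2 = \sum_k \sum_i a i ^+ 2 * C k i ^+ 2.
  by apply: eq_bigr => k _; apply: eq_bigr => i _; rewrite -!exprMn C_a.
move: e; under eq_bigr do rewrite -mulr_sumr row_C mulr1 exprMn.
rewrite -mulr_sumr exchange_big /=.
under [X in _ = X]eq_bigr do rewrite -mulr_sumr col_C mulr1.
have s0 : \sum_i a i ^+ 2 != 0.
  have [i ai] := a_neq0; rewrite psumr_eq0 => [|j _]; last exact: sqr_ge0.
  by apply/allPn; exists i; rewrite ?mem_index_enum //= sqrf_eq0.
rewrite -[RHS]mul1r => /(mulIf s0)/eqP; rewrite sqrf_eq1 => /orP[/eqP //|/eqP e].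
by have := sqr_ge0 al; rewrite e oppr_ge0 ler10.
Qed.

Lemma isometry_time t : f (al * t + q) = f t.
Proof. by rewrite -[RHS]f_al isometry_time_scale mul1r. Qed.

Lemma isometry_timeE x : phi x 0 ti = al * x 0 ti + q.
Proof. exact: T_eq. Qed.

Lemma isometry_wave_map : al = 1 -> q = 0 ->
  exists C u u1 c, [/\ C^T *m C = 1%:M, block_diagonal a C,
    forall k (t : R), is_derive t 1 (u k) (u1 k t),
    forall k (t : R), is_derive t 1 (u1 k) ((f t + a k) * u k t) &
    phi = wave_map C u u1 c].
Proof.
move=> al1 q0.
have bC : block_diagonal a C.
  move=> i j aij; have := C_a i j; rewrite al1 expr1n mul1r => /eqP.
  by rewrite -subr_eq0 -mulrBl mulf_eq0 subr_eq0 (negPf aij) /= => /eqP.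
have ode k (t : R) : is_derive t 1 (u1 k) ((f t + a k) * u k t).
  by have := du1 k t; rewrite al1 q0 expr1n !mul1r addr0.
have S_s x : d1 si si x = 1 by rewrite -[LHS]mul1r -al1 al_S.
have X_t k x : d1 (xi k) ti x = u1 k (x 0 ti).
  apply: (@coord_invariant _ _ (predC1 ti)) => [c /= cti|c]; last first.
    by rewrite /= negbK => /eqP ->; rewrite time_axis_t.
  apply: invariant => y; rewrite hess_x X_s.
  by move: cti; case: (coordP c) => [||i]; rewrite ?T_s ?T_x ?coordE ?natr_bool // => _; ring.
have S_x i x : d1 si (xi i) x = - 2 * \sum_k u1 k (x 0 ti) * C k i.
  have := isomE x ti (xi i); rewrite -metric_form_unit /metric_form /unit_vec !coordE !natr_bool.
  rewrite T_x T_t al1 [X in _ = _ + X]big1 => [|j _]; last by rewrite ?coordE ?natr_bool mul0r.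
  by under eq_bigr do rewrite X_t X_x; lra.
have S_t x : d1 si ti x = kappa x - kappa (phi x) - \sum_k u1 k (x 0 ti) * u1 k (x 0 ti).
  have := isomE x ti ti; rewrite -metric_form_unit /metric_form /unit_vec !coordE !natr_bool.
  rewrite T_t al1 [X in _ = _ + X]big1 => [|j _]; last by rewrite ?coordE ?natr_bool mul0r.
  by under eq_bigr do rewrite X_t; lra.
(* The first derivatives of the $s$ component are forced by pairing $\partial_s$ and $\partial_t$
   with the coordinate fields. They agree with those of the wave map, so only an additive constant
   is free. *)
pose F x := phi x 0 si - wave_map C u u1 0 x 0 si.
have F0 x : F x = F 0.
  apply: (@coord_invariant _ _ predT) => // c _; apply: derive0_line => y.
  apply: (is_derive_eq (is_deriveBr (dcomp si c y) (is_derive_wave_map_s C 0 du ode c y))).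
  case: (coordP c) => [||i]; rewrite ?S_s ?S_t ?S_x ?coordE ?natr_bool /xdir.
  - rewrite (_ : kappa (phi y) = \sum_k (f (y 0 ti) + a k) * (xpart C y k + u k (y 0 ti)) ^+ 2).
      rewrite kappa_affine // [X in 0 - 2 * X]big1 => [|k _]; first by ring.
      by rewrite big1 ?mulr0 // => i _; rewrite !coordE natr_false mulr0.
    by rewrite wave_kappaE T_eq al1 q0 mul1r addr0; apply: eq_bigr => k _; rewrite X_eq.
  - rewrite [X in 1 - 2 * X]big1 => [|k _]; first by ring.
    by rewrite big1 ?mulr0 // => i _; rewrite !coordE natr_false mulr0.
  - under [X in _ - (0 - 2 * X - _)]eq_bigr => k _.
      under eq_bigr do rewrite !coordE mulrC eq_sym.
      by rewrite sum_delta; over.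
    ring.
exists C, u, u1, (F 0); split=> //.
apply/funext => x; apply/rowP => p; case: (coordP p) => [||k].
- by rewrite wave_map_t T_eq al1 q0 mul1r addr0.
- by rewrite -(F0 x) /F !wave_map_s addr0; ring.
- by rewrite wave_map_x X_eq.
Qed.

End IsometryClassification.

(** * The isometry group *)

Section Heisenberg.
Variables (R : realType) (m : nat).
Implicit Types (p v : 'cV[R]_m) (c : R) (M : 'M[R]_(1 + (m + 1))).

Definition heis_a M : 'cV[R]_m := (lsubmx (ursubmx M))^T.
Definition heis_b M : 'cV[R]_m := ursubmx (drsubmx M).
Definition heis_c M : R := rsubmx (ursubmx M) 0 0.

Lemma heis_mx_a p v c : heis_a (heis_mx p v c) = p.
Proof. by rewrite /heis_a /heis_mx block_mxKur row_mxKl trmxK. Qed.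

Lemma heis_mx_b p v c : heis_b (heis_mx p v c) = v.
Proof. by rewrite /heis_b /heis_mx block_mxKdr block_mxKur. Qed.

Lemma heis_mx_c p v c : heis_c (heis_mx p v c) = c.
Proof. by rewrite /heis_c /heis_mx block_mxKur row_mxKr mxE eqxx. Qed.

Lemma heis_mxM p v c p' v' c' : heis_mx p v c *m heis_mx p' v' c' =
  heis_mx (p + p') (v + v') (c + c' + (p^T *m v') 0 0).
Proof.
rewrite /heis_mx mulmx_block !mulmx0 !mul0mx !mul1mx !addr0 !add0r.
rewrite mul_row_block mulmx_block !mulmx0 !mul0mx !mul1mx !mulmx1 !addr0 !add0r.
rewrite add_row_mx linearD /=; congr (block_mx _ (row_mx _ _) _ (block_mx _ _ _ _)).
- by rewrite addrC.
- by rewrite {1}[p^T *m v']mx11_scalar -!raddfD /=; congr (_%:M); ring.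
- by rewrite addrC.
Qed.

Lemma heis_mx1 : heis_mx 0 0 0 = 1%:M :> 'M[R]_(1 + (m + 1)).
Proof.
by rewrite /heis_mx trmx0 !raddf0 row_mx0 !scalar_mx_block.
Qed.

Lemma heis_actE (C : 'M[R]_m) p v c :
  heis_act C (heis_mx p v c) = heis_mx (C *m p) (C *m v) c.
Proof.
by rewrite /heis_act -/(heis_a _) -/(heis_b _) -/(heis_c _) heis_mx_a heis_mx_b heis_mx_c.
Qed.

Lemma continuous_heis_mx (T : topologicalType) (p v : T -> 'cV[R]_m) (c : T -> R) :
  continuous p -> continuous v -> continuous c ->
  continuous (fun x => heis_mx (p x) (v x) (c x)).
Proof.
move=> cp cv cc.
have ck (r : R) : continuous (fun _ : T => r) by move=> x; exact: cvg_cst.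
have ext (F F' : T -> R) : continuous F -> F =1 F' -> continuous F'.
  by move=> cF /funext <-.
apply: continuous_mx => i j.
case: (split_ordP i) => i' ->; case: (split_ordP j) => j' ->.
- by apply: (ext _ _ (ck _)) => x; rewrite /heis_mx block_mxEul.
- case: (split_ordP j') => j'' ->.
    apply: (ext _ _ (continuous_entry (i := j'') (j := 0) cp)) => x.
    by rewrite /heis_mx block_mxEur row_mxEl mxE (ord1 i').
  apply: (ext _ _ cc) => x.
  by rewrite /heis_mx block_mxEur row_mxEr mxE (ord1 i') (ord1 j'') eqxx.
- by apply: (ext _ _ (ck 0)) => x; rewrite /heis_mx block_mxEdl mxE.
- case: (split_ordP i') => i'' ->; case: (split_ordP j') => j'' ->.
  + by apply: (ext _ _ (ck _)) => x; rewrite /heis_mx block_mxEdr block_mxEul.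
  + apply: (ext _ _ (continuous_entry (i := i'') (j := j'') cv)) => x.
    by rewrite /heis_mx block_mxEdr block_mxEur.
  + by apply: (ext _ _ (ck 0)) => x; rewrite /heis_mx block_mxEdr block_mxEdl mxE.
  + by apply: (ext _ _ (ck _)) => x; rewrite /heis_mx block_mxEdr block_mxEdr.
Qed.

Lemma He_connected : connected (@He R m).
Proof.
have H1 : He (1%:M : 'M[R]_(1 + (m + 1))) by exists 0, 0, 0; rewrite heis_mx1.
suff -> : @He R m = connected_component (@He R m) 1%:M by exact: component_connected.
apply/seteqP; split; last exact: connected_component_sub.
move=> _ [p [v [c ->]]].
exists [set heis_mx (t *: p) (t *: v) (t * c) | t in [set: R]]; last first.
  by exists 1 => //; rewrite !scale1r mul1r.
split.
- by exists 0 => //; rewrite !scale0r mul0r heis_mx1.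
- by move=> _ [t _ <-]; exists (t *: p), (t *: v), (t * c).
- apply: connected_continuous_connected.
    by apply/connected_intervalP => ? ? _ _ ? _.
  apply: continuous_subspaceT; apply: continuous_heis_mx => t.
  + by apply: cvgZr_tmp; exact: cvg_id.
  + by apply: cvgZr_tmp; exact: cvg_id.
  + by apply: cvgMr_tmp; exact: cvg_id.
Qed.

End Heisenberg.

(** * Connectedness arguments and the compact-open topology *)

Section ConnectedSets.
Variables (T : topologicalType) (R : realType).

(** The image is an interval contained in the set of signs; with -1 it would contain 0. *)
Lemma connected_sign (G : set T) (g : T -> R) x0 : connected G -> continuous g ->
  G x0 -> g x0 = 1 -> (forall x, G x -> g x ^+ 2 = 1) -> forall x, G x -> g x = 1.
Proof.
move=> cG cg Gx0 g1 gsq x Gx.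
have /eqP := gsq x Gx; rewrite sqrf_eq1 => /orP[/eqP //|/eqP gx].
have /connected_intervalP := connected_continuous_connected cG (continuous_subspaceT cg).
have i1 : [set g x | x in G] (-1) by exists x.
have i2 : [set g x | x in G] 1 by exists x0.
move=> /(_ _ _ i1 i2 0); rewrite lerN10 ler01 => /(_ isT)[y Gy gy].
by have /eqP := gsq y Gy; rewrite gy expr0n /= eq_sym oner_eq0.
Qed.

(* The values of [g] fill an interval containing [0]; a nonzero value would make
   all small numbers, hence all numbers, periods of [f]. *)
Lemma connected_periods (G : set T) (g : T -> R) (f : R -> R) x0 : connected G ->
  continuous g -> G x0 -> g x0 = 0 -> (exists t1 t2, f t1 != f t2) ->
  (forall x, G x -> forall t, f (t + g x) = f t) -> forall x, G x -> g x = 0.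
Proof.
move=> cG cg Gx0 g0 [t1 [t2 ft]] per x Gx; apply/eqP; apply: contraNT ft => gx.
have /connected_intervalP itv := connected_continuous_connected cG (continuous_subspaceT cg).
have perN r : (forall t, f (t + r) = f t) -> forall t, f (t - r) = f t.
  by move=> pr t; rewrite -[LHS]pr subrK.
have small r : `|r| <= `|g x| -> forall t, f (t + r) = f t.
  have pos s : (0 <= s <= g x) || (g x <= s <= 0) -> forall t, f (t + s) = f t.
    move=> /orP[] h.
      have [] := itv 0 (g x) _ _ s h; [by exists x0|by exists x|].
      by move=> y Gy <-; exact: per.
    have [] := itv (g x) 0 _ _ s h; [by exists x|by exists x0|].
    by move=> y Gy <-; exact: per.
  case: (ger0P r) => r0; case: (ger0P (g x)) => gx0 rg.
  - by apply: pos; rewrite r0 rg.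
  - move=> t; rewrite -[r]opprK; apply: perN; apply: pos; apply/orP; right.
    by rewrite oppr_le0 r0 andbT lerNr.
  - move=> t; rewrite -[r]opprK; apply: perN; apply: pos; apply/orP; left.
    by rewrite oppr_ge0 ltW.
  - by apply: pos; apply/orP; right; rewrite (ltW r0) andbT -lerN2.
(* With so large an [n] the number [d / n] is one of the small periods, and [n] such steps lead from
   [t1] to [t2]. *)
pose d := t2 - t1; pose n := Num.bound `|d / g x|.
have dn : `|d / g x| < n%:R by exact: archi_boundP.
have n0 : 0 < n%:R :> R by rewrite (le_lt_trans _ dn).
have pn k t : f (t + k%:R * (d / n%:R)) = f t.
  elim: k t => [|k IH] t; first by rewrite mul0r addr0.
  rewrite -natr1 mulrDl mul1r addrA small ?IH //.
  rewrite normrM normfV [`|n%:R|]gtr0_norm // ler_pdivrMr //.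
  by rewrite mulrC -ler_pdivrMr ?normr_gt0 // -normfV -normrM ltW.
by rewrite -(pn n t1) mulrCA divff ?mulr1 ?lt0r_neq0 // addrC subrK.
Qed.

(** A singleton is compact, so conditions on the value at [x] are subbasic. *)
Lemma compact_open_eval (X Y : topologicalType) (x : X) :
  continuous (fun phi : {compact-open, X -> Y} => phi x).
Proof.
move=> phi A; rewrite nbhsE => -[B [oO Ox] OA].
have op := compact_open_open (@compact_set1 _ x) oO.
apply: (filterS (P := [set g : {compact-open, X -> Y} | g @` [set x] `<=` B])).
  by move=> g gO; apply: OA; apply: gO; exists x.
by apply: open_nbhs_nbhs; split=> // _ [_ -> <-].
Qed.

Lemma compact_open_curry (U X Y : topologicalType) (F : U -> X -> Y) :
  continuous (fun z : U * X => F z.1 z.2) ->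
  continuous (F : U -> {compact-open, X -> Y}).
Proof. by move=> cF; have := continuous_curry_fun cF. Qed.

Lemma connected_setX (U : topologicalType) (A : set T) (B : set U) (a0 : T) (b0 : U) :
  connected A -> connected B -> A a0 -> B b0 -> connected (A `*` B).
Proof.
move=> cA cB Aa Bb.
suff -> : A `*` B = connected_component (A `*` B) (a0, b0) by exact: component_connected.
apply/seteqP; split; last exact: connected_component_sub.
move=> [a b] [/= Aa' Bb'].
apply: (@connected_component_trans _ _ (a, b0)).
  apply: (@connected_component_max _ _ [set (z, b0) | z in A]); last by exists a.
  - by exists a0.
  - by move=> _ [z Az <-].
  - apply: connected_continuous_connected => //; apply: continuous_subspaceT => z.
    by apply: cvg_pair; [exact: cvg_id|exact: cvg_cst].
apply: (@connected_component_max _ _ [set (a, z) | z in B]); last by exists b.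
- by exists b0.
- by move=> _ [z Bz <-].
- apply: connected_continuous_connected => //; apply: continuous_subspaceT => z.
  by apply: cvg_pair; [exact: cvg_cst|exact: cvg_id].
Qed.

End ConnectedSets.

(** * The identity component and its parametrisation by the semidirect product *)

Section IsometryGroup.
Variables (R : realType) (m : nat) (f : R -> R) (a : 'I_m -> R).
Hypothesis f_smooth : smooth_line f.
Hypothesis f_nonconst : exists t1 t2, f t1 != f t2.
Hypothesis a_sum0 : \sum_i a i = 0.
Hypothesis a_neq0 : exists i, a i != 0.
Hypothesis f_bounded_shift : forall k, exists M : R, forall t, `|f t + a k| <= M.
Notation N := (2 + m)%N.
Notation ti := (ti m).
Notation si := (si m).
Notation G := (Isom0 (wave_mx f a)).
Notation H := (sdprod_He (block_SO a)).
Notation mxpair := ('M[R]_m * 'M[R]_(1 + (m + 1)))%type.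
Implicit Types (p v : 'cV[R]_m) (C : 'M[R]_m) (x y : 'rV[R]_N).

(** Fundamental solutions, paired with their derivatives and indexed by the eigenvalue; indices with
    equal eigenvalue share them, and solutions become linear in the initial data. *)
Variables cs sn : R -> (R -> R) * (R -> R).
Hypothesis hcs : forall lam, ode_solution (fun t => f t + lam) 1 0 (cs lam).1 (cs lam).2.
Hypothesis hsn : forall lam, ode_solution (fun t => f t + lam) 0 1 (sn lam).1 (sn lam).2.

Definition sol p v (k : 'I_m) (t : R) : R := p k 0 * (cs (a k)).1 t + v k 0 * (sn (a k)).1 t.
Definition sol1 p v (k : 'I_m) (t : R) : R := p k 0 * (cs (a k)).2 t + v k 0 * (sn (a k)).2 t.

Lemma sol_ode p v k : ode_solution (fun t => f t + a k) (p k 0) (v k 0) (sol p v k) (sol1 p v k).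
Proof.
have [c0 c10 dc dc1] := hcs (a k); have [s0 s10 ds ds1] := hsn (a k).
rewrite /sol /sol1; split.
- by rewrite c0 s0 mulr1 mulr0 addr0.
- by rewrite c10 s10 mulr1 mulr0 add0r.
- by move=> t; exact: (is_deriveDr (is_deriveZr (p k 0) (dc t)) (is_deriveZr (v k 0) (ds t))).
- move=> t; apply: (is_derive_eq (is_deriveDr (is_deriveZr (p k 0) (dc1 t))
    (is_deriveZr (v k 0) (ds1 t)))).
  by ring.
Qed.

Lemma sol_derive p v k (t : R) : is_derive t 1 (sol p v k) (sol1 p v k t).
Proof. by have [_ _ d _] := sol_ode p v k. Qed.

Lemma sol_derive1 p v k (t : R) : is_derive t 1 (sol1 p v k) ((f t + a k) * sol p v k t).
Proof. by have [_ _ _ d] := sol_ode p v k. Qed.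

Definition dot_col p v : R := \sum_k p k 0 * v k 0.

(* The matrices of [He] multiply with the cocycle [p^T v'], the isometries with
   the antisymmetric one given by the Wronskian, which accounts for
   [2 c - <p, v>]. *)
Definition wave_isometry (z : mxpair) : 'rV[R]_N -> 'rV[R]_N :=
  let p := heis_a z.2 in let v := heis_b z.2 in
  wave_map z.1 (sol p v) (sol1 p v) (2 * heis_c z.2 - dot_col p v).

Definition base_point (k : 'I_m) : 'rV[R]_N := delta_mx 0 (xi k).

(** An inverse using only the values at 0 and at the unit vectors of $V$. At time 0 the $x$ part is
    $Cx + p$, and the $s$ component is $2c - 2 \langle p, v \rangle$ at 0, with increment $-2 (C^T
    v)_i$ at the $i$-th unit vector. *)
Definition wave_parameters (phi : 'rV[R]_N -> 'rV[R]_N) : mxpair :=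
  let C : 'M[R]_m := \matrix_(k, i) (phi (base_point i) 0 (xi k) - phi 0 0 (xi k)) in
  let p : 'cV[R]_m := \col_k phi 0 0 (xi k) in
  let v : 'cV[R]_m := \col_k \sum_i C k i * (- 2^-1 * (phi (base_point i) 0 si - phi 0 0 si)) in
  (C, heis_mx p v (2^-1 * phi 0 0 si + dot_col p v)).

(** [C] mixes only indices with equal eigenvalue, whose fundamental solutions coincide. *)
Lemma sol_comm C p v k t : block_diagonal a C ->
  sol (C *m p) (C *m v) k t = \sum_i C k i * sol p v i t.
Proof.
move=> bC; rewrite /sol !mxE !mulr_suml -big_split; apply: eq_bigr => i _ /=.
by have [->|/bC ->] := eqVneq (a k) (a i); ring.
Qed.

Lemma sol1_comm C p v k t : block_diagonal a C ->
  sol1 (C *m p) (C *m v) k t = \sum_i C k i * sol1 p v i t.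
Proof.
move=> bC; rewrite /sol1 !mxE !mulr_suml -big_split; apply: eq_bigr => i _ /=.
by have [->|/bC ->] := eqVneq (a k) (a i); ring.
Qed.

Lemma xpart_wave_map C C' u u1 c x k : xpart C (wave_map C' u u1 c x) k =
  xpart (C *m C') x k + \sum_i C k i * u i (x 0 ti).
Proof.
rewrite /xpart; under eq_bigr do rewrite wave_map_x mulrDr.
rewrite big_split /=; congr (_ + _); rewrite /xpart.
under eq_bigr do rewrite mulr_sumr; rewrite exchange_big; apply: eq_bigr => j _.
by rewrite mxE mulr_suml; apply: eq_bigr => i _; rewrite mulrA.
Qed.

(* The cross terms form the Wronskian of two solutions of the same equation,
   hence they do not depend on time. *)
Lemma wave_isometry_mul C C' p v c p' v' c' : C^T *m C = 1%:M -> block_diagonal a C ->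
  wave_isometry (sdprod_He_mul (C, heis_mx p v c) (C', heis_mx p' v' c')) =
  wave_isometry (C, heis_mx p v c) \o wave_isometry (C', heis_mx p' v' c').
Proof.
move=> CC bC; rewrite /sdprod_He_mul /= heis_actE heis_mxM.
apply/funext => x; rewrite /comp.
apply/rowP => q; rewrite /wave_isometry /= !heis_mx_a !heis_mx_b !heis_mx_c.
have solD r k t p1 v1 p2 v2 : r = sol (p1 + p2) (v1 + v2) k t ->
    r = sol p1 v1 k t + sol p2 v2 k t by move=> ->; rewrite /sol !mxE; ring.
have sol1D r k t p1 v1 p2 v2 : r = sol1 (p1 + p2) (v1 + v2) k t ->
    r = sol1 p1 v1 k t + sol1 p2 v2 k t by move=> ->; rewrite /sol1 !mxE; ring.
case: (coordP q) => [||k].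
- by rewrite !wave_map_t.
- rewrite !wave_map_s !wave_map_t; set t := x 0 ti.
  under eq_bigr do rewrite (sol1D _ _ _ _ _ _ _ (erefl _)) (sol1_comm _ _ _ _ bC) mulrDl.
  under [X in _ - _ - X + _ = _]eq_bigr do rewrite (sol1D _ _ _ _ _ _ _ (erefl _))
    (solD _ _ _ _ _ _ _ (erefl _)) (sol1_comm _ _ _ _ bC) (sol_comm _ _ _ _ bC).
  under [X in _ = _ - 2 * X - _ + _]eq_bigr do rewrite xpart_wave_map mulrDr.
  rewrite !big_split /=.
  have e1 : \sum_k (\sum_i C k i * sol1 p' v' i t) * xpart (C *m C') x k
     = \sum_k sol1 p' v' k t * xpart C' x k.
    rewrite -(sum_orthogonal (fun i => sol1 p' v' i t) (xpart C' x) CC).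
    apply: eq_bigr => k _; congr (_ * _); rewrite /xpart.
    under [RHS]eq_bigr do rewrite mulr_sumr; rewrite exchange_big; apply: eq_bigr => j _.
    by rewrite mxE mulr_suml; apply: eq_bigr => i _; rewrite mulrA.
  (* The two mixed products are rewritten as twice one of them plus a Wronskian, which is evaluated
     at time 0. *)
  have e2 : \sum_k (sol p v k t + \sum_i C k i * sol p' v' i t)
       * (sol1 p v k t + \sum_i C k i * sol1 p' v' i t)
     = \sum_k sol p v k t * sol1 p v k t + \sum_k sol p' v' k t * sol1 p' v' k t
       + 2 * (\sum_k sol1 p v k t * (\sum_i C k i * sol p' v' i t))
       + \sum_k (p k 0 * (C *m v') k 0 - v k 0 * (C *m p') k 0).
    rewrite -(sum_orthogonal (fun i => sol p' v' i t) (fun i => sol1 p' v' i t) CC).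
    rewrite mulr_sumr -!big_split; apply: eq_bigr => k _ /=.
    rewrite -(wronskian_cst (sol_ode p v k) (sol_ode (C *m p') (C *m v') k) t).
    by rewrite (sol_comm _ _ _ _ bC) (sol1_comm _ _ _ _ bC); ring.
  (* Subtracted from the contribution $2 p^T C v'$ of the Heisenberg product, this symmetric cross
     term leaves $p^T C v' - v^T C p'$, which cancels the Wronskian of [e2]. *)
  have e3 : dot_col (p + C *m p') (v + C *m v') = dot_col p v + dot_col p' v'
      + \sum_k (p k 0 * (C *m v') k 0 + v k 0 * (C *m p') k 0).
    rewrite /dot_col -(sum_orthogonal (fun i => p' i 0) (fun i => v' i 0) CC) -!big_split.
    by apply: eq_bigr => k _ /=; rewrite !mxE; ring.
  have e4 : (p^T *m (C *m v')) 0 0 = \sum_k p k 0 * (C *m v') k 0.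
    by rewrite mxE; apply: eq_bigr => k _; rewrite mxE.
  rewrite e1 e2 e3 e4 !big_split /= sumrN.
  move: (\sum_k p k 0 * (C *m v') k 0) (\sum_k v k 0 * (C *m p') k 0) => r1 r2.
  move: (\sum_k sol1 p v k t * xpart (C *m C') x k) (\sum_k sol1 p' v' k t * xpart C' x k)
    (\sum_k sol p v k t * sol1 p v k t) (\sum_k sol p' v' k t * sol1 p' v' k t)
    (\sum_k sol1 p v k t * (\sum_i C k i * sol p' v' i t)) (dot_col p v) (dot_col p' v').
  by move=> r3 r4 r5 r6 r7 r8 r9; ring.
- rewrite !wave_map_x xpart_wave_map wave_map_t (solD _ _ _ _ _ _ _ (erefl _)).
  by rewrite (sol_comm _ _ _ _ bC); ring.
Qed.

Lemma sol0 p v k : sol p v k 0 = p k 0.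
Proof. by have [h _ _ _] := sol_ode p v k. Qed.

Lemma sol10 p v k : sol1 p v k 0 = v k 0.
Proof. by have [_ h _ _] := sol_ode p v k. Qed.

Lemma xpart0 C k : xpart C 0 k = 0.
Proof. by rewrite /xpart big1 // => i _; rewrite mxE mulr0. Qed.

Lemma base_point_t k : base_point k 0 ti = 0.
Proof. by rewrite mxE eqxx coordE. Qed.

Lemma base_point_s k : base_point k 0 si = 0.
Proof. by rewrite mxE eqxx coordE. Qed.

Lemma xpart_base_point C i k : xpart C (base_point i) k = C k i.
Proof.
rewrite /xpart -[RHS](sum_delta (fun j => C k j)).
by apply: eq_bigr => j _; rewrite mxE eqxx coordE mulrC.
Qed.

Lemma xpart1 x k : xpart 1%:M x k = x 0 (xi k).
Proof.
rewrite -[RHS](sum_delta (fun j => x 0 (xi j))).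
by apply: eq_bigr => j _; rewrite mxE eq_sym.
Qed.

Lemma wave_isometry1 : wave_isometry (1%:M, heis_mx 0 0 0) = idfun.
Proof.
have s0 k t : sol 0 0 k t = 0 by rewrite /sol !mxE !mul0r addr0.
have s10 k t : sol1 0 0 k t = 0 by rewrite /sol1 !mxE !mul0r addr0.
apply/funext => x; apply/rowP => q.
rewrite /wave_isometry /= heis_mx_a heis_mx_b heis_mx_c /dot_col.
case: (coordP q) => [||k].
- by rewrite wave_map_t.
- rewrite wave_map_s !big1 => [|k _|k _|k _]; rewrite ?mxE ?s10 ?mul0r ?mulr0 //.
  by rewrite !subr0 addr0.
- by rewrite wave_map_x xpart1 s0 addr0.
Qed.

Lemma block_SO_orthogonal C : block_SO a C -> C^T *m C = 1%:M.
Proof. by case=> [[]]. Qed.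

Lemma wave_isometry_isom z : H z -> Isom (wave_mx f a) (wave_isometry z).
Proof.
case: z => C M [/= SC [p [v [c ->]]]].
have CC := block_SO_orthogonal SC; have CC' : C *m C^T = 1%:M by exact: mulmx1C.
have bC : block_diagonal a C by case: SC.
have sm C' p' v' c' : smooth_map (wave_isometry (C', heis_mx p' v' c')).
  apply: (wave_map_smooth f_smooth).
    by move=> k t; exact: sol_derive.
  by move=> k t; exact: sol_derive1.
split; last first.
  by move=> x; apply: (wave_map_pullback _ (@sol_derive _ _) (@sol_derive1 _ _) CC bC).
(* The inverse in the semidirect product: $C^T$ acting on the Heisenberg inverse $(-p, -v, -c + p^T
   v)$. *)
exists (wave_isometry (C^T, heis_mx (- (C^T *m p)) (- (C^T *m v)) (- c + (p^T *m v) 0 0))).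
split=> // x.
  rewrite -[LHS]/((wave_isometry _ \o wave_isometry _) x) -wave_isometry_mul ?trmxK //; last exact: block_diagonal_tr.
  rewrite /sdprod_He_mul /= CC heis_actE heis_mxM !addNr linearN /= mulNmx.
  rewrite trmx_mul trmxK mulmxA -[p^T *m C *m C^T]mulmxA CC' mulmx1 [(- (_ *m _)) 0 0]mxE.
  by rewrite (_ : _ + _ = 0) ?wave_isometry1 //; ring.
rewrite -[LHS]/((wave_isometry _ \o wave_isometry _) x) -wave_isometry_mul //.
rewrite /sdprod_He_mul /= CC' heis_actE heis_mxM !mulmxN !mulmxA -(mulmxA p^T C) CC'
  mulmx1 !mul1mx !addrN.
by rewrite [(- (_ *m _)) 0 0]mxE (_ : _ + _ = 0) ?wave_isometry1 //; ring.
Qed.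

Lemma wave_isometryK z : H z -> wave_parameters (wave_isometry z) = z.
Proof.
case: z => C M [/= SC [p [v [c ->]]]].
have CC' : C *m C^T = 1%:M by exact/mulmx1C/block_SO_orthogonal.
rewrite /wave_parameters; set phi := wave_isometry _.
have phi0x k : phi 0 0 (xi k) = p k 0.
  by rewrite wave_map_x xpart0 add0r mxE /= heis_mx_a heis_mx_b sol0.
have phi0s : phi 0 0 si = 2 * c - 2 * dot_col p v.
  rewrite wave_map_s /= heis_mx_a heis_mx_b heis_mx_c big1 => [|k _]; last by rewrite xpart0 mulr0.
  under eq_bigr do rewrite !mxE sol0 sol10.
  by rewrite mxE -/(dot_col p v); ring.
have phibx i k : phi (base_point i) 0 (xi k) = C k i + p k 0.
  by rewrite wave_map_x xpart_base_point base_point_t /= heis_mx_a heis_mx_b sol0.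
have phibs i : phi (base_point i) 0 si = phi 0 0 si - 2 * (\sum_k v k 0 * C k i).
  rewrite phi0s wave_map_s /= heis_mx_a heis_mx_b heis_mx_c base_point_t base_point_s.
  under eq_bigr do rewrite xpart_base_point sol10.
  under [X in _ - _ - X + _ = _]eq_bigr do rewrite sol0 sol10.
  by rewrite -/(dot_col p v); ring.
have eC : (\matrix_(k, i) (phi (base_point i) 0 (xi k) - phi 0 0 (xi k))) = C.
  by apply/matrixP => k i; rewrite mxE phibx phi0x addrK.
have ep : \col_k phi 0 0 (xi k) = p by apply/colP => k; rewrite mxE phi0x.
rewrite eC ep; set v' := \col_k _.
have -> : v' = v.
  apply/colP => k; rewrite mxE -[RHS](sum_delta (fun l => v l 0)).
  transitivity (\sum_i \sum_l C k i * (v l 0 * C l i)).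
    apply: eq_bigr => i _; rewrite phibs -mulr_sumr; congr (_ * _).
    by move: (\sum_k0 _) (phi 0 0 si) => *; field.
  rewrite exchange_big; apply: eq_bigr => l _.
  have := congr1 (fun Y : 'M[R]_m => Y l k) CC'; rewrite !mxE => <-.
  by rewrite mulr_suml; apply: eq_bigr => i _; rewrite mxE; ring.
by congr (_, heis_mx _ _ _); rewrite phi0s; move: (dot_col p v) => *; field.
Qed.

(** Currying reduces the claim to joint continuity in the parameters and the point. *)
Lemma wave_isometry_continuous : continuous (wave_isometry : mxpair -> {compact-open, 'rV[R]_N -> 'rV[R]_N}).
Proof.
apply: compact_open_curry.
have cM i j : continuous (fun z : mxpair * 'rV[R]_N => z.1.2 i j).
  by apply: continuous_entry => z; apply: continuous_comp; [exact: cvg_fst|exact: cvg_snd].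
have cC i j : continuous (fun z : mxpair * 'rV[R]_N => z.1.1 i j).
  by apply: continuous_entry => z; apply: continuous_comp; exact: cvg_fst.
have cx i : continuous (fun z : mxpair * 'rV[R]_N => z.2 0 i).
  by apply: continuous_entry => z; exact: cvg_snd.
have ct (g g1 : R -> R) : (forall t : R, is_derive t 1 g (g1 t)) ->
    continuous (fun z : mxpair * 'rV[R]_N => g (z.2 0 ti)).
  move=> dg z; apply: (@continuous_comp _ _ _ (fun z : mxpair * 'rV[R]_N => z.2 0 ti) g).
    exact: cx.
  exact: (is_derive_continuous dg).
have ccs k : continuous (fun z : mxpair * 'rV[R]_N => (cs (a k)).1 (z.2 0 ti)).
  by have [_ _ d _] := hcs (a k); exact: ct d.
have ccs1 k : continuous (fun z : mxpair * 'rV[R]_N => (cs (a k)).2 (z.2 0 ti)).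
  by have [_ _ _ d] := hcs (a k); exact: ct d.
have csn k : continuous (fun z : mxpair * 'rV[R]_N => (sn (a k)).1 (z.2 0 ti)).
  by have [_ _ d _] := hsn (a k); exact: ct d.
have csn1 k : continuous (fun z : mxpair * 'rV[R]_N => (sn (a k)).2 (z.2 0 ti)).
  by have [_ _ _ d] := hsn (a k); exact: ct d.
have cK (r : R) : continuous (fun _ : mxpair * 'rV[R]_N => r) by exact: cst_continuous.
have ca k : continuous (fun z : mxpair * 'rV[R]_N => heis_a z.1.2 k 0).
  by rewrite /heis_a; under eq_fun do rewrite !mxE; exact: cM.
have cb k : continuous (fun z : mxpair * 'rV[R]_N => heis_b z.1.2 k 0).
  by rewrite /heis_b; under eq_fun do rewrite !mxE; exact: cM.
have cc : continuous (fun z : mxpair * 'rV[R]_N => heis_c z.1.2).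
  by rewrite /heis_c; under eq_fun do rewrite !mxE; exact: cM.
have cX k : continuous (fun z : mxpair * 'rV[R]_N => xpart z.1.1 z.2 k).
  by apply: continuous_sumr => i; exact: continuousMr.
have cu k : continuous (fun z : mxpair * 'rV[R]_N =>
    sol (heis_a z.1.2) (heis_b z.1.2) k (z.2 0 ti)).
  by apply: continuousDr; exact: continuousMr.
have cu1 k : continuous (fun z : mxpair * 'rV[R]_N =>
    sol1 (heis_a z.1.2) (heis_b z.1.2) k (z.2 0 ti)).
  by apply: continuousDr; exact: continuousMr.
apply: continuous_mx => o q; rewrite ord1 /wave_isometry; case: (coordP q) => [||k].
- by under eq_fun do rewrite wave_map_t; exact: cx.
- under eq_fun do rewrite wave_map_s.
  apply: continuousDr; last first.
    apply: continuousDr; [exact: continuousMr|apply: continuousNr].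
    by apply: continuous_sumr => k; exact: continuousMr.
  apply: continuousDr; last first.
    by apply: continuousNr; apply: continuous_sumr => k; exact: continuousMr.
  apply: continuousDr; first exact: cx.
  apply: continuousNr; apply: continuousMr => //.
  by apply: continuous_sumr => k; exact: continuousMr.
- by under eq_fun do rewrite wave_map_x; apply: continuousDr; [exact: cX|exact: cu].
Qed.

Lemma wave_parameters_continuous : continuous (wave_parameters : {compact-open, 'rV[R]_N -> 'rV[R]_N} -> mxpair).
Proof.
pose T : topologicalType := {compact-open, 'rV[R]_N -> 'rV[R]_N}.
have ev x q : continuous (fun phi : T => phi x 0 q).
  by apply: continuous_entry; exact: compact_open_eval.
have cK (r : R) : continuous (fun _ : T => r) by exact: cst_continuous.
have cC k i : continuous (fun phi : T => phi (base_point i) 0 (xi k) - phi 0 0 (xi k)).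
  by apply: continuousDr; [exact: ev|apply: continuousNr; exact: ev].
have cp k : continuous (fun phi : T => phi 0 0 (xi k)) by exact: ev.
have cMC : continuous (fun phi : T => (wave_parameters phi).1).
  by apply: continuous_mx => k i; under eq_fun do rewrite mxE; exact: cC.
have cv k : continuous (fun phi : T => \sum_i (wave_parameters phi).1 k i *
    (- 2^-1 * (phi (base_point i) 0 si - phi 0 0 si))).
  apply: continuous_sumr => i; apply: continuousMr; first exact: continuous_entry.
  by apply: continuousMr => //; apply: continuousDr; [exact: ev|apply: continuousNr; exact: ev].
suff cMM : continuous (fun phi : T => (wave_parameters phi).2).
  by move=> phi; exact: (cvg_pair (cMC phi) (cMM phi)).
apply: continuous_heis_mx.
- by apply: continuous_mx => k o; under eq_fun do rewrite mxE; exact: ev.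
- apply: continuous_mx => k o; under eq_fun do rewrite mxE.
  exact: cv.
- apply: continuousDr; first by apply: continuousMr => //; exact: ev.
  apply: continuous_sumr => k; under eq_fun do rewrite mxE [X in _ * X]mxE.
  apply: continuousMr; first exact: ev.
  exact: cv.
Qed.

Let T : topologicalType := {compact-open, 'rV[R]_N -> 'rV[R]_N}.

Lemma block_SO1 : block_SO a 1%:M.
Proof. by case: (block_SO_subgroup a). Qed.

Lemma He1 : He (1%:M : 'M[R]_(1 + (m + 1))).
Proof. by exists 0, 0, 0; rewrite heis_mx1. Qed.

Lemma wave_isometry_isom0 z : H z -> G (wave_isometry z).
Proof.
move=> Hz; apply: (@connected_component_max T (Isom (wave_mx f a)) 
  [set wave_isometry y | y in H] idfun); last by exists z.
- exists (1%:M, heis_mx 0 0 0); last exact: wave_isometry1.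
  by split=> /=; [exact: block_SO1|exists 0, 0, 0].
- by move=> _ [y Hy <-]; exact: wave_isometry_isom.
- apply: connected_continuous_connected.
    exact: connected_setX (@block_SO_connected R m a) (@He_connected R m) block_SO1 He1.
  exact: continuous_subspaceT wave_isometry_continuous.
Qed.

Lemma isom0_isom phi : G phi -> smooth_map phi /\
  forall x, pullback_metric (wave_mx f a) phi x = wave_mx f a x.
Proof. by move=> /connected_component_sub[[psi [_ _ sphi _]] ?]. Qed.

Lemma isom0_connected : connected (G : set T).
Proof. exact: component_connected. Qed.

Lemma Isom_id : Isom (wave_mx f a) idfun.
Proof. by rewrite -wave_isometry1; apply: wave_isometry_isom; split; [exact: block_SO1|exists 0, 0, 0]. Qed.

Lemma isom0_id : G (idfun : T).
Proof. by apply: connected_component_refl; exact: Isom_id. Qed.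

Let e_t : 'rV[R]_N := delta_mx 0 ti.

Lemma eval_continuous x q : continuous (fun phi : T => phi x 0 q).
Proof. by apply: continuous_entry; exact: compact_open_eval. Qed.

Lemma e_t_t : e_t 0 ti = 1. Proof. by rewrite mxE !eqxx. Qed.

(** The scale and the shift of time are expressed by the values at [e_t] and 0, hence are continuous
    in the isometry. The scale keeps the sign it has at the identity; after that the shift is a
    period of [f] and stays 0. *)
Lemma isom0_time phi x : G phi -> phi x 0 ti = x 0 ti.
Proof.
have timeE psi y : G psi -> psi y 0 ti = (psi e_t 0 ti - psi 0 0 ti) * y 0 ti + psi 0 0 ti.
  move=> /isom0_isom[spsi psiP].
  have := isometry_timeE f_smooth f_nonconst a_neq0 spsi psiP.
  move=> h; rewrite h [in psi e_t 0 ti]h e_t_t mulr1; ring.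
have tsq psi : G psi -> (psi e_t 0 ti - psi 0 0 ti) ^+ 2 = 1.
  move=> /isom0_isom[spsi psiP].
  have := isometry_time_scale f_smooth f_nonconst a_sum0 a_neq0 spsi psiP.
  have := isometry_timeE f_smooth f_nonconst a_neq0 spsi psiP.
  by move=> h; rewrite [in psi e_t 0 ti]h e_t_t mulr1 addrK.
have t1 : forall psi : T, G psi -> psi e_t 0 ti - psi 0 0 ti = 1.
  apply: (connected_sign isom0_connected _ isom0_id) => //.
    by apply: continuousDr; [|apply: continuousNr]; exact: eval_continuous.
  by rewrite e_t_t mxE subr0.
have t0 : forall psi : T, G psi -> psi 0 0 ti = 0.
  apply: (connected_periods isom0_connected _ isom0_id _ f_nonconst).
  - exact: eval_continuous.
  - by rewrite mxE.
  - move=> psi Gpsi t; have [spsi psiP] := isom0_isom Gpsi.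
    have := isometry_time f_smooth f_nonconst a_sum0 a_neq0 spsi psiP t.
    suff -> : partial ti (fun y => psi y 0 ti) 0 = 1 by rewrite mul1r.
    have := isometry_timeE f_smooth f_nonconst a_neq0 spsi psiP e_t.
    by rewrite e_t_t mulr1 => /eqP; rewrite -subr_eq t1 // => /eqP.
by move=> Gphi; rewrite timeE // t1 // t0 // mul1r addr0.
Qed.

Lemma isom0_wave_map phi : G phi -> exists C u u1 c, [/\ C^T *m C = 1%:M, block_diagonal a C,
  forall k (t : R), is_derive t 1 (u k) (u1 k t),
  forall k (t : R), is_derive t 1 (u1 k) ((f t + a k) * u k t) &
  phi = wave_map C u u1 c].
Proof.
move=> Gphi; have [sphi phiP] := isom0_isom Gphi.
have phi0 : phi 0 0 ti = 0 by rewrite isom0_time // mxE.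
apply: (isometry_wave_map f_smooth f_nonconst a_sum0 a_neq0 sphi phiP) => //.
have := isometry_timeE f_smooth f_nonconst a_neq0 sphi phiP e_t.
by rewrite isom0_time // e_t_t mulr1 phi0 addr0.
Qed.

(** On every eigenspace the determinant is a sign that depends continuously on the isometry and
    equals 1 at the identity. *)
Lemma isom0_linear_part phi : G phi -> block_SO a (wave_parameters phi).1.
Proof.
have cL : continuous (fun phi : T => (wave_parameters phi).1).
  by move=> psi; apply: continuous_comp; [exact: wave_parameters_continuous|exact: cvg_fst].
have id1 : (wave_parameters (idfun : 'rV[R]_N -> 'rV[R]_N)).1 = 1%:M.
  by apply/matrixP => k i; rewrite !mxE /= coordE subr0.
have orth psi : G psi -> (wave_parameters psi).1^T *m (wave_parameters psi).1 = 1%:M /\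
    block_diagonal a (wave_parameters psi).1.
  move=> Gpsi; have [C [u [u1 [c [CC bC _ _ ->]]]]] := isom0_wave_map Gpsi.
  suff -> : (wave_parameters (wave_map C u u1 c)).1 = C by [].
  by apply/matrixP => k i; rewrite mxE !wave_map_x xpart0 xpart_base_point base_point_t mxE; ring.
have detb lam psi : G psi -> \det (eigen_block a lam (wave_parameters psi).1) = 1.
  move: psi; apply: (connected_sign isom0_connected _ isom0_id) => [|| psi Gpsi].
  - move=> psi; apply: continuous_comp; last exact: det_continuous.
    by apply: continuous_comp; [exact: cL|exact: eigen_block_continuous].
  - by rewrite id1 eigen_block1 det1.
  - have [CC bC] := orth psi Gpsi.
    by rewrite expr2 -{1}det_tr -det_mulmx -eigen_block_tr // -eigen_blockM ?CC
      ?eigen_block1 ?det1 //; exact: block_diagonal_tr.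
have det2 psi : G psi -> \det (wave_parameters psi).1 = 1.
  move: psi; apply: (connected_sign isom0_connected _ isom0_id) => [|| psi Gpsi].
  - by move=> psi; apply: continuous_comp; [exact: cL|exact: det_continuous].
  - by rewrite id1 det1.
  - by have [CC _] := orth psi Gpsi; rewrite expr2 -{1}det_tr -det_mulmx CC det1.
move=> Gphi; have [CC bC] := orth phi Gphi; split=> //; first by split=> //; exact: det2.
by move=> lam; exact: detb.
Qed.

Lemma isom0_wave_isometry phi : G phi -> exists2 z, H z & phi = wave_isometry z.
Proof.
move=> Gphi; have SC := isom0_linear_part Gphi; move: SC.
have [C [u [u1 [c [CC bC du du1 e]]]]] := isom0_wave_map Gphi.
have -> : (wave_parameters phi).1 = C.
  by rewrite e; apply/matrixP => k i; rewrite mxE !wave_map_x xpart0 xpart_base_point base_point_t mxE; ring.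
move=> SC; pose p : 'cV[R]_m := \col_k u k 0; pose v : 'cV[R]_m := \col_k u1 k 0.
(* The initial data determine [u] by uniqueness; the last entry solves $2 c' - \langle p, v \rangle
   = c$ for $c'$. *)
exists (C, heis_mx p v (2^-1 * (c + dot_col p v))).
  by split=> //=; exists p, v, (2^-1 * (c + dot_col p v)).
rewrite e /wave_isometry /= heis_mx_a heis_mx_b heis_mx_c.
have wc k : continuous (fun t => f t + a k).
  apply: continuousDr; last exact: cst_continuous.
  by move=> t; apply/differentiable_continuous/derivable1_diffP; exact: (@f_smooth 0%N).
have euv k : u k = sol p v k /\ u1 k = sol1 p v k.
  apply: (ode_solution_unique (wc k) (f_bounded_shift k)  _ (sol_ode p v k)).
  by split=> //; rewrite mxE.
have -> : u = sol p v by apply/funext => k; case: (euv k).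
have -> : u1 = sol1 p v by apply/funext => k; case: (euv k).
by congr wave_map; move: (dot_col p v) => r; field.
Qed.

Lemma isom0_isomorphic : topgroup_isomorphic G (fun phi psi => phi \o psi)
  H (@sdprod_He_mul R m).
Proof.
exists wave_parameters, wave_isometry; split.
- split=> [phi Gphi|z Hz|phi Gphi|z Hz].
  + by have [z Hz ->] := isom0_wave_isometry Gphi; rewrite wave_isometryK.
  + exact: wave_isometry_isom0.
  + by have [z Hz ->] := isom0_wave_isometry Gphi; rewrite wave_isometryK.
  + exact: wave_isometryK.
- move=> phi psi /isom0_wave_isometry[[C M] Hz ->] /isom0_wave_isometry[[C' M'] Hy ->].
  rewrite !wave_isometryK //; case: Hz Hy => /= SC [p [v [c ->]]] [/= SC' [p' [v' [c' ->]]]].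
  rewrite -wave_isometry_mul ?wave_isometryK //; [|exact: block_SO_orthogonal|by case: SC].
  split=> /=; first by case: (block_SO_subgroup a) => _ _ + _; apply.
  by rewrite heis_actE heis_mxM; do 3!eexists.
- exact: continuous_subspaceT wave_parameters_continuous.
- exact: continuous_subspaceT wave_isometry_continuous.
Qed.

End IsometryGroup.

Lemma wave_isom0_isomorphic (R : realType) (m : nat) (f : R -> R) (a : 'I_m -> R) :
  smooth_line f -> (exists t1 t2, f t1 != f t2) -> (exists M, forall t, `|f t| <= M) ->
  \sum_i a i = 0 -> (exists i, a i != 0) ->
  topgroup_isomorphic (Isom0 (wave_mx f a)) (fun phi psi => phi \o psi)
    (sdprod_He (block_SO a)) (@sdprod_He_mul R m).
Proof.
move=> f_smooth f_nonconst f_bounded a_sum0 a_neq0.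
have wc lam : continuous (fun t => f t + lam).
  apply: continuousDr; last exact: cst_continuous.
  by move=> t; apply/differentiable_continuous/derivable1_diffP; exact: (@f_smooth 0%N).
have wb lam : exists M, forall t, `|f t + lam| <= M.
  by have [M fM] := f_bounded; exists (M + `|lam|) => t;
    rewrite (le_trans (ler_normD _ _)) // lerD2r.
have ex (p v lam : R) : exists y : (R -> R) * (R -> R),
    ode_solution (fun t => f t + lam) p v y.1 y.2.
  by have [y [y1 h]] := ode_solution_exists (wc lam) (wb lam) p v; exists (y, y1).
have [cs hcs] := choice (ex 1 0); have [sn hsn] := choice (ex 0 1).
exact: (isom0_isomorphic f_smooth f_nonconst a_sum0 a_neq0 (fun k => wb (a k)) hcs hsn).
Qed.

(** * Constant profiles *)

Section ConstantProfile.
Variables (R : realType) (m : nat) (f : R -> R) (a : 'I_m -> R) (c : R).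
Hypothesis f_cst : f = cst c.
Notation N := (2 + m)%N.
Notation ti := (ti m).
Notation si := (si m).
Notation g := (wave_mx f a).
Implicit Types (x : 'rV[R]_N) (p q i j k l : 'I_N).

Definition theta p : R := (p == ti)%:R.
(** The gradient of $t$, which is $2 \partial_s$; [theta] is the covector $dt$. *)
Definition grad_t p : R := 2 * (p == si)%:R.
(** For constant $f$ the coordinate Hessian of $\kappa$ is constant and diagonal; these are its
    diagonal entries, zero in the directions $t$ and $s$. *)
Definition hess_coef p : R := \sum_r (p == xi r)%:R * (2 * (c + a r)).
Definition dkappa x p : R := hess_coef p * x 0 p.
Definition hess q p : R := hess_coef p * (q == p)%:R.

Lemma hess_coef_t : hess_coef ti = 0.
Proof. by rewrite /hess_coef big1 // => r _; rewrite coordE mul0r. Qed.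
Lemma hess_coef_s : hess_coef si = 0.
Proof. by rewrite /hess_coef big1 // => r _; rewrite coordE mul0r. Qed.

Lemma dkappa_t x : dkappa x ti = 0. Proof. by rewrite /dkappa hess_coef_t mul0r. Qed.
Lemma dkappa_s x : dkappa x si = 0. Proof. by rewrite /dkappa hess_coef_s mul0r. Qed.
Lemma theta_s : theta si = 0. Proof. by rewrite /theta coordE. Qed.

Lemma hessC q p : hess q p = hess p q.
Proof. by rewrite /hess [p == q]eq_sym; have [->|] := eqVneq q p => //; rewrite !mulr0. Qed.

Lemma hess_s p : hess si p = 0.
Proof. by rewrite hessC /hess hess_coef_s mul0r. Qed.

Lemma kappa_gradE x p : kappa_grad f a x p = dkappa x p.
Proof.
rewrite /dkappa; case: (coordP p) => [||i].
- rewrite hess_coef_t mul0r kappa_grad_t f_cst; under eq_bigr do rewrite derive1_cst mul0r.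
  by rewrite big1.
- by rewrite kappa_grad_s hess_coef_s mul0r.
- rewrite kappa_grad_x f_cst /hess_coef; under eq_bigr do rewrite coordE eq_sym.
  by rewrite (sum_delta (fun r => 2 * (c + a r))).
Qed.

Lemma smooth_cst : smooth_line f.
Proof.
have h n : exists r, derive1n n f = cst r.
  elim: n => [|n [r IH]]; first by exists c.
  by exists 0; rewrite derive1nS IH; apply/funext => t; rewrite derive1_cst.
by move=> n x; have [r ->] := h n; exact: derivable_cst.
Qed.

Lemma metric_mxE (k : R) p q : metric_mx m k p q = k * theta p * theta q + metric_mx m 0 p q.
Proof.
rewrite -!metric_form_unit /metric_form /unit_vec /theta ![ti == _]eq_sym.
by move: (\sum_i _) => r; ring.
Qed.

Lemma partial_wave l p q x : partial l (fun y => g y p q) x = dkappa x l * theta p * theta q.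
Proof.
apply: partialE; apply: (is_derive_ext (F := fun y =>
  theta p * theta q * wave_kappa f a y + metric_mx m 0 p q)).
  by move=> y; rewrite [RHS]metric_mxE; ring.
apply: (is_derive_eq (is_deriveDr (is_deriveZr _ (partial_kappa a smooth_cst l x))
  (is_derive_cst _ x _))).
by rewrite kappa_gradE addr0; ring.
Qed.

Lemma inv_wave x : invmx (g x) = inverse_mx m (wave_kappa f a x).
Proof.
have gK := inverse_mxK m (wave_kappa f a x); have [u _] := mulmx1_unit gK.
by rewrite -[RHS]mul1mx -(mulVmx u) -mulmxA gK mulmx1.
Qed.

Lemma raise_dkappa x k : \sum_l inverse_mx m (wave_kappa f a x) k l * dkappa x l = dkappa x k.
Proof.
rewrite sum_coord /dkappa hess_coef_t hess_coef_s !mul0r !mulr0 !add0r.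
under eq_bigr do rewrite inverse_mx_x.
case: (coordP k) => [||r].
- by rewrite hess_coef_t mul0r big1 // => r _; rewrite coordE mul0r.
- by rewrite hess_coef_s mul0r big1 // => r _; rewrite coordE mul0r.
under eq_bigr do rewrite coordE eq_sym.
exact: (sum_delta (fun r => hess_coef (xi r) * x 0 (xi r))).
Qed.

Lemma christoffelE k i j x : christoffel g k i j x =
  2^-1 * (grad_t k * (dkappa x i * theta j + dkappa x j * theta i)
    - theta i * theta j * dkappa x k).
Proof.
rewrite /christoffel inv_wave; congr (_ * _).
under eq_bigr do rewrite !partial_wave mulrBr.
rewrite sumrB -(raise_dkappa x k) mulr_sumr; congr (_ - _); last first.
  by apply: eq_bigr => l _; ring.
rewrite /grad_t -(inverse_mx_t (wave_kappa f a x)).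
rewrite -(sum_delta (inverse_mx m (wave_kappa f a x) k) ti) mulr_suml.
by apply: eq_bigr => l _; rewrite /theta; ring.
Qed.

Lemma partial_christoffel q k i j x : partial q (christoffel g k i j) x =
  2^-1 * (grad_t k * (hess q i * theta j + hess q j * theta i) - theta i * theta j * hess q k).
Proof.
have -> : christoffel g k i j = fun y : 'rV[R]_N =>
    (2^-1 * grad_t k * theta j * hess_coef i) * y 0 i
    + (2^-1 * grad_t k * theta i * hess_coef j) * y 0 j + (- 2^-1 * theta i * theta j * hess_coef k) * y 0 k.
  by apply/funext => y; rewrite christoffelE /dkappa; ring.
apply: partialE.
apply: (is_derive_eq (is_deriveDr (is_deriveDr (is_deriveZr _ (is_derive_coord i q x))
  (is_deriveZr _ (is_derive_coord j q x))) (is_deriveZr _ (is_derive_coord k q x)))).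
by rewrite /hess; ring.
Qed.

Lemma sum_theta (F : 'I_N -> R) : \sum_p theta p * F p = F ti.
Proof. exact: sum_delta. Qed.

Lemma sum_grad_t (F : 'I_N -> R) : \sum_p grad_t p * F p = 2 * F si.
Proof. by rewrite -sum_delta mulr_sumr; apply: eq_bigr => p _; rewrite mulrA. Qed.

Lemma sum_christoffel i j x (F : 'I_N -> R) :
  \sum_p christoffel g p i j x * F p =
  (dkappa x i * theta j + dkappa x j * theta i) * F si
  - 2^-1 * theta i * theta j * \sum_p dkappa x p * F p.
Proof.
have -> : (dkappa x i * theta j + dkappa x j * theta i) * F si =
    2^-1 * (dkappa x i * theta j + dkappa x j * theta i) * (2 * F si) by field.
rewrite -sum_grad_t !mulr_sumr -sumrB; apply: eq_bigr => p _.
by rewrite christoffelE; ring.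
Qed.

(** The result is symmetric in [i] and [j], so the quadratic terms drop out of the curvature, which
    becomes linear in the Hessian of $\kappa$. *)
Lemma christoffel2 l k i j x : \sum_p christoffel g l i p x * christoffel g p j k x =
  - (2^-1 * theta j * theta k * (2^-1 * grad_t l * theta i * \sum_p dkappa x p * dkappa x p)).
Proof.
under eq_bigr do rewrite mulrC.
have sK : \sum_p dkappa x p * theta p = 0.
  by under eq_bigr do rewrite mulrC; rewrite sum_theta dkappa_t.
rewrite sum_christoffel christoffelE dkappa_s theta_s !(mul0r, mulr0, oppr0, subr0, addr0, sub0r).
congr (- (_ * _)).
under eq_bigr do rewrite christoffelE.
transitivity (\sum_p (2^-1 * grad_t l * theta i * (dkappa x p * dkappa x p)
   + 2^-1 * (grad_t l * dkappa x i - theta i * dkappa x l) * (dkappa x p * theta p))).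
  by apply: eq_bigr => p _; ring.
by rewrite big_split /= -!mulr_sumr sK mulr0 addr0.
Qed.

Lemma curvature_upE l k i j x : curvature_up g l k i j x =
  2^-1 * (grad_t l * (hess i k * theta j - hess j k * theta i)
    - theta k * (theta j * hess i l - theta i * hess j l)).
Proof.
rewrite /curvature_up !partial_christoffel sumrB !christoffel2 (hessC j i); ring.
Qed.

Lemma metric_grad_t x l : \sum_p g x l p * grad_t p = theta l.
Proof.
under eq_bigr do rewrite mulrC; rewrite sum_grad_t /wave_mx -metric_form_unit.
rewrite /metric_form /unit_vec !coordE big1 => [|r _]; last by rewrite coordE mulr0.
by rewrite /theta [l == _]eq_sym !natr_bool; move: (ti == l)%:R (si == l)%:R => *; field.
Qed.

Lemma metric_hess x i l : \sum_p g x l p * hess i p = hess i l.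
Proof.
transitivity (\sum_p (p == i)%:R * (g x l i * hess_coef i)).
  apply: eq_bigr => p _; rewrite /hess eq_sym; have [->|] := eqVneq p i.
    by rewrite mulr1 mul1r.
  by rewrite mulr0 mulr0 mul0r.
rewrite sum_delta /hess.
case: (coordP i) => [||r]; rewrite ?hess_coef_t ?hess_coef_s ?mulr0.
- rewrite /hess_coef; case: eqP => [<-|_]; last by rewrite mulr0.
  by rewrite -/(hess_coef ti) hess_coef_t mul0r.
- case: eqP => [<-|_]; last by rewrite mulr0.
  by rewrite hess_coef_s mul0r.
rewrite /wave_mx -metric_form_unit /metric_form /unit_vec !coordE.
under eq_bigr do rewrite coordE mulrC.
rewrite (sum_delta (fun r => (xi r == l)%:R)) !natr_bool.
by rewrite !mulr0 addr0 mulr0 !add0r mulrC; case: eqP => [->|] //; rewrite !mulr0.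
Qed.

Lemma curvatureE l k i j x : curvature g l k i j x =
  2^-1 * (theta l * (hess i k * theta j - hess j k * theta i)
    - theta k * (theta j * hess i l - theta i * hess j l)).
Proof.
rewrite /curvature; under eq_bigr do rewrite curvature_upE.
rewrite -{1}(metric_grad_t x l) -(metric_hess x i l) -(metric_hess x j l).
rewrite mulr_suml !mulr_sumr -sumrB mulr_sumr -sumrB mulr_sumr.
by apply: eq_bigr => p _; ring.
Qed.

Definition hess_dkappa x q := hess_coef q * dkappa x q.

(** Contraction with [dkappa] annihilates [theta], as [dkappa] has no $t$ component, and turns
    [hess i] into [hess_dkappa i]. In each slot the curvature is a combination of such terms. *)
Lemma sum_dkappa x (r s t : R) i j F :
  (forall p, F p = r * theta p + s * hess i p + t * hess j p) ->
  \sum_p dkappa x p * F p =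
  s * hess_dkappa x i + t * hess_dkappa x j.
Proof.
move=> eF; under eq_bigr do rewrite eF.
have sh q : \sum_p dkappa x p * hess q p = hess_dkappa x q.
  rewrite -(sum_delta (hess_dkappa x) q); apply: eq_bigr => p _.
  by rewrite /hess /hess_dkappa eq_sym; ring.
have sK : \sum_p dkappa x p * theta p = 0.
  by under eq_bigr do rewrite mulrC; rewrite sum_theta dkappa_t.
transitivity (\sum_p (r * (dkappa x p * theta p) + s * (dkappa x p * hess i p)
  + t * (dkappa x p * hess j p))).
  by apply: eq_bigr => p _; ring.
by rewrite !big_split /= -!mulr_sumr sK !sh mulr0 add0r.
Qed.

(* The components of the curvature are constant, and the four Christoffel terms
   of its covariant derivative cancel in pairs. *)
Lemma wave_locally_symmetric : locally_symmetric g.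
Proof.
move=> q l k i j x; rewrite /nabla4.
have -> : partial q (curvature g l k i j) x = 0.
  have -> : curvature g l k i j = cst (curvature g l k i j x).
    by apply/funext => y; rewrite /= !curvatureE.
  exact: partialE (is_derive_cst _ _ _).
rewrite !big_split /= !sum_christoffel !curvatureE !hess_s !(hessC _ si) !hess_s theta_s.
have e1 : \sum_p dkappa x p * curvature g p k i j x =
    - 2^-1 * theta k * theta j * hess_dkappa x i + 2^-1 * theta k * theta i * hess_dkappa x j.
  apply: (@sum_dkappa x (2^-1 * (hess i k * theta j - hess j k * theta i))) => p.
  by rewrite curvatureE; ring.
have e2 : \sum_p dkappa x p * curvature g l p i j x =
    2^-1 * theta l * theta j * hess_dkappa x i + - 2^-1 * theta l * theta i * hess_dkappa x j.
  apply: (@sum_dkappa x (- 2^-1 * (theta j * hess i l - theta i * hess j l))) => p.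
  by rewrite curvatureE; ring.
have e3 : \sum_p dkappa x p * curvature g l k p j x =
    2^-1 * theta l * theta j * hess_dkappa x k + - 2^-1 * theta k * theta j * hess_dkappa x l.
  apply: (@sum_dkappa x (2^-1 * (theta k * hess j l - theta l * hess j k))) => p.
  by rewrite curvatureE (hessC p k) (hessC p l); ring.
have e4 : \sum_p dkappa x p * curvature g l k i p x =
    - 2^-1 * theta l * theta i * hess_dkappa x k + 2^-1 * theta k * theta i * hess_dkappa x l.
  apply: (@sum_dkappa x (2^-1 * (theta l * hess i k - theta k * hess i l))) => p.
  by rewrite curvatureE (hessC p k) (hessC p l); ring.
by rewrite e1 e2 e3 e4 !(mul0r, mulr0, subr0, oppr0, add0r, addr0, sub0r); ring.
Qed.

End ConstantProfile.

(** * Orthonormal eigenbases *)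

(** The trace of the hypothesis refers to the arbitrary basis [vbasis]; expanding each basis in the
    other carries it to the eigenbasis. *)
Lemma trace_basis_indep (F : fieldType) (V : vectType F) (A : 'End(V)) p q
    (X : p.-tuple V) (Y : q.-tuple V) : basis_of fullv X -> basis_of fullv Y ->
  \sum_i coord X i (A X`_i) = \sum_k coord Y k (A Y`_k).
Proof.
move=> bX bY; transitivity (\sum_(i < p) \sum_(k < q) coord Y k X`_i * coord X i (A Y`_k)).
  apply: eq_bigr => i _; rewrite [in LHS](coord_basis bY (memvf X`_i)) !linear_sum.
  by apply: eq_bigr => k _; rewrite !linearZ.
rewrite exchange_big; apply: eq_bigr => k _.
rewrite [in RHS](coord_basis bX (memvf (A Y`_k))) linear_sum.
by apply: eq_bigr => i _; rewrite linearZ /= mulrC.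
Qed.

#[local] Transparent ti si xi metric_mx wave_kappa.

Section OrthonormalEigenbasis.
Variables (R : realType) (m : nat) (V : vectType R) (ip : {dot V for idfun}).
Variables (f : R -> R) (A : 'End(V)) (e : m.-tuple V) (a : 'I_m -> R).
Hypothesis dimV : \dim {:V} = m.
Hypothesis e_orthonormal : forall i j : 'I_m, ip e`_i e`_j = (i == j)%:R.
Hypothesis e_eigen : forall i : 'I_m, A e`_i = a i *: e`_i.
Implicit Types (c d : 'I_m -> R).

Lemma ip_sum c d : ip (\sum_i c i *: e`_i) (\sum_i d i *: e`_i) = \sum_i c i * d i.
Proof.
rewrite linear_sumlz; apply: eq_bigr => i _; rewrite linearZl_LR linear_sumr /=; congr (_ * _).
rewrite -[RHS]sum_delta; apply: eq_bigr => j _.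
by rewrite linearZr_LR /= e_orthonormal eq_sym mulrC.
Qed.

Lemma orthonormal_free : free e.
Proof.
apply/freeP => k k0 i.
have := ip_sum k (fun j => (j == i)%:R); rewrite k0 linear0l.
by under eq_bigr do rewrite mulrC; rewrite sum_delta => <-.
Qed.

Lemma orthonormal_basis : basis_of fullv e.
Proof. by rewrite basisEfree orthonormal_free subvf dimV size_tuple leqnn. Qed.

Lemma eigen_sum c : A (\sum_i c i *: e`_i) = \sum_i (c i * a i) *: e`_i.
Proof. by rewrite linear_sum; apply: eq_bigr => i _; rewrite linearZ /= e_eigen scalerA. Qed.

Lemma end_mx_eigen : end_mx A e = diag_mx (\row_i a i).
Proof.
apply/matrixP => i j; rewrite !mxE e_eigen linearZ /= coord_free ?orthonormal_free //.
by rewrite eq_sym; have [->|] := eqVneq i j; rewrite ?mulr1 // mulr0.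
Qed.

Lemma end_trace_eigen : end_trace A = \sum_i a i.
Proof.
rewrite /end_trace /mxtrace; under eq_bigr do rewrite mxE.
rewrite (trace_basis_indep A (vbasisP _) orthonormal_basis).
by apply: eq_bigr => i _; rewrite e_eigen linearZ /= coord_free ?orthonormal_free // eqxx mulr1.
Qed.

Lemma end_eigen_neq0 : A != 0 -> exists i, a i != 0.
Proof.
apply: contra_neqP => /forallNP a0; apply/lfunP => v; rewrite lfunE.
rewrite (coord_basis orthonormal_basis (memvf v)) eigen_sum big1 // => i _.
by have /negP := a0 i; rewrite negbK => /eqP ->; rewrite mulr0 scale0r.
Qed.

Lemma wave_metricE : wave_metric ip f A e = wave_mx f a.
Proof.
apply/funext => x; rewrite /wave_metric /wave_mx /metric_mx.
have -> : kappa ip f A e x = wave_kappa f a x.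
  rewrite /kappa /coord_psi eigen_sum !ip_sum /wave_kappa mulr_sumr -big_split.
  by apply: eq_bigr => i _ /=; rewrite /coord_t /ti /xi; ring.
by congr block_mx; apply/matrixP => i j; rewrite !mxE e_orthonormal.
Qed.

Lemma mem_leigenspace lam v : (v \in passmx.leigenspace A lam) = (A v == lam *: v).
Proof.
by rewrite memv_ker !(add_lfunE, opp_lfunE, scale_lfunE, id_lfunE) subr_eq0.
Qed.

Lemma leigenspace_simple :
  (exists lam, (1 < \dim (passmx.leigenspace A lam))%N) <-> ~ simple_spectrum a.
Proof.
split=> [[lam dlam] inj|/existsNP[i /existsNP[j /not_implyP[aij ij]]]].
  have coordv v k : v \in passmx.leigenspace A lam -> (a k - lam) * coord e k v = 0.
    rewrite mem_leigenspace => /eqP Av; rewrite mulrBl; apply/eqP; rewrite subr_eq0; apply/eqP.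
    have := congr1 (coord e k) Av; rewrite [RHS]linearZ /= => <-.
    rewrite [in RHS](coord_basis orthonormal_basis (memvf v)) eigen_sum.
    by rewrite coord_sum_free ?orthonormal_free // mulrC.
  (* With distinct eigenvalues, membership in the eigenspace of [lam] leaves at most one coordinate
     free, so the eigenspace lies in the span of one vector, possibly zero. *)
  suff [w Ew] : exists w, (passmx.leigenspace A lam <= <[w]>)%VS.
    by have := leq_trans dlam (dimvS Ew); rewrite dim_vline; case: (w != 0).
  have [[i ai]|/forallNP ne] := pselect (exists i, a i = lam).
    exists e`_i; apply/subvP => v /coordv vk.
    apply/vlineP; exists (coord e i v).
    rewrite {1}(coord_basis orthonormal_basis (memvf v)) (bigD1 i) //= big1 ?addr0 // => j ji.
    have /eqP := vk j; rewrite mulf_eq0 subr_eq0 => /orP[/eqP aj|/eqP ->]; last by rewrite scale0r.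
    by move: ji; rewrite (inj j i) ?eqxx // aj ai.
  exists 0; apply/subvP => v /coordv vk.
  rewrite (coord_basis orthonormal_basis (memvf v)) big1 ?mem0v // => j _.
  have /eqP := vk j; rewrite mulf_eq0 subr_eq0 => /orP[/eqP aj|/eqP ->]; last by rewrite scale0r.
  by have := ne j.
have ei0 (k : 'I_m) : e`_k != 0.
  by apply: free_not0 orthonormal_free _; rewrite mem_nth ?size_tuple.
exists (a i); rewrite ltnNge; apply/negP => dle.
have si : (<[e`_i]> <= passmx.leigenspace A (a i))%VS.
  by rewrite -memvE mem_leigenspace e_eigen.
(* An eigenspace of dimension at most 1 would be the line through $e_i$ and contain $e_j$, against
   orthonormality. *)
have : e`_j \in <[e`_i]>%VS.
  suff /eqP -> : (<[e`_i]> == passmx.leigenspace A (a i))%VS by rewrite mem_leigenspace e_eigen aij.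
  by rewrite eqEdim si dim_vline ei0.
case/vlineP => k ejk; have := e_orthonormal j j.
have -> : ip e`_j e`_j = k * ip e`_i e`_j by rewrite {1}ejk linearZl_LR.
rewrite e_orthonormal eqxx; move/eqP: ij => /negPf ->.
by rewrite mulr0 => /eqP; rewrite eq_sym oner_eq0.
Qed.

End OrthonormalEigenbasis.

#[local] Opaque ti si xi metric_mx wave_kappa.

Theorem theorem5 (R : realType) (n : nat) (hn : (4 <= n)%N)
    (V : vectType R) (hV : \dim {:V} = (n - 2)%N) (ip : {dot V for idfun})
    (f : R -> R) (f_smooth : smooth_line f)
    (f_periodic : exists2 p : R, p != 0 & periodic f p)
    (A : 'End(V)) (A_neq0 : A != 0) (A_traceless : end_trace A = 0)
    (A_selfadjoint : forall u v : V, ip (A u) v = ip u (A v))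
    (e : (n - 2).-tuple V)
    (e_orthonormal : forall i j : 'I_(n - 2), ip e`_i e`_j = (i == j)%:R)
    (e_eigen : forall i : 'I_(n - 2), exists a : R, A e`_i = a *: e`_i)
    (hW : essentially_parallel_weyl (wave_metric ip f A e)) :
  let s := centralizer_algebra (end_mx A e) in
  let S := centralizer_group (end_mx A e) in
  [/\ connected_lie_subgroup (@SO R (n - 2)) S,
      lie_algebra_of S = s,
      topgroup_isomorphic (Isom0 (wave_metric ip f A e)) (fun phi psi => phi \o psi)
        (sdprod_He S) (@sdprod_He_mul R (n - 2))
    & (s <> [set 0] <-> exists a : R, (1 < \dim (passmx.leigenspace A a))%N) /\
      (S <> [set 1%:M] <-> exists a : R, (1 < \dim (passmx.leigenspace A a))%N)].
Proof.
have [a Ae] := choice e_eigen => s S.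
have f_cont : continuous f.
  by move=> t; apply/differentiable_continuous/derivable1_diffP; exact: (@f_smooth 0%N).
have f_bounded : exists M : R, forall t, `|f t| <= M.
  by have [p p0 fp] := f_periodic; exact: periodic_bounded fp.
(* A constant profile would make the metric locally symmetric, which [hW] excludes. *)
have f_nonconst : exists t1 t2, f t1 != f t2.
  have [_ _] := hW; rewrite (wave_metricE f e_orthonormal Ae); apply: contra_notP => h.
  apply: (@wave_locally_symmetric _ _ _ _ (f 0)); apply/funext => t /=.
  by apply/eqP; apply: contra_notT h => ft; exists t, 0.
have a_sum0 : \sum_i a i = 0 by rewrite -(end_trace_eigen hV e_orthonormal Ae).
have a_neq0 := end_eigen_neq0 hV e_orthonormal Ae A_neq0.
have eS : S = block_SO a by rewrite /S (end_mx_eigen e_orthonormal Ae) centralizer_groupE.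
have es : s = centralizer_algebra (diag_mx (\row_i a i)).
  by rewrite /s (end_mx_eigen e_orthonormal Ae).
have simpleE := leigenspace_simple hV e_orthonormal Ae.
rewrite eS es; split.
- exact: block_SO_connected_lie_subgroup.
- exact: block_SO_lie_algebra.
- by rewrite (wave_metricE f e_orthonormal Ae); exact: wave_isom0_isomorphic.
- by split; rewrite simpleE ?block_SO_trivial ?centralizer_algebra_trivial.
Qed.
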